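(* Let $\Omega\subset\mathbb{R}^2$ be an open, bounded set with smooth boundary. There exists $\alpha_0>0$ such that for every $\alpha\in(0,\alpha_0)$ there is a constant $C_*=C_*(\alpha,\Omega)>0$ with $$\mathrm{TM}(\alpha,\Omega)-\mathscr{E}_{\alpha,\Omega}(u)\ \ge\ C_*\inf_{v\in\mathcal{M}_\alpha(\Omega)}\|\nabla u-\nabla v\|_{L^2(\Omega)}^2\qquad\text{for all }u\in\overline{\mathcal{B}}_1 .$$
   Context: For $\alpha\in(0,4\pi]$ and $u\in W^{1,2}_0(\Omega)$ set $\mathscr{E}_{\alpha,\Omega}(u)=\int_\Omega e^{\alpha u^2}\,dx$ and $\mathrm{TM}(\alpha,\Omega)=\sup\{\mathscr{E}_{\alpha,\Omega}(u): u\in W^{1,2}_0(\Omega),\ \|\nabla u\|_{L^2(\Omega)}\le 1\}$, which is finite for $0\le\alpha\le4\pi$. $\overline{\mathcal{B}}_1=\{u\in W^{1,2}_0(\Omega):\|\nabla u\|_{L^2(\Omega)}\le1\}$. $\mathcal{M}_\alpha(\Omega)$ is the set of optimizers, i.e. of $v\in W^{1,2}_0(\Omega)$ with $\|\nabla v\|_{L^2(\Omega)}\le1$ and $\mathscr{E}_{\alpha,\Omega}(v)=\mathrm{TM}(\alpha,\Omega)$. *)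

(* Defs.v *)
From HB Require Import structures.
From mathcomp Require Import all_boot all_order all_algebra.
From mathcomp Require Import all_classical all_reals all_analysis.

Set Implicit Arguments.
Unset Strict Implicit.
Unset Printing Implicit Defensive.

Import Order.TTheory GRing.Theory Num.Theory.
Import numFieldNormedType.Exports.

Local Open Scope classical_set_scope.
Local Open Scope ring_scope.

Section Smooth.
Context {R : realType}.

(* [false] is the first coordinate direction, [true] the second one. *)
Definition basis2 (i : bool) : R * R := if i then (0, 1) else (1, 0).

Definition partial (i : bool) (f : R * R -> R) : R * R -> R :=
  fun x => 'D_(basis2 i) f x.

Definition gradient (f : R * R -> R) : R * R -> R * R :=
  fun x => (partial false f x, partial true f x).

Definition iter_partial (s : seq bool) (f : R * R -> R) : R * R -> R :=
  foldr partial f s.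

(* C^oo on the plane: all iterated partial derivatives exist and are
   continuous.  Existence is required explicitly because ['D_v f x] is a
   total operator. *)
Definition smooth2 (f : R * R -> R) : Prop :=
  forall s : seq bool,
    continuous (iter_partial s f) /\
    forall (i : bool) (x : R * R), derivable (iter_partial s f) x (basis2 i).

Definition smooth1 (f : R -> R) : Prop :=
  forall (n : nat) (x : R), derivable (derive1n n f) x 1.

(* Near each boundary point, after possibly relabelling and reorienting the
   coordinate axes, Omega is the region strictly above the graph of a C^oo
   function.  [swap] exchanges the two axes, [flip] reverses the vertical one. *)
Definition smooth_boundary (Omega : set (R * R)) : Prop :=
  forall x : R * R, (closure Omega `\` interior Omega) x ->
  exists (swap flip : bool) (gamma : R -> R), smooth1 gamma /\
    \forall y \near x,
      let s := if swap then y.2 else y.1 in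
      let t := if swap then y.1 else y.2 in
      Omega y <-> gamma s < (if flip then - t else t).

(* C_c^oo(Omega), extended by zero to the whole plane. *)
Definition test_function (Omega : set (R * R)) (phi : R * R -> R) : Prop :=
  [/\ smooth2 phi, compact (closure [set x | phi x != 0]) &
      closure [set x | phi x != 0] `<=` Omega].

End Smooth.

Section Sobolev.
Context {R : realType}.

Definition lebesgue2 :
    {measure set (measurableTypeR R * measurableTypeR R) -> \bar R} :=
  (@lebesgue_measure R \x @lebesgue_measure R)%E.

Definition euclid (p : R * R) : R := Num.sqrt (p.1 ^+ 2 + p.2 ^+ 2).

Definition L2norm (Omega : set (R * R)) (f : R * R -> R) : \bar R :=
  ('N[lebesgue2]_2%:E[(EFin \o f) \_ Omega])%E.

Definition L2norm_vec (Omega : set (R * R)) (F : R * R -> R * R) : \bar R :=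
  L2norm Omega (fun x => euclid (F x)).

Definition in_L2 (Omega : set (R * R)) (f : R * R -> R) : Prop :=
  measurable_fun (Omega : set (measurableTypeR R * measurableTypeR R)) f /\
  (L2norm Omega f < +oo)%E.

Definition weak_gradient (Omega : set (R * R))
    (u : R * R -> R) (g : R * R -> R * R) : Prop :=
  forall phi : R * R -> R, test_function Omega phi ->
    (\int[lebesgue2]_(x in Omega) (u x * partial false phi x)%:E =
      - \int[lebesgue2]_(x in Omega) ((g x).1 * phi x)%:E)%E /\
    (\int[lebesgue2]_(x in Omega) (u x * partial true phi x)%:E =
      - \int[lebesgue2]_(x in Omega) ((g x).2 * phi x)%:E)%E.

(* W^{1,2}(Omega).  An element is represented by a function together with a
   weak gradient (which the function determines almost everywhere on Omega).
   Representatives are not quotiented by a.e. equality: everything below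
   depends only on the a.e. classes of the restrictions to Omega. *)
Record W12 (Omega : set (R * R)) : Type := MkW12 {
  W12_fun :> R * R -> R;
  grad : R * R -> R * R;
  W12_fun_L2 : in_L2 Omega W12_fun;
  grad1_L2 : in_L2 Omega (fun x => (grad x).1);
  grad2_L2 : in_L2 Omega (fun x => (grad x).2);
  grad_weak : weak_gradient Omega W12_fun grad }.

(* W_0^{1,2}(Omega): closure of C_c^oo(Omega) in the W^{1,2} norm. *)
Definition W012 (Omega : set (R * R)) : set (W12 Omega) :=
  [set u : W12 Omega | forall e : R, 0 < e ->
    exists phi : R * R -> R, [/\ test_function Omega phi,
      (L2norm Omega (fun x => u x - phi x)%R < e%:E)%E &
      (L2norm_vec Omega (fun x => grad u x - gradient phi x)%R < e%:E)%E]].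

Definition energy (alpha : R) (Omega : set (R * R)) (u : W12 Omega) : \bar R :=
  (\int[lebesgue2]_(x in Omega) (expR (alpha * u x ^+ 2))%:E)%E.

Definition unit_ball (Omega : set (R * R)) : set (W12 Omega) :=
  [set u : W12 Omega | W012 u /\ (L2norm_vec Omega (grad u) <= 1)%E].

Definition TM (alpha : R) (Omega : set (R * R)) : \bar R :=
  ereal_sup [set energy alpha u | u in @unit_ball Omega].

Definition optimizers (alpha : R) (Omega : set (R * R)) : set (W12 Omega) :=
  [set v : W12 Omega | unit_ball v /\ energy alpha v = TM alpha Omega].

End Sobolev.

(* Main.v *)
(* After dividing by alpha the deficit concerns J_a(u) = \int (e^{a u^2} - 1)/a,
   a small perturbation of \int u^2. If no constant works for arbitrarily
   small a, compare u with a maximizer v of J_a and expand along h = u - v: the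
   Euler-Lagrange equation and the constraint leave a normalised direction h,
   asymptotically orthogonal to v, with
     \int h^2 + O(a) \int v^2 h^2 >= \int v^2 e^{a v^2} - o(a).
   As a -> 0, v tends to a first Dirichlet eigenfunction v0 that maximizes
   \int u^4 on the unit sphere of the first eigenspace E, h tends to h0 in E
   orthogonal to v0, and the right-hand side is at least
   lam + (a/2) \int v0^4 - o(a), whereas \int h^2 <= lam.

   The contradiction comes from v0 h0 = 0 a.e. As E is stable under absolute
   values, it is stable under cutting off |v0| by the sign of an eigenfunction;
   cutting |v0| in two pieces and using the strict convexity of s^2 + t^2 on
   s + t = 1 shows that a quartic maximizer cannot be split, so every element
   of E has constant sign on the support of v0. No connectedness of Omega and no
   boundary regularity is involved.

   The Trudinger inequality is obtained from the Gagliardo-Nirenberg inequality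
   |w|_2^2 <= |d1 w|_1 |d2 w|_1 applied to truncations of u, which makes the
   measures of the superlevel sets of u decay like a Gaussian. Compactness is
   expressed by convergence along a fixed ultrafilter on nat, which replaces
   every extraction of subsequences. *)
Require Import Defs.
From HB Require Import structures.
From mathcomp Require Import all_boot all_order all_algebra.
From mathcomp Require Import all_classical all_reals all_analysis.
From mathcomp Require Import measurable_realfun ring lra.
Set Implicit Arguments.
Unset Strict Implicit.
Unset Printing Implicit Defensive.
Import Order.TTheory GRing.Theory Num.Theory.
Import numFieldNormedType.Exports.
Local Open Scope classical_set_scope.
Local Open Scope ring_scope.

(** * Integrals of real functions *)

(** The first eigenspace may have dimension greater than one. At order zero in [a] the comparison
    between [h] and [v] then only reads [lam <= lam], so the contradiction has to be found in the
    coefficient of [a], and every error, including the defect of orthogonality allowed to [h], must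
    be o(a). The two limits are taken one after the other. At fixed [a], points that violate the
    inequality with constants 1/(n+1) form a maximizing sequence, because they violate it against
    one fixed maximizer at distance at most 2. They converge strongly to some maximizer, and it is
    this limit, found after the points, that is compared with them; no nearest maximizer has to be
    selected. Only then does [a] tend to 0. The study of [J a] takes place in an abstract space of
    functions with a semi-inner product. The Dirichlet space enters through four facts: an
    exponential integrability bound, completeness, L2 compactness, and approximate stability under
    absolute values. The exponent 1/256 of the first is far from sharp, which only affects the size
    of [alpha0]. *)

Lemma psd_CS (R : realFieldType) (A B C : R) :
  (forall s t, 0 <= s ^+ 2 * A + 2 * s * t * B + t ^+ 2 * C) -> B ^+ 2 <= A * C.
Proof.
move=> pos.
have A0 : 0 <= A by have := pos 1 0; lra.
have C0 : 0 <= C by have := pos 0 1; lra.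
have [C1|C1] := ltP 0 C; first by have := pos C (- B); nra.
have {}C1 : C = 0 by apply/le_anti/andP.
rewrite C1 in pos *.
rewrite mulr0; have [->|B0] := eqVneq B 0; first by rewrite expr0n.
(* With [C = 0] the form is affine in [t], and this [t] gives it the value -1. *)
have := pos 1 (- (A + 1) / (2 * B)).
rewrite expr1n !mul1r mulr1 mulr0 addr0.
have -> : 2 * (- (A + 1) / (2 * B)) * B = - (A + 1) by field.
by rewrite opprD addrA subrr sub0r oppr_ge0 ler10.
Qed.

Section RealIntegrals.
Context {R : realType} d {T : measurableType d}.
Variables (mu : {measure set T -> \bar R}) (D : set T).
Hypothesis mD : measurable D.
Implicit Types f g h : T -> R.

Definition itg f := mu.-integrable D (EFin \o f).
(** Defaults to 0 when the integral is infinite, so comparisons have to be accompanied by [itg]. *)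
Definition Int f : R := \int[mu]_(x in D) f x.

Lemma itg_meas f : itg f -> measurable_fun D f.
Proof. by move=> /measurable_int /measurable_EFinP. Qed.

Lemma itg_dom f g : measurable_fun D f -> itg g ->
  (forall x, D x -> `|f x| <= g x) -> itg f.
Proof.
move=> mf ig fg; apply: (le_integrable mD _ _ ig).
  exact/measurable_EFinP.
by move=> x Dx /=; rewrite lee_fin (le_trans (fg x Dx)) ?ler_norm.
Qed.

Lemma itgD f g : itg f -> itg g -> itg (fun x => f x + g x).
Proof.
move=> hf hg; have := integrableD mD hf hg; apply: eq_integrable => // x _.
Qed.

Lemma itgZ a f : itg f -> itg (fun x => a * f x).
Proof.
by move=> hf; have := integrableZl mD a hf; apply: eq_integrable.
Qed.

Lemma itgB f g : itg f -> itg g -> itg (fun x => f x - g x).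
Proof.
move=> hf hg; have := integrableB mD hf hg; apply: eq_integrable => // x _.
Qed.

Lemma itg_norm f : itg f -> itg (fun x => `|f x|).
Proof. exact: integrable_norm. Qed.

Lemma eq_itg f g : (forall x, D x -> f x = g x) -> itg f -> itg g.
Proof.
move=> fg; apply: eq_integrable => // x /set_mem Dx.
by rewrite /= fg.
Qed.

Lemma eq_Int f g : (forall x, D x -> f x = g x) -> Int f = Int g.
Proof. by move=> fg; apply: eq_Rintegral => x /set_mem Dx; exact: fg. Qed.

Lemma IntD f g : itg f -> itg g -> Int (fun x => f x + g x) = Int f + Int g.
Proof. by move=> hf hg; rewrite /Int RintegralD. Qed.

Lemma IntB f g : itg f -> itg g -> Int (fun x => f x - g x) = Int f - Int g.
Proof. by move=> hf hg; rewrite /Int RintegralB. Qed.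

Lemma IntZ a f : itg f -> Int (fun x => a * f x) = a * Int f.
Proof. by move=> hf; rewrite /Int RintegralZl. Qed.

Lemma Int_le f g : itg f -> itg g -> (forall x, D x -> f x <= g x) ->
  Int f <= Int g.
Proof. by move=> hf hg fg; exact: le_Rintegral. Qed.

Lemma Int_ge0 f : (forall x, D x -> 0 <= f x) -> 0 <= Int f.
Proof. by move=> f0; exact: Rintegral_ge0. Qed.

Lemma Int_lin2 a f b g : itg f -> itg g ->
  Int (fun x => a * f x + b * g x) = a * Int f + b * Int g.
Proof. by move=> hf hg; rewrite IntD ?IntZ//; exact: itgZ. Qed.

Lemma Int_fin f : itg f -> (\int[mu]_(x in D) (f x)%:E)%E = (Int f)%:E.
Proof. by move=> hf; rewrite fineK//; exact: integrable_fin_num. Qed.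

Lemma itg_ge0 f : measurable_fun D f -> (forall x, D x -> 0 <= f x) ->
  (\int[mu]_(x in D) (f x)%:E < +oo)%E -> itg f.
Proof.
move=> mf f0 foo; apply/integrableP; split; first exact/measurable_EFinP.
rewrite (eq_integral (EFin \o f)) // => x /set_mem Dx /=.
by rewrite ger0_norm// f0.
Qed.

Lemma itgM f g : measurable_fun D f -> measurable_fun D g ->
  itg (fun x => f x ^+ 2) -> itg (fun x => g x ^+ 2) ->
  itg (fun x => f x * g x).
Proof.
move=> mf mg f2 g2; apply: itg_dom (itgD f2 g2) _.
  exact: measurable_funM.
move=> x _; rewrite normrM -(real_normK (num_real (f x))) -(real_normK (num_real (g x))).
have : 0 <= (`|f x| - `|g x|) ^+ 2 by exact: sqr_ge0.
have := mulr_ge0 (normr_ge0 (f x)) (normr_ge0 (g x)).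
nra.
Qed.

Lemma Int_CS f g : measurable_fun D f -> measurable_fun D g ->
  itg (fun x => f x ^+ 2) -> itg (fun x => g x ^+ 2) ->
  Int (fun x => f x * g x) ^+ 2 <=
  Int (fun x => f x ^+ 2) * Int (fun x => g x ^+ 2).
Proof.
move=> mf mg f2 g2.
have fg := itgM mf mg f2 g2.
apply: psd_CS => s t.
set A := Int (fun x => f x ^+ 2); set B := Int (fun x => _ * _).
set C := Int (fun x => g x ^+ 2).
have -> : s ^+ 2 * A + 2 * s * t * B + t ^+ 2 * C =
      Int (fun x => (s * f x + t * g x) ^+ 2).
    rewrite -(IntZ _ f2) -(IntZ _ fg) -(IntZ _ g2) -IntD; try exact: itgZ.
    rewrite -IntD; [|apply: itgD; exact: itgZ|exact: itgZ].
    by apply: eq_Int => x _; ring.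
by apply: Int_ge0 => x _; exact: sqr_ge0.
Qed.

Lemma Int_eq0_ae f : itg f -> (forall x, D x -> 0 <= f x) -> Int f = 0 ->
  {ae mu, forall x, D x -> f x = 0}.
Proof.
move=> hf f0 If0.
have : (\int[mu]_(x in D) `|(EFin \o f) x| = 0)%E.
  rewrite (eq_integral (EFin \o f)).
    by have := Int_fin hf; rewrite If0.
  by move=> x /set_mem Dx /=; rewrite ger0_norm// f0.
move/(ae_eq_integral_abs mu mD (measurable_int _ hf)).
by apply: filterS => x /[apply] /= -[].
Qed.

Lemma Int_ae f g : itg f -> itg g -> {ae mu, forall x, D x -> f x = g x} ->
  Int f = Int g.
Proof.
move=> hf hg fg; congr fine; apply: ae_eq_integral => //.
- exact: (measurable_int _ hf).
- exact: (measurable_int _ hg).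
- by apply: filterS fg => x /[apply] /= ->.
Qed.

Lemma Int_set0 f : D = set0 -> Int f = 0.
Proof. by move=> D0; rewrite /Int D0 Rintegral_set0. Qed.

Lemma Int_eq0 f : (forall x, D x -> f x = 0) -> Int f = 0.
Proof.
by move=> f0; rewrite /Int /Rintegral integral0_eq// => x Dx; rewrite f0.
Qed.

Lemma Int_norm_le f : itg f -> `|Int f| <= Int (fun x => `|f x|).
Proof. exact: le_normr_Rintegral. Qed.

Lemma Int_dct (f_ : nat -> T -> R) g :
  (forall n, measurable_fun D (f_ n)) -> itg g ->
  (forall n x, D x -> `|f_ n x| <= g x) ->
  (forall x, D x -> f_ n x @[n --> \oo] --> 0) ->
  Int (f_ n) @[n --> \oo] --> 0.
Proof.
move=> mf ig fg f0.
have [] := @dominated_convergence _ _ _ mu D mD (fun n => EFin \o f_ n)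
  (cst 0%E) (EFin \o g) => //.
- by move=> n; apply/measurable_EFinP.
- apply: aeW => x Dx; apply: cvg_EFin; first by apply: nearW => n.
  exact: f0.
- by apply: aeW => x n Dx; rewrite lee_fin fg.
- by rewrite integral0 => _ _ /fine_cvg.
Qed.

End RealIntegrals.

(** * Plane calculus *)

Section Plane.
Context {R : realType}.
Notation plane := (measurableTypeR R * measurableTypeR R)%type.
Notation mu1 := (@lebesgue_measure R).
Notation mu2 := (@lebesgue2 R).

(** The sigma-algebra of [plane] is a product, not the one generated by the topology. An open set is
    the union of the countably many half-open boxes with rational corners that it contains. *)
Lemma open_measurable2 (A : set (R * R)) : open A -> measurable (A : set plane).
Proof.
move=> oA.
pose box (k : (rat * rat) * (rat * rat)) : set plane :=
  `]ratr k.1.1, ratr k.1.2[%classic `*` `]ratr k.2.1, ratr k.2.2[%classic.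
pose F k : set plane := if `[< box k `<=` A >] then box k else set0.
suff AF : A = \bigcup_k F k.
  rewrite AF; apply: countable_bigcupT_measurable => // k; rewrite /F.
  by case: ifP => // _; apply: measurableX.
apply/seteqP; split => [[x y] Axy|z [k _]]; last first.
  by rewrite /F; case: asboolP => // h; exact: h.
have := oA; rewrite openE => /(_ _ Axy).
rewrite /interior => /nbhs_ballP[e /= e0 ball_A].
have near (t : R) : exists p q, [/\ t - e < ratr p, ratr p < t, t < ratr q & ratr q < t + e].
  have h1 : t - e < t by rewrite ltrBlDr ltrDl.
  have h2 : t < t + e by rewrite ltrDl.
  have [p] := rat_in_itvoo h1; have [q] := rat_in_itvoo h2.
  by rewrite !in_itv/= => /andP[? ?] /andP[? ?]; exists p, q.
have [p1 [q1 [h1 h2 h3 h4]]] := near x; have [p2 [q2 [h5 h6 h7 h8]]] := near y.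
exists ((p1, q1), (p2, q2)) => //; rewrite /F; case: asboolP => [_|[]].
  by split => /=; rewrite in_itv/= ?h2 ?h6.
move=> [s t] [/=]; rewrite !in_itv/= => /andP[s1 s2] /andP[t1 t2].
by apply: ball_A; split; rewrite /ball/= ltr_norml; apply/andP; split; lra.
Qed.

Lemma continuous_measurable2 (g : R * R -> R) (D : set plane) : measurable D ->
  continuous g -> measurable_fun D (g : plane -> R).
Proof.
move=> mD cg; apply: measurable_funTS.
apply: (measurability _ (RGenOpens.measurableE R)) => _ [_ [a [b ->] <-]].
rewrite setTI; apply: open_measurable2.
by apply: open_comp; [move=> x _; exact: cg|exact: interval_open].
Qed.

Lemma lebesgue2_rect (A B : set (measurableTypeR R)) : measurable A -> measurable B ->
  mu2 (A `*` B) = (mu1 A * mu1 B)%E.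
Proof. by move=> mA mB; exact: product_measure1E. Qed.

Lemma itg_bounded d (T : measurableType d) (mu : {measure set T -> \bar R})
    (D : set T) (g : T -> R) M : measurable D -> (mu D < +oo)%E ->
  measurable_fun D g -> (forall x, D x -> `|g x| <= M) -> itg mu D g.
Proof.
move=> mD Doo mg gM; apply: measurable_bounded_integrable => //.
exists M; split; first exact: num_real.
by move=> y My x Dx /=; rewrite (le_trans (gM x Dx))// ltW.
Qed.

Lemma compact_bound (g : R * R -> R) (Q : set (R * R)) : continuous g -> compact Q ->
  exists M, forall z, Q z -> `|g z| <= M.
Proof.
move=> cg cQ; have : compact (g @` Q).
  by apply: continuous_compact => //; exact: continuous_subspaceT.
move=> /compact_bounded[M [_ hM]]; exists (M + 1) => z Qz.
by apply: (hM (M + 1)); [rewrite ltrDl|exists z].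
Qed.

Definition rect (a b c d : R) : set plane := `[a, b[%classic `*` `[c, d[%classic.

Lemma rect_measurable a b c d : measurable (rect a b c d).
Proof. exact: measurableX. Qed.

Lemma rect_bound (g : R * R -> R) a b c d : continuous g ->
  exists M, forall z, rect a b c d z -> `|g z| <= M.
Proof.
move=> cg; have cQ : compact (`[a, b]%classic `*` `[c, d]%classic : set (R * R)).
  by apply: compact_setX; exact: segment_compact.
have [M hM] := compact_bound cg cQ; exists M => -[x y] [/= Ix Jy].
apply: hM; split => /=; [move: Ix|move: Jy]; rewrite /= !in_itv/= => /andP[-> /ltW].
  by [].
by [].
Qed.

Lemma rect_finite a b c d : (mu2 (rect a b c d) < +oo)%E.
Proof.
rewrite lebesgue2_rect//= !lebesgue_measure_itv/=.
by case: ifP => _; case: ifP => _; rewrite ?mul0e ?mule0 -?EFinD -?EFinM ?ltry.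
Qed.

Lemma itg_rect (g : R * R -> R) a b c d : continuous g -> itg mu2 (rect a b c d) g.
Proof.
move=> cg; have [M hM] := rect_bound a b c d cg.
apply: itg_bounded hM; [exact: rect_measurable|exact: rect_finite|].
by apply: continuous_measurable2 => //; exact: rect_measurable.
Qed.

Lemma itg_itv (g : R -> R) (a b : R) : continuous g -> itg mu1 `[a, b[%classic g.
Proof.
move=> cg; have : itg mu1 `[a, b]%classic g.
  apply: continuous_compact_integrable; first exact: segment_compact.
  exact: continuous_subspaceT.
apply: integrableS => //.
by move=> x /=; rewrite !in_itv/= => /andP[-> /ltW].
Qed.

Section Fubini.
Variables (I J : set (measurableTypeR R)) (g : plane -> R).
Hypotheses (mI : measurable I) (mJ : measurable J).
Hypothesis ig : itg mu2 (I `*` J) g.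

Let f : plane -> \bar R := (EFin \o g) \_ (I `*` J).

Let mIJ : measurable (I `*` J : set plane).
Proof. exact: measurableX. Qed.

Let fint : mu2.-integrable setT f.
Proof. by have := (integrable_mkcond (EFin \o g) mIJ).1 ig. Qed.

Let Int2 : Int mu2 (I `*` J) g = fine (\int[mu2]_z f z)%E.
Proof. by rewrite /Int /Rintegral integral_mkcond. Qed.

(** Integrability is required of every slice and not of almost every one, so that the inner integral
    is a real function defined everywhere, without an exceptional set. All later integrands are
    continuous. *)
Lemma fubini_rect1 : (forall x, I x -> itg mu1 J (fun y => g (x, y))) ->
  itg mu1 I (fun x => Int mu1 J (fun y => g (x, y))) /\
  Int mu2 (I `*` J) g = Int mu1 I (fun x => Int mu1 J (fun y => g (x, y))).
Proof.
move=> gx.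
have FE : fubini_F mu1 f = (fun x => (Int mu1 J (fun y => g (x, y)))%:E) \_ I.
  apply/funext => x; rewrite /fubini_F /f patchE.
  case: ifPn => [/set_mem Ix|/negP nIx].
    rewrite -Int_fin//; last exact: gx.
    rewrite [RHS]integral_mkcond; apply: eq_integral => y _.
    rewrite !patchE; congr (if _ then _ else _).
    apply/idP/idP => [/set_mem[/= _ Jy]|/set_mem Jy]; [exact/mem_set|].
    by apply/mem_set.
  rewrite [RHS](_ : _ = 0%E)//.
  apply: integral0_eq => y _; rewrite patchE; case: ifPn => // /set_mem[/= Ix _].
  by case: nIx; apply/mem_set.
split.
  apply/integrable_mkcond => //; rewrite -FE.
  exact: (@integrable_fubini_F _ _ _ _ _ mu1 mu1 f fint).
rewrite Int2 /lebesgue2 -(@integral12_prod_meas1 _ _ _ _ _ mu1 mu1 f fint).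
by rewrite FE -integral_mkcond.
Qed.

Lemma fubini_rect2 : (forall y, J y -> itg mu1 I (fun x => g (x, y))) ->
  itg mu1 J (fun y => Int mu1 I (fun x => g (x, y))) /\
  Int mu2 (I `*` J) g = Int mu1 J (fun y => Int mu1 I (fun x => g (x, y))).
Proof.
move=> gx.
have GE : fubini_G mu1 f = (fun y => (Int mu1 I (fun x => g (x, y)))%:E) \_ J.
  apply/funext => y; rewrite /fubini_G /f patchE.
  case: ifPn => [/set_mem Jy|/negP nJy].
    rewrite -Int_fin//; last exact: gx.
    rewrite [RHS]integral_mkcond; apply: eq_integral => x _.
    rewrite !patchE; congr (if _ then _ else _).
    apply/idP/idP => [/set_mem[/= Ix _]|/set_mem Ix]; [exact/mem_set|].
    by apply/mem_set.
  rewrite [RHS](_ : _ = 0%E)//.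
  apply: integral0_eq => x _; rewrite patchE; case: ifPn => // /set_mem[/= _ Jy].
  by case: nJy; apply/mem_set.
split.
  apply/integrable_mkcond => //; rewrite -GE.
  have mf : measurable_fun setT f := measurable_int _ fint.
  apply/integrableP; split; first exact: (@measurable_fubini_G _ _ _ _ _ mu1 mu1 f fint).
  apply: le_lt_trans ((@integrable21ltyP _ _ _ _ _ mu1 mu1 f mf).1 fint).
  apply: ge0_le_integral => //.
  - apply: measurableT_comp => //.
    exact: (@measurable_fubini_G _ _ _ _ _ mu1 mu1 f fint).
  - apply: (@measurable_fun_fubini_tonelli_G _ _ _ _ _ mu1 (abse \o f)) => //=.
    exact: measurableT_comp.
  - by move=> y _; apply: le_abse_integral => //; exact: measurableT_comp.
rewrite Int2 /lebesgue2 -(@integral21_prod_meas1 _ _ _ _ _ mu1 mu1 f fint).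
by rewrite GE -integral_mkcond.
Qed.

End Fubini.

End Plane.

(** * Partial derivatives along coordinate lines, and a smoothed absolute value *)

Section Slices.
Context {R : realType}.
Implicit Types (f g w : R * R -> R) (z : R * R) (i : bool).

Definition coord i z : R := if i then z.2 else z.1.
Definition line i z (s : R) : R * R := if i then (z.1, s) else (s, z.2).

Lemma line_coord i z : line i z (coord i z) = z.
Proof. by case: i; case: z. Qed.

Lemma line_line i z s t : line i (line i z s) t = line i z t.
Proof. by case: i. Qed.

Lemma coord_line i z s : coord i (line i z s) = s.
Proof. by case: i. Qed.

Lemma line_continuous i z : continuous (line i z).
Proof.
by move=> s; case: i; [exact: (cvg_pair (cvg_cst _) cvg_id)|
  exact: (cvg_pair cvg_id (cvg_cst _))].
Qed.

Lemma sliceE f z i :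
  (fun h : R => h^-1 *: ((f \o shift z) (h *: basis2 i) - f z)) =
  (fun h : R => h^-1 *: (((fun s => f (line i z s)) \o shift (coord i z)) (h *: (1 : R))
     - f (line i z (coord i z)))).
Proof.
apply/funext => h; rewrite line_coord; congr (_ *: (f _ - _)).
case: i z => -[x y]; congr pair => /=.
- by rewrite scaler0 add0r.
- by rewrite scaler0 add0r.
Qed.

(** The two difference quotients are the same function, so the one-variable rules of differentiation
    apply to [partial]. *)
Lemma sliceP f z i (df : R) :
  is_derive (coord i z) 1 (fun s => f (line i z s)) df <->
  derivable f z (basis2 i) /\ partial i f z = df.
Proof.
split=> [[dv <-]|[dv <-]]; rewrite /partial /derivable /derive sliceE.
  by split.
by split => //; rewrite /derivable -sliceE.
Qed.

Lemma partialP f z i df : is_derive (coord i z) 1 (fun s => f (line i z s)) df ->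
  derivable f z (basis2 i) /\ partial i f z = df.
Proof. by move/sliceP. Qed.

(** [iter_partial] adds new derivatives on the outside. Here the first derivative is peeled off from
    the inside, so that closure under sums, products and inverse square roots goes by induction on
    the order. *)
Fixpoint Ck n f : Prop := continuous f /\
  if n is m.+1 then forall i, (forall z, derivable f z (basis2 i)) /\ Ck m (partial i f)
  else True.

Lemma Ck_continuous n f : Ck n f -> continuous f. Proof. by case: n => [[]|n []]. Qed.

Lemma iter_partial_rcons s i f :
  iter_partial (rcons s i) f = iter_partial s (partial i f).
Proof. by rewrite /iter_partial foldr_rcons. Qed.

Lemma smooth2_partial f i : smooth2 f -> smooth2 (partial i f).
Proof. by move=> sf s; rewrite -iter_partial_rcons; exact: sf. Qed.

Lemma smooth2_continuous f : smooth2 f -> continuous f.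
Proof. by move=> /(_ [::])[]. Qed.

Lemma smooth2_derivable f i z : smooth2 f -> derivable f z (basis2 i).
Proof. by move=> /(_ [::])[_]; exact. Qed.

Lemma smooth2P f : smooth2 f <-> forall n, Ck n f.
Proof.
split=> [sf n|cf s].
  elim: n f sf => [|n IH] f sf /=; split; try exact: smooth2_continuous.
    by [].
  move=> i; split; first by move=> z; exact: smooth2_derivable.
  by apply: IH; exact: smooth2_partial.
elim/last_ind: s f cf => [|s i IH] f cf.
  by split => [|i z]; [exact: Ck_continuous (cf 0%N)|exact: ((cf 1%N).2 i).1].
rewrite iter_partial_rcons; apply: IH => n.
by case: (cf n.+1) => _ /(_ i)[].
Qed.

Lemma CkW n f : Ck n.+1 f -> Ck n f.
Proof.
elim: n f => [|n IH] f; first by case.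
by move=> [cf df]; split => // i; have [d1 /IH d2] := df i.
Qed.

Lemma partial_is_derive f z i : derivable f z (basis2 i) ->
  is_derive (coord i z) 1 (fun s => f (line i z s)) (partial i f z).
Proof. by move=> df; apply/sliceP. Qed.

Lemma Ck_step n f (df : bool -> R * R -> R) : continuous f ->
  (forall i z, is_derive (coord i z) 1 (fun s => f (line i z s)) (df i z)) ->
  (forall i, Ck n (df i)) -> Ck n.+1 f.
Proof.
move=> cf hd hC; split => // i.
have e : partial i f = df i by apply/funext => z; have [] := partialP (hd i z).
by rewrite e; split => // z; have [] := partialP (hd i z).
Qed.

Lemma CkD n f g : Ck n f -> Ck n g -> Ck n (fun z => f z + g z).
Proof.
elim: n f g => [|n IH] f g cf cg.
  by split => // z; apply: cvgD; [exact: cf.1|exact: cg.1].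
apply: (Ck_step (df := fun i z => partial i f z + partial i g z)).
- by move=> z; apply: cvgD; [exact: cf.1|exact: cg.1].
- move=> i z.
  have d1 := partial_is_derive ((cf.2 i).1 z).
  have d2 := partial_is_derive ((cg.2 i).1 z).
  exact: is_deriveD.
- by move=> i; apply: IH; [exact: (cf.2 i).2|exact: (cg.2 i).2].
Qed.

Lemma Ck_cst n (c : R) : Ck n (fun=> c).
Proof.
elim: n c => [|n IH] c; first by split => // z; exact: cvg_cst.
apply: (Ck_step (df := fun _ _ => 0)).
- by move=> z; exact: cvg_cst.
- by move=> i z; exact: is_derive_cst.
- by move=> i; exact: IH.
Qed.

Lemma CkM n f g : Ck n f -> Ck n g -> Ck n (fun z => f z * g z).
Proof.
elim: n f g => [|n IH] f g cf cg.
  by split => // z; apply: cvgM; [exact: cf.1|exact: cg.1].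
apply: (Ck_step (df := fun i z => f z * partial i g z + g z * partial i f z)).
- by move=> z; apply: cvgM; [exact: cf.1|exact: cg.1].
- move=> i z.
  have d1 := partial_is_derive ((cf.2 i).1 z).
  have d2 := partial_is_derive ((cg.2 i).1 z).
  have := is_deriveM d1 d2; rewrite !line_coord; exact.
- move=> i; apply: CkD; apply: IH; [exact: CkW|exact: (cg.2 i).2|exact: CkW|].
  exact: (cf.2 i).2.
Qed.

Lemma smooth2D f g : smooth2 f -> smooth2 g -> smooth2 (fun z => f z + g z).
Proof.
by move=> /smooth2P sf /smooth2P sg; apply/smooth2P => n; exact: CkD.
Qed.

Lemma smooth2M f g : smooth2 f -> smooth2 g -> smooth2 (fun z => f z * g z).
Proof.
by move=> /smooth2P sf /smooth2P sg; apply/smooth2P => n; exact: CkM.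
Qed.

Lemma smooth2_cst (c : R) : smooth2 (fun=> c).
Proof. by apply/smooth2P => n; exact: Ck_cst. Qed.

Section SmoothAbs.
Variables (f : R * R -> R) (e : R).
Hypothesis e0 : 0 < e.

Let q z := f z ^+ 2 + e ^+ 2.
Let q0 z : 0 < q z. Proof. by rewrite ltr_wpDl ?sqr_ge0// exprn_gt0. Qed.
Let W z := (Num.sqrt (q z))^-1.

Let W_continuous : continuous f -> continuous W.
Proof.
move=> cf z; apply: cvgV; first by rewrite gt_eqF// sqrtr_gt0.
apply: (@continuous_comp _ _ _ q Num.sqrt); last exact: sqrt_continuous.
apply: cvgD; last exact: cvg_cst.
by rewrite /=; apply: cvgM; exact: cf.
Qed.

(* With [W = (f^2 + e^2)^(-1/2)] one has [dW = - f W^3 df], so that [W] is as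
   smooth as [f]. *)
Let CkWfun n : Ck n f -> Ck n W.
Proof.
elim: n => [|n IH] cf; first by split => //; exact: W_continuous cf.1.
apply: (Ck_step (df := fun i z => (- 1) * (f z * (W z * (W z * W z))) * partial i f z)).
- exact: W_continuous cf.1.
- move=> i z; have d1 := partial_is_derive ((cf.2 i).1 z).
  have hq : is_derive (coord i z) 1 (fun s => q (line i z s)) (2 * f z * partial i f z).
    rewrite /q; apply: is_derive_eq.
    by rewrite line_coord /GRing.scale/= addr0; ring.
  have hs : is_derive (q z) 1 (@Num.sqrt R) (2 * Num.sqrt (q z))^-1.
    exact: is_derive1_sqrt.
  have hc : is_derive (coord i z) 1 (fun s => Num.sqrt (q (line i z s)))
     ((2 * Num.sqrt (q z))^-1 * (2 * f z * partial i f z)).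
    have hs' : is_derive (q (line i z (coord i z))) 1 (@Num.sqrt R) (2 * Num.sqrt (q z))^-1.
      by rewrite line_coord.
    exact: (@is_derive1_comp _ (@Num.sqrt R) (fun s => q (line i z s))).
  have sn0 : Num.sqrt (q (line i z (coord i z))) != 0.
    by rewrite line_coord gt_eqF// sqrtr_gt0.
  have := @is_deriveV _ (fun s => Num.sqrt (q (line i z s))) (coord i z) _ 1 sn0 hc.
  rewrite line_coord => h; apply: is_derive_eq.
  have s0 : Num.sqrt (q z) != 0 by rewrite gt_eqF// sqrtr_gt0.
  by rewrite /W /GRing.scale/=; field.
- move=> i; have cfn := CkW cf; have cW := IH cfn.
  apply: CkM; last exact: (cf.2 i).2.
  by apply: CkM; [exact: Ck_cst|do ?apply: CkM].
Qed.

(** A smooth substitute for the absolute value of [f]. Subtracting [e] makes it vanish wherever [f]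
    does, so that compact supports inside [Omega] are kept. *)
Definition smooth_abs z := Num.sqrt (f z ^+ 2 + e ^+ 2) - e.

Lemma smooth_abs_smooth : smooth2 f -> smooth2 smooth_abs.
Proof.
move=> sf; have sW : smooth2 W.
  by apply/smooth2P => n; apply: CkWfun; exact: (smooth2P f).1.
have -> : smooth_abs = (fun z => (f z * f z + e ^+ 2) * W z + (- e)).
  apply/funext => z; have s0 : Num.sqrt (q z) != 0 by rewrite gt_eqF// sqrtr_gt0.
  have -> : f z * f z + e ^+ 2 = Num.sqrt (q z) * Num.sqrt (q z).
    by rewrite -[RHS]expr2 sqr_sqrtr ?(ltW (q0 z)).
  by rewrite /W mulfK.
apply: smooth2D; last exact: smooth2_cst.
apply: smooth2M => //; apply: smooth2D; last exact: smooth2_cst.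
exact: smooth2M.
Qed.

(** The derivative is that of [f] times [f / sqrt (f^2 + e^2)], a factor of modulus at most 1. Hence
    the Dirichlet energy does not increase. *)
Lemma smooth_abs_partial i z : smooth2 f ->
  `|partial i smooth_abs z| <= `|partial i f z|.
Proof.
move=> sf; have d1 := partial_is_derive (smooth2_derivable (i := i) (z := z) sf).
have hq : is_derive (coord i z) 1 (fun s => q (line i z s)) (2 * f z * partial i f z).
  rewrite /q; apply: is_derive_eq.
  by rewrite line_coord /GRing.scale/= addr0; ring.
have hs' : is_derive (q (line i z (coord i z))) 1 (@Num.sqrt R) (2 * Num.sqrt (q z))^-1.
  by rewrite line_coord; exact: is_derive1_sqrt.
have hc := @is_derive1_comp _ (@Num.sqrt R) (fun s => q (line i z s)) _ _ _ hs' hq.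
have hc' : is_derive (coord i z) 1 (fun s => smooth_abs (line i z s))
   ((2 * Num.sqrt (q z))^-1 * (2 * f z * partial i f z)).
  by rewrite -[X in is_derive _ _ _ X]subr0; apply: is_deriveB.
have [_ ->] := partialP hc'.
have s0 : 0 < Num.sqrt (q z) by rewrite sqrtr_gt0.
have -> : (2 * Num.sqrt (q z))^-1 * (2 * f z * partial i f z) =
  (f z / Num.sqrt (q z)) * partial i f z by field; rewrite gt_eqF.
rewrite normrM ler_piMl// normrM normfV (gtr0_norm s0) ler_pdivrMr// mul1r.
by rewrite -sqrtr_sqr ler_wsqrtr// lerDl sqr_ge0.
Qed.

Lemma smooth_abs_close z : `|smooth_abs z - `|f z| | <= e.
Proof.
have s0 : 0 <= Num.sqrt (q z) by exact: sqrtr_ge0.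
have ss : Num.sqrt (q z) ^+ 2 = `|f z| ^+ 2 + e ^+ 2.
  by rewrite sqr_sqrtr ?(ltW (q0 z))// /q real_normK ?num_real.
have -> : smooth_abs z = Num.sqrt (q z) - e by [].
move: (Num.sqrt (q z)) (`|f z|) s0 ss (normr_ge0 (f z)) => s a s0 ss a0.
have h1 : a <= s by rewrite -ler_sqr ?nnegrE// ss lerDl sqr_ge0.
have h2 : s <= a + e.
  rewrite -ler_sqr ?nnegrE ?addr_ge0 ?(ltW e0)// ss sqrrD.
  by rewrite lerD2r lerDl mulrn_wge0// mulr_ge0// ltW.
by rewrite ler_norml; apply/andP; split; lra.
Qed.

Lemma smooth_abs0 z : f z = 0 -> smooth_abs z = 0.
Proof. by move=> fz; rewrite /smooth_abs fz expr0n add0r sqrtr_sqr gtr0_norm// subrr. Qed.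

End SmoothAbs.
End Slices.

(** * The fundamental theorem of calculus on slices and the Gagliardo-Nirenberg inequality *)

Section C1.
Context {R : realType}.
Notation plane := (measurableTypeR R * measurableTypeR R)%type.
Notation mu1 := (@lebesgue_measure R).
Notation mu2 := (@lebesgue2 R).

Lemma is_derive1_continuous (F f : R -> R) :
  (forall x : R, is_derive x (1 : R) F (f x)) -> continuous F.
Proof.
move=> h x; apply: differentiable_continuous; apply/derivable1_diffP.
by case: (h x).
Qed.

Lemma FTC2 (F f : R -> R) a b : a <= b -> continuous f ->
  (forall x : R, is_derive x (1 : R) F (f x)) -> Int mu1 `[a, b[%classic f = F b - F a.
Proof.
move=> ab cf hF.
have -> : Int mu1 `[a, b[%classic f = Int mu1 `[a, b]%classic f.
  by apply: Rintegral_itv_bndo_bndc; exact: itg_itv.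
move: ab; rewrite le_eqVlt => /predU1P[<-|ab].
  by rewrite set_itv1 /Int Rintegral_set1 subrr.
rewrite /Int /Rintegral (continuous_FTC2 (F := F)) //=.
- exact: continuous_subspaceT.
- have cF := is_derive1_continuous hF.
  split; first by move=> x _; case: (hF x).
  + exact/cvg_at_right_filter/cF.
  + exact/cvg_at_left_filter/cF.
- by move=> x _; rewrite derive1E; case: (hF x).
Qed.

Lemma diff_le_Int (F f : R -> R) a b s t : continuous f ->
  (forall x : R, is_derive x (1 : R) F (f x)) ->
  a <= s <= b -> a <= t <= b ->
  `|F s - F t| <= Int mu1 `[a, b[%classic (fun x => `|f x|).
Proof.
move=> cf hF.
wlog ts : s t / t <= s => [hw|] sab tab.
  have [/hw h|/ltW /hw h] := leP t s; first exact: h.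
  by rewrite distrC; exact: h.
have cn : continuous (fun x => `|f x|).
  by move=> x; apply: continuous_comp; [exact: cf|exact: norm_continuous].
rewrite -(FTC2 ts cf hF).
have mts : measurable (`[t, s[%classic : set (measurableTypeR R)) by [].
apply: (le_trans (Int_norm_le mts (itg_itv t s cf))).
have sub : `[t, s[%classic `<=` (`[a, b[%classic : set R).
  move=> x /=; rewrite !in_itv/=; move: sab tab => /andP[_ sb] /andP[ta _] /andP[tx xs].
  by rewrite (le_trans ta tx) (lt_le_trans xs sb).
rewrite /Int /Rintegral fine_le//.
- by apply: integrable_fin_num => //; exact: itg_itv.
- by apply: integrable_fin_num => //; exact: itg_itv.
- apply: ge0_subset_integral => //.
  by apply: measurable_int; exact: (itg_itv a b cn).
Qed.

Definition C1 (w : R * R -> R) (dw : bool -> R * R -> R) := [/\ continuous w,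
  forall i, continuous (dw i) &
  forall i z, is_derive (coord i z) 1 (fun s => w (line i z s)) (dw i z)].

Lemma C1_smooth f : smooth2 f -> C1 f (fun i => partial i f).
Proof.
move=> sf; split; first exact: smooth2_continuous.
  by move=> i; apply: smooth2_continuous; exact: smooth2_partial.
by move=> i z; apply: partial_is_derive; exact: smooth2_derivable.
Qed.

Lemma C1M f df g dg : C1 f df -> C1 g dg ->
  C1 (fun z => f z * g z) (fun i z => f z * dg i z + g z * df i z).
Proof.
move=> [cf cdf hf] [cg cdg hg]; split.
- by move=> z; apply: cvgM; [exact: cf|exact: cg].
- move=> i z; apply: cvgD; apply: cvgM; [exact: cf|exact: cdg|exact: cg|exact: cdf].
- by move=> i z; have := is_deriveM (hf i z) (hg i z); rewrite !line_coord; exact.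
Qed.

Lemma C1_comp f df (h h' : R -> R) : C1 f df -> continuous h' ->
  (forall x : R, is_derive x (1 : R) h (h' x)) ->
  C1 (fun z => h (f z)) (fun i z => h' (f z) * df i z).
Proof.
move=> [cf cdf hf] ch hh; split.
- move=> z; apply: (@continuous_comp _ _ _ f h); [exact: cf|].
  exact: is_derive1_continuous hh _.
- move=> i z; apply: cvgM; last exact: cdf.
  by apply: (@continuous_comp _ _ _ f h'); [exact: cf|exact: ch].
- move=> i z; have hz : is_derive (f (line i z (coord i z))) (1 : R) h (h' (f z)).
    by rewrite line_coord; exact: hh.
  exact: (@is_derive1_comp _ h (fun s => f (line i z s)) _ _ _ hz (hf i z)).
Qed.

Lemma C1_slice w dw i z : C1 w dw ->
  continuous (fun s => dw i (line i z s)) /\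
  forall s : R, is_derive s (1 : R) (fun s => w (line i z s)) (dw i (line i z s)).
Proof.
move=> [cw cdw hw]; split.
  move=> s; apply: (@continuous_comp _ _ _ (line i z) (dw i)).
    exact: line_continuous.
  exact: cdw.
move=> s; have := hw i (line i z s); rewrite coord_line.
have -> : (fun t => w (line i (line i z s) t)) = (fun t => w (line i z t)).
  by apply/funext => t; rewrite line_line.
exact.
Qed.

Lemma slice_continuous (g : R * R -> R) i z : continuous g ->
  continuous (fun s => g (line i z s)).
Proof.
move=> cg s; apply: (@continuous_comp _ _ _ (line i z) g).
  exact: line_continuous.
exact: cg.
Qed.

Lemma norm_continuous2 (g : R * R -> R) : continuous g ->
  continuous (fun z => `|g z|).
Proof.
by move=> cg z; apply: (@continuous_comp _ _ _ g (fun t => `|t|));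
  [exact: cg|exact: norm_continuous].
Qed.

Lemma fubini_cont1 (g : R * R -> R) a b c d : continuous g ->
  itg mu1 (`[a, b[%classic) (fun x => Int mu1 `[c, d[%classic (fun y => g (x, y))) /\
  Int mu2 (rect a b c d) g =
    Int mu1 (`[a, b[%classic) (fun x => Int mu1 `[c, d[%classic (fun y => g (x, y))).
Proof.
move=> cg; apply: fubini_rect1 => //; first exact: itg_rect.
by move=> x _; apply: itg_itv; exact: (@slice_continuous g true (x, 0)).
Qed.

Lemma fubini_cont2 (g : R * R -> R) a b c d : continuous g ->
  itg mu1 `[c, d[%classic (fun y => Int mu1 `[a, b[%classic (fun x => g (x, y))) /\
  Int mu2 (rect a b c d) g =
    Int mu1 `[c, d[%classic (fun y => Int mu1 `[a, b[%classic (fun x => g (x, y))).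
Proof.
move=> cg; apply: fubini_rect2 => //; first exact: itg_rect.
by move=> y _; apply: itg_itv; exact: (@slice_continuous g false (0, y)).
Qed.

Section Box.
Variables (w : R * R -> R) (dw : bool -> R * R -> R) (L : R).
Hypotheses (Cw : C1 w dw) (L0 : 0 <= L).
Hypothesis w0 : forall z i, ~ (- L < coord i z < L) -> w z = 0.

Let I : set (measurableTypeR R) := `[- L, L[%classic.
Let Q := rect (- L) L (- L) L.

Let LL : - L <= L. Proof. by rewrite (le_trans _ L0)// oppr_le0. Qed.

Lemma Int_partial0 i : Int mu2 Q (dw i) = 0.
Proof.
have [cw cdw hw] := Cw.
have h j z : Int mu1 I (fun s => dw j (line j z s)) = 0.
  have [h1 h2] := C1_slice j z Cw.
  rewrite (FTC2 LL h1 h2) !(@w0 (line j z _) j) ?subrr//.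
    by rewrite coord_line ltxx.
  by rewrite coord_line ltxx andbF.
case: i; [rewrite (fubini_cont1 _ _ _ _ (cdw true)).2|
          rewrite (fubini_cont2 _ _ _ _ (cdw false)).2].
- by apply: Int_eq0 => x _; exact: (h true (x, 0)).
- by apply: Int_eq0 => y _; exact: (h false (0, y)).
Qed.

Lemma slice_bound i z : - L <= coord i z <= L ->
  `|w z| <= Int mu1 I (fun s => `|dw i (line i z s)|).
Proof.
move=> zL; have [h1 h2] := C1_slice i z Cw.
have := diff_le_Int h1 h2 zL (t := - L).
rewrite lexx LL => /(_ isT); rewrite line_coord (@w0 (line i z _) i) ?subr0//.
by rewrite coord_line ltxx.
Qed.

(** By [slice_bound] in the two directions, [w (x, y) ^+ 2] is at most a function of [y] times a
    function of [x]; the iterated integral of such a product factorizes. *)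
Lemma gagliardo_nirenberg : Int mu2 Q (fun z => w z ^+ 2) <=
  Int mu2 Q (fun z => `|dw false z|) * Int mu2 Q (fun z => `|dw true z|).
Proof.
have [cw cdw hw] := Cw.
have cw2 : continuous (fun z => w z ^+ 2) by move=> z; apply: cvgM; exact: cw.
have [a1 a2] := fubini_cont2 (- L) L (- L) L (norm_continuous2 (cdw false)).
have [b1 b2] := fubini_cont1 (- L) L (- L) L (norm_continuous2 (cdw true)).
have [c1 c2] := fubini_cont1 (- L) L (- L) L cw2.
have mI : measurable I by exact: measurable_itv.
rewrite a2 b2 c2 -(IntZ mI _ b1).
apply: Int_le => //; first exact: itgZ.
move=> x Ix; rewrite mulrC -(IntZ mI _ a1).
have i1 : itg mu1 I (fun y => w (x, y) ^+ 2).
  by apply: itg_itv; exact: (@slice_continuous _ true (x, 0) cw2).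
apply: (Int_le mI i1 (itgZ mI _ a1)) =>
 y Iy; have II t : I t -> - L <= t <= L.
  by rewrite /I /= in_itv/= => /andP[-> /ltW].
have h1 := @slice_bound false (x, y) (II x Ix).
have h2 := @slice_bound true (x, y) (II y Iy).
rewrite -(real_normK (num_real (w (x, y)))) expr2.
exact: (ler_pM (normr_ge0 _) (normr_ge0 _) h2 h1).
Qed.

End Box.
End C1.

(** * Test functions *)

Section TestFunctions.
Context {R : realType}.
Notation plane := (measurableTypeR R * measurableTypeR R)%type.
Notation mu1 := (@lebesgue_measure R).
Notation mu2 := (@lebesgue2 R).
Variables (Omega : set (R * R)) (L : R).
Hypotheses (oO : open Omega) (L0 : 0 < L).
Hypothesis OL : forall z i, Omega z -> - L < coord i z < L.

Let Q := rect (- L) L (- L) L.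

Lemma omega_measurable : measurable (Omega : set plane).
Proof. exact: open_measurable2. Qed.

Lemma omega_sub_rect : Omega `<=` Q.
Proof.
move=> z Oz; split; rewrite /= in_itv/=.
  by have /andP[/ltW -> ->] := OL false Oz.
by have /andP[/ltW -> ->] := OL true Oz.
Qed.

Lemma omega_finite : (mu2 Omega < +oo)%E.
Proof.
apply: le_lt_trans (rect_finite (- L) L (- L) L).
apply: le_measure; rewrite ?inE; [exact: omega_measurable|exact: rect_measurable|].
exact: omega_sub_rect.
Qed.

Lemma itg_omega (g : R * R -> R) : continuous g -> itg mu2 Omega g.
Proof.
move=> cg; have [M hM] := rect_bound (- L) L (- L) L cg.
apply: (@itg_bounded _ _ _ mu2 Omega g M).
- exact: omega_measurable.
- exact: omega_finite.
- by apply: continuous_measurable2 => //; exact: omega_measurable.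
- by move=> z /omega_sub_rect/hM.
Qed.

Lemma Int_rect_omega (g : R * R -> R) : (forall z, ~ Omega z -> g z = 0) ->
  Int mu2 Q g = Int mu2 Omega g.
Proof.
move=> g0; rewrite /Int Rintegral_mkcond [RHS]Rintegral_mkcond.
apply: eq_Rintegral => z _; rewrite !patchE.
case: ifPn => [zQ|/negP zQ]; case: ifPn => [zO|/negP zO] //.
- by apply: g0 => Oz; apply: zO; apply/mem_set.
- by case: zQ; apply/mem_set/omega_sub_rect/set_mem.
Qed.

Implicit Types phi psi : R * R -> R.

Lemma test_smooth phi : test_function Omega phi -> smooth2 phi.
Proof. by case. Qed.

Lemma test_out phi z : test_function Omega phi -> ~ Omega z -> phi z = 0.
Proof.
move=> [_ _ KO] nO; apply: contrapT => p0; apply: nO; apply: KO.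
by apply: subset_closure => /=; apply/eqP.
Qed.

Lemma test_box phi z i : test_function Omega phi ->
  ~ (- L < coord i z < L) -> phi z = 0.
Proof.
by move=> tphi nL; apply: (test_out tphi) => Oz; apply: nL; exact: OL.
Qed.

Lemma test_sub phi psi : test_function Omega phi -> smooth2 psi ->
  (forall z, ~ closure [set z | phi z != 0] z -> psi z = 0) ->
  test_function Omega psi.
Proof.
move=> [_ cK KO] spsi h.
have sub : closure [set z | psi z != 0] `<=` closure [set z | phi z != 0].
  rewrite [X in _ `<=` X](_ : _ = closure (closure [set z | phi z != 0])).
    apply: closureS => z /= pz; apply: contrapT => nK; move: pz.
    by rewrite h// eqxx.
  by apply: (closure_id _).1; exact: closed_closure.
split => //; last exact: subset_trans sub KO.
exact: (subclosed_compact (@closed_closure _ _) cK sub).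
Qed.

Lemma test_sub0 phi psi : test_function Omega phi -> smooth2 psi ->
  (forall z, phi z = 0 -> psi z = 0) -> test_function Omega psi.
Proof.
move=> tphi spsi h; apply: test_sub tphi spsi _ => z nK; apply: h.
by apply: contrapT => p0; apply: nK; apply: subset_closure => /=; apply/eqP.
Qed.

Lemma test_partial phi i : test_function Omega phi ->
  test_function Omega (partial i phi).
Proof.
move=> tphi; have sphi := test_smooth tphi.
apply: (test_sub tphi); [exact: smooth2_partial|move=> z nK].
have : nbhs z (~` closure [set z | phi z != 0]).
  by apply: open_nbhs_nbhs; split => //; apply: closed_openC; exact: closed_closure.
move=> nz; apply: (@proj2 (derivable phi z (basis2 i))).
apply: partialP.
(* Off the closed support [phi] vanishes on a neighbourhood of [z], hence near [z] on the line
   through it. *)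
have h0 : is_derive (coord i z) (1 : R) (fun=> 0 : R) 0 by exact: is_derive_cst.
apply: (near_eq_is_derive _ h0).
have hl : line i z s @[s --> coord i z] --> z.
  by rewrite -[X in _ --> X](line_coord i z); exact: line_continuous.
have hn : \forall s \near coord i z, ~ closure [set z | phi z != 0] (line i z s).
  by have := hl _ nz.
apply: filterS hn => s /= ns; apply/esym; apply: contrapT => p0; apply: ns.
by apply: subset_closure => /=; apply/eqP.
Qed.

Lemma test_lin a phi b psi : test_function Omega phi -> test_function Omega psi ->
  test_function Omega (fun z => a * phi z + b * psi z).
Proof.
move=> tphi tpsi.
have [s1 cK1 KO1] := tphi; have [s2 cK2 KO2] := tpsi.
have s : smooth2 (fun z => a * phi z + b * psi z).
  exact: (smooth2D (smooth2M (smooth2_cst a) s1) (smooth2M (smooth2_cst b) s2)).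
have sub : closure [set z | a * phi z + b * psi z != 0] `<=`
    closure [set z | phi z != 0] `|` closure [set z | psi z != 0].
  rewrite -closureU; apply: closureS => z /= h.
  have [p0|p0] := eqVneq (phi z) 0; last by left.
  by right; apply: contra h => /eqP q0; rewrite p0 q0 !mulr0 addr0.
split => //.
- exact: (subclosed_compact (@closed_closure _ _) (compactU cK1 cK2) sub).
- by move=> z /sub[/KO1|/KO2].
Qed.

Lemma test_smooth_abs phi e : 0 < e -> test_function Omega phi ->
  test_function Omega (smooth_abs phi e).
Proof.
move=> e0 tphi; apply: (test_sub0 tphi).
  exact: (smooth_abs_smooth e0 (test_smooth tphi)).
by move=> z; exact: smooth_abs0.
Qed.

Lemma test_cont phi : test_function Omega phi -> continuous phi.
Proof. by move=> /test_smooth; exact: smooth2_continuous. Qed.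

Lemma integration_by_parts phi psi i :
  test_function Omega phi -> test_function Omega psi ->
  Int mu2 Omega (fun z => phi z * partial i psi z) =
  - Int mu2 Omega (fun z => partial i phi z * psi z).
Proof.
move=> tphi tpsi.
have c1 := test_cont tphi; have c2 := test_cont tpsi.
have d1 := test_cont (test_partial i tphi).
have d2 := test_cont (test_partial i tpsi).
have Cw := C1M (C1_smooth (test_smooth tphi)) (C1_smooth (test_smooth tpsi)).
have w0 z j : ~ (- L < coord j z < L) -> phi z * psi z = 0.
  by move=> nL; rewrite (test_box tphi nL) mul0r.
have := Int_partial0 Cw (ltW L0) w0 i; rewrite Int_rect_omega; last first.
  by move=> z nO; rewrite (test_out tphi nO) (test_out tpsi nO) !mul0r addr0.
have cc (f g : R * R -> R) : continuous f -> continuous g ->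
    itg mu2 Omega (fun z => f z * g z).
  by move=> cf cg; apply: itg_omega => z; apply: cvgM; [exact: cf|exact: cg].
rewrite (IntD omega_measurable (cc _ _ c1 d2) (cc _ _ c2 d1)).
move/eqP; rewrite addr_eq0 => /eqP ->; congr (- _).
by apply: eq_Int => z _; rewrite mulrC.
Qed.

(** [h] will be the truncation [ramp s t] in the study of level sets and the identity in the
    Poincare inequality. The condition [h 0 = 0] makes the composite vanish outside [Omega]. *)
Lemma omega_GN phi (h h' : R -> R) : test_function Omega phi -> continuous h' ->
  (forall x : R, is_derive x (1 : R) h (h' x)) -> h 0 = 0 ->
  Int mu2 Omega (fun z => h (phi z) ^+ 2) <=
  Int mu2 Omega (fun z => `|h' (phi z) * partial false phi z|) *
  Int mu2 Omega (fun z => `|h' (phi z) * partial true phi z|).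
Proof.
move=> tphi ch hh h0.
have Cw := C1_comp (C1_smooth (test_smooth tphi)) ch hh.
have w0 z j : ~ (- L < coord j z < L) -> h (phi z) = 0.
  by move=> nL; rewrite (test_box tphi nL).
have := gagliardo_nirenberg Cw (ltW L0) w0.
have p0 i z : ~ Omega z -> `|h' (phi z) * partial i phi z| = 0.
  by move=> nO; rewrite (test_out (test_partial i tphi) nO) mulr0 normr0.
have h2 z : ~ Omega z -> h (phi z) ^+ 2 = 0.
  by move=> nO; rewrite (test_out tphi nO) h0 expr0n.
by rewrite (Int_rect_omega h2) (Int_rect_omega (p0 false)) (Int_rect_omega (p0 true)).
Qed.

End TestFunctions.

(** * The Trudinger inequality for test functions *)

Section Tent.
Context {R : realType}.
Implicit Types r s t x : R.

Definition posp r : R := Num.max r 0.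

Lemma posp_continuous : continuous posp.
Proof.
by move=> x; apply: continuous_max; [exact: cvg_id|exact: cvg_cst].
Qed.

Lemma posp_sqr_remainder x y :
  `|posp (y + x) ^+ 2 - posp x ^+ 2 - 2 * posp x * y| <= y ^+ 2.
Proof.
rewrite /posp /Num.max; case: ltP => h1; case: ltP => h2;
  rewrite ler_norml; apply/andP; split; nra.
Qed.

Lemma is_derive_posp_sqr x : is_derive x (1 : R) (fun r => posp r ^+ 2) (2 * posp x).
Proof.
have h : (fun y : R => y^-1 *: (((fun r => posp r ^+ 2) \o shift x) (y *: (1 : R)) -
    posp x ^+ 2)) @ 0^' --> 2 * posp x.
  apply/cvgrPdist_lt => e e0.
  have n0 : \forall y \near (0 : R)^', `|y| < e by exact: dnbhs0_lt.
  have nn : \forall y \near (0 : R)^', y != 0 by exact: nbhs_dnbhs_neq.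
  apply: filterS2 n0 nn => y ye y0 /=.
  apply: le_lt_trans ye; rewrite /GRing.scale/= mulr1.
  have -> : 2 * posp x - y^-1 * (posp (y + x) ^+ 2 - posp x ^+ 2) =
    - (y^-1 * (posp (y + x) ^+ 2 - posp x ^+ 2 - 2 * posp x * y)) by field.
  rewrite normrN normrM normfV ler_pdivrMl ?normr_gt0// -expr2 real_normK ?num_real//.
  exact: posp_sqr_remainder.
apply: DeriveDef; last exact: cvg_lim h.
by apply/cvg_ex; exists (2 * posp x).
Qed.

Variables (s t : R).

(** [omega_GN] asks for a truncation with continuous derivative. A piecewise linear one is therefore
    replaced by [ramp], the primitive of a tent supported on [[s, t]] with height [(t - s) / 2] and
    area [(t - s)^2 / 4]. *)
Definition tent r := posp (r - s) - 2 * posp (r - (s + t) / 2) + posp (r - t).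
Definition ramp r := (posp (r - s) ^+ 2 - 2 * posp (r - (s + t) / 2) ^+ 2 +
  posp (r - t) ^+ 2) / 2.

Lemma tent_continuous : continuous tent.
Proof.
move=> x; apply: cvgD; last first.
  apply: (@continuous_comp _ _ _ (fun r => r - t) posp); last exact: posp_continuous.
  by apply: cvgB; [exact: cvg_id|exact: cvg_cst].
apply: cvgB.
  apply: (@continuous_comp _ _ _ (fun r => r - s) posp); last exact: posp_continuous.
  by apply: cvgB; [exact: cvg_id|exact: cvg_cst].
apply: cvgMl_tmp.
apply: (@continuous_comp _ _ _ (fun r => r - (s + t) / 2) posp); last exact: posp_continuous.
by apply: cvgB; [exact: cvg_id|exact: cvg_cst].
Qed.

Lemma ramp_derive x : is_derive x (1 : R) ramp (tent x).
Proof.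
have hd (c : R) : is_derive x (1 : R) (fun r => posp (r - c) ^+ 2) (2 * posp (x - c)).
  have h1 : is_derive x (1 : R) (fun r => r - c) 1.
    by apply: is_derive_eq; rewrite subr0.
  have h2 := is_derive_posp_sqr (x - c).
  have := @is_derive1_comp _ (fun r => posp r ^+ 2) (fun r => r - c) x _ _ h2 h1.
  by rewrite mulr1.
have h1 := hd s; have h2 := hd ((s + t) / 2); have h3 := hd t.
have h := is_deriveZ (2^-1) (is_deriveD (is_deriveB h1 (is_deriveZ 2 h2)) h3).
have e : ramp = (2^-1 : R) \*: ((fun r => posp (r - s) ^+ 2) - ((2 : R) \*: (fun r => posp (r - (s + t) / 2) ^+ 2)) + (fun r => posp (r - t) ^+ 2)).
  by apply/funext => r; rewrite /ramp /= /GRing.scale/= mulrC.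
rewrite e; apply: is_derive_eq.
by rewrite /tent /GRing.scale/=; field.
Qed.

Lemma tent_bound r : s < t -> `|tent r| <= (t - s) / 2.
Proof.
move=> st; rewrite ler_norml /tent /posp /Num.max.
case: (ltP (r - s) 0) => h1; case: (ltP (r - (s + t) / 2) 0) => h2;
  case: (ltP (r - t) 0) => h3; apply/andP; split; lra.
Qed.

Lemma tent_out r : s < t -> r <= s \/ t <= r -> tent r = 0.
Proof.
move=> st h; rewrite /tent /posp /Num.max.
case: (ltP (r - s) 0) => h1; case: (ltP (r - (s + t) / 2) 0) => h2;
  case: (ltP (r - t) 0) => h3; case: h => h; lra.
Qed.

Lemma ramp_low r : s < t -> r <= s -> ramp r = 0.
Proof.
move=> st h; rewrite /ramp /posp !max_r; lra.
Qed.

Lemma ramp_high r : s < t -> t <= r -> ramp r = (t - s) ^+ 2 / 4.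
Proof.
move=> st h; rewrite /ramp /posp !max_l; lra.
Qed.

End Tent.

Section Iteration.
Context {R : realType}.

(** With [x = D / c] the hypothesis bounds the ratio of [A'] to [A] by [x / (1 + x)]. The weaker
    bound [expR (x - 1/2)] has the advantage that products over layers telescope: each layer gains
    [expR (- 1/2)], and the costs [D / c] add up to the total energy. *)
Lemma layer_step (c D A A' : R) : 0 < c -> 0 <= D -> 0 <= A ->
  c * A' <= (A - A') * D -> A' <= expR (D / c - 2^-1) * A.
Proof.
move=> c0 D0 A0 h.
have cD : 0 < c + D by rewrite ltr_wpDr.
have h1 : A' <= D / (c + D) * A.
  by rewrite mulrAC ler_pdivlMr//; lra.
apply: le_trans h1 _; apply: ler_wpM2r => //.
set x := D / c; have x0 : 0 <= x by rewrite /x divr_ge0// ltW.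
have -> : D / (c + D) = x / (1 + x).
  rewrite /x; field; rewrite !gt_eqF//=; lra.
have x1 : 0 < 1 + x by lra.
rewrite ler_pdivrMr//; apply: (@le_trans _ _ ((1 + (x - 2^-1)) * (1 + x))); first nra.
by rewrite ler_pM2r// expR_ge1Dx.
Qed.

Lemma layer_iter (c : R) (A G : nat -> R) : 0 < c ->
  (forall n, 0 <= A n) -> (forall n, G n <= G n.+1) ->
  (forall n, c * A n.+1 <= (A n - A n.+1) * (G n.+1 - G n)) ->
  forall n, A n <= expR ((G n - G 0%N) / c - n%:R / 2) * A 0%N.
Proof.
move=> c0 A0 Gm h; elim=> [|n ih].
  by rewrite subrr !mul0r subrr expR0 mul1r.
have D0 : 0 <= G n.+1 - G n by rewrite subr_ge0.
apply: le_trans (layer_step c0 D0 (A0 n) (h n)) _.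
have -> : (G n.+1 - G 0%N) / c - n.+1%:R / 2 =
  ((G n.+1 - G n) / c - 2^-1) + ((G n - G 0%N) / c - n%:R / 2).
  by rewrite -natr1; field; rewrite gt_eqF.
by rewrite [in leRHS]expRD -[leRHS]mulrA; apply: ler_wpM2l ih; exact: expR_ge0.
Qed.

Lemma level_step_alg (x y d a p q : R) :
  x ^+ 2 <= (d / 2) ^+ 2 * (a * p) -> y ^+ 2 <= (d / 2) ^+ 2 * (a * q) ->
  x * y <= d ^+ 2 / 8 * (a * (p + q)).
Proof.
move=> hx hy; have h := sqr_ge0 (x - y).
have -> : d ^+ 2 / 8 * (a * (p + q)) =
  ((d / 2) ^+ 2 * (a * p) + (d / 2) ^+ 2 * (a * q)) / 2 by field.
rewrite ler_pdivlMr//; apply: le_trans (lerD hx hy).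
by rewrite -subr_ge0 (_ : _ - _ = (x - y) ^+ 2)//; ring.
Qed.

Lemma measurable_bool_natr d (T : measurableType d) (D : set T) (b : T -> bool) :
  measurable_fun setT b -> measurable_fun D (fun z => (b z)%:R : R).
Proof.
move=> mb; apply: measurable_funTS.
have -> : (fun z => (b z)%:R : R) = (fun z => if b z then 1 else 0).
  by apply/funext => z; case: (b z).
exact: measurable_fun_ifT.
Qed.

End Iteration.

Lemma continuous_sqr (R : realType) (T : topologicalType) (f : T -> R) :
  continuous f -> continuous (fun z => f z ^+ 2).
Proof.
move=> cf z; apply: (@continuous_comp _ _ _ f (fun r => r ^+ 2)); first exact: cf.
exact: exprn_continuous.
Qed.

Section TrudingerMoser.
Context {R : realType}.
Notation plane := (measurableTypeR R * measurableTypeR R)%type.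
Notation mu2 := (@lebesgue2 R).
Variables (Omega : set (R * R)) (L : R).
Hypotheses (oO : open Omega) (L0 : 0 < L).
Hypothesis OL : forall z i, Omega z -> - L < coord i z < L.

Let mO : measurable (Omega : set plane) := omega_measurable oO.
Let fO := omega_finite oO OL.

Lemma itg_trunc (b : R * R -> bool) (g : R * R -> R) :
  measurable_fun setT (b : plane -> bool) -> continuous g ->
  itg mu2 Omega (fun z => (b z)%:R * g z).
Proof.
move=> mb cg; have [M hM] := rect_bound (- L) L (- L) L cg.
apply: (@itg_bounded _ _ _ mu2 Omega _ M) => //.
  apply: measurable_funM; first exact: measurable_bool_natr.
  exact: continuous_measurable2.
move=> z /(omega_sub_rect OL) /hM; rewrite normrM normr_nat; case: (b z) => /=.
  by rewrite mul1r.
by rewrite mul0r => h; apply: le_trans h.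
Qed.

Lemma itg_bool (b : R * R -> bool) :
  measurable_fun setT (b : plane -> bool) -> itg mu2 Omega (fun z => (b z)%:R).
Proof.
move=> mb; have := itg_trunc mb (@cst_continuous _ _ (1 : R)).
by apply: eq_itg => // z _ /=; rewrite mulr1.
Qed.

Variable phi : R * R -> R.
Hypothesis tphi : test_function Omega phi.

Let grd z := partial false phi z ^+ 2 + partial true phi z ^+ 2.
Let lev (t : R) : R := Int mu2 Omega (fun z => (t <= phi z)%R%:R).
Let ene (t : R) : R := Int mu2 Omega (fun z => (phi z < t)%R%:R * grd z).

Let cphi : continuous phi := test_cont tphi.
Let cd i : continuous (partial i phi).
Proof. exact: smooth2_continuous (smooth2_partial i (test_smooth tphi)). Qed.
Let cgrd : continuous grd.
Proof. by move=> z; apply: cvgD; apply: continuous_sqr; exact: cd. Qed.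
Let mphi : measurable_fun setT (phi : plane -> R).
Proof. exact: continuous_measurable2. Qed.

Let mle (t : R) : measurable_fun setT ((fun z => (t <= phi z)%R) : plane -> bool).
Proof. exact: measurable_fun_ler. Qed.
Let mlt (t : R) : measurable_fun setT ((fun z => (phi z < t)%R) : plane -> bool).
Proof. exact: measurable_fun_ltr. Qed.

(** Gagliardo-Nirenberg for [ramp s t] composed with [phi]. The left side is at least
    [((t - s)^2 / 4)^2 * lev t]. On the right both factors live on the layer [s <= phi < t], which
    has measure [lev s - lev t] and energy [ene t - ene s]; Cauchy-Schwarz turns their product into
    that of these two quantities. *)
Lemma level_step (s t : R) : 0 <= s -> s < t ->
  (t - s) ^+ 2 / 2 * lev t <= (lev s - lev t) * (ene t - ene s).
Proof.
move=> s0 st.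
pose S z := (s <= phi z < t).
have mS : measurable_fun setT (S : plane -> bool) by apply: measurable_and.
have ea : lev s - lev t = Int mu2 Omega (fun z => (S z)%:R).
  rewrite /lev -IntB//; try exact: itg_bool.
  apply: eq_Int => z _; rewrite /S; case: (leP s (phi z)) => h1; case: (leP t (phi z)) => h2 //=;
    rewrite ?subrr ?subr0 //; lra.
have eb : ene t - ene s = Int mu2 Omega (fun z => (S z)%:R * grd z).
  rewrite /ene -IntB//; try exact: itg_trunc.
  apply: eq_Int => z _; rewrite /S -mulrBl; congr (_ * _).
  case: (leP s (phi z)) => h1; case: (leP t (phi z)) => h2 //=;
    rewrite ?subrr ?subr0 //; lra.
have isq i : itg mu2 Omega (fun z => ((S z)%:R * `|partial i phi z|) ^+ 2).
  have h : continuous (fun z => partial i phi z ^+ 2).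
    exact: continuous_sqr.
  apply: eq_itg (itg_trunc mS h) => // z _.
  by rewrite exprMn real_normK ?num_real// -natrX; case: (S z).
have mSr : measurable_fun Omega ((fun z => (S z)%:R) : plane -> R).
  exact: measurable_bool_natr.
have mSd i : measurable_fun Omega ((fun z => (S z)%:R * `|partial i phi z|) : plane -> R).
  apply: measurable_funM => //; apply: (measurableT_comp (@normr_measurable _ setT)).
  exact: continuous_measurable2.
have i2 : itg mu2 Omega (fun z => ((S z)%:R : R) ^+ 2).
  by apply: eq_itg (itg_bool mS) => // z _; case: (S z); rewrite ?expr1n ?expr0n.
pose X i := Int mu2 Omega (fun z => `|tent s t (phi z) * partial i phi z|).
pose b i := Int mu2 Omega (fun z => ((S z)%:R * `|partial i phi z|) ^+ 2).
have X0 i : 0 <= X i by apply: Int_ge0 => // z _.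
have Xb i : X i ^+ 2 <= ((t - s) / 2) ^+ 2 * ((lev s - lev t) * b i).
  have := Int_CS mO mSr (mSd i) i2 (isq i).
  have -> : Int mu2 Omega (fun z => ((S z)%:R : R) ^+ 2) = lev s - lev t.
    by rewrite ea; apply: eq_Int => // z _; case: (S z); rewrite ?expr1n ?expr0n.
  rewrite -/(b i) => h.
  have le1 : X i <= (t - s) / 2 * Int mu2 Omega (fun z => (S z)%:R * ((S z)%:R * `|partial i phi z|)).
    have ii : itg mu2 Omega (fun z => (S z)%:R * ((S z)%:R * `|partial i phi z|)) by exact: (itgM mO mSr (mSd i) i2 (isq i)).
    rewrite -IntZ//; apply: Int_le => //.
    - apply: itg_norm => //; apply: (itg_omega oO OL) => // z.
      apply: cvgM; last exact: cd.
      by apply: (@continuous_comp _ _ _ phi (tent s t)); [exact: cphi|exact: tent_continuous].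
    - exact: itgZ.
    - move=> z _; rewrite normrM mulrA -natrM mulnb andbb; rewrite mulrA.
      apply: ler_wpM2r => //; rewrite /S.
      case: (leP s (phi z)) => h1; case: (ltP (phi z) t) => h2 /=; rewrite ?mulr1 ?mulr0.
      + exact: tent_bound.
      + by rewrite tent_out ?normr0 ?mul1r//; right.
      + by rewrite tent_out ?normr0//; left; exact: ltW.
      + by rewrite tent_out ?normr0//; left; exact: ltW.
  apply: (@le_trans _ _ (((t - s) / 2 * Int mu2 Omega (fun z => (S z)%:R * ((S z)%:R * `|partial i phi z|))) ^+ 2)).
    by rewrite lerXn2r ?nnegrE// (le_trans _ le1).
  by rewrite exprMn; apply: ler_wpM2l => //; exact: sqr_ge0.
have bb : b false + b true = ene t - ene s.
  rewrite eb /b -IntD//; apply: eq_Int => z _.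
  by rewrite /grd !exprMn !real_normK ?num_real// -mulrDr; case: (S z); rewrite ?expr1n// expr0n.
have GN := omega_GN L0 OL tphi (@tent_continuous R s t) (@ramp_derive R s t) (ramp_low st s0).
have lo : ((t - s) ^+ 2 / 4) ^+ 2 * lev t <= Int mu2 Omega (fun z => ramp s t (phi z) ^+ 2).
  rewrite /lev -IntZ; [|exact: mO|exact: itg_bool].
  apply: Int_le => //.
  - by apply: itgZ => //; exact: itg_bool.
  - apply: (itg_omega oO OL) => //; apply: continuous_sqr => z.
    apply: (@continuous_comp _ _ _ phi (ramp s t)); first exact: cphi.
    exact: (is_derive1_continuous (@ramp_derive R s t)).
  - move=> z _; case: (leP t (phi z)) => h; rewrite ?mulr1 ?mulr0 ?sqr_ge0//.
    by rewrite ramp_high.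
have := Xb false; have := Xb true; have := X0 false; have := X0 true.
have tot := le_trans lo GN.
move: tot; rewrite -/(X false) -/(X true) -bb.
move: (X false) (X true) (b false) (b true) (lev s - lev t) => x y p q a.
move: (lev t) => l tot y0 x0 hy hx.
have ts : 0 < t - s by rewrite subr_gt0.
have xy := level_step_alg hx hy.
have t2 : 0 < (t - s) ^+ 2 / 8 by rewrite divr_gt0// exprn_gt0.
rewrite -(ler_pM2l t2); apply: le_trans _ xy; apply: le_trans _ tot.
by rewrite [leLHS](_ : _ = ((t - s) ^+ 2 / 4) ^+ 2 * l)//; field.
Qed.

Lemma level_decay n : Int mu2 Omega grd <= 1 ->
  lev (Num.sqrt (8 * n%:R)) <= expR (- (n%:R / 4)) * Int mu2 Omega (fun=> 1).
Proof.
move=> g1.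
have i1 : itg mu2 Omega (fun=> 1 : R) by apply: (itg_omega oO OL) => //; exact: cst_continuous.
have lW t : lev t <= Int mu2 Omega (fun=> 1).
  by apply: Int_le => //; [exact: itg_bool|move=> z _; case: (t <= phi z)%R].
have W0 : 0 <= Int mu2 Omega (fun=> 1 : R) by apply: Int_ge0.
have grd0 z : 0 <= grd z by rewrite addr_ge0// sqr_ge0.
have e0 t : 0 <= ene t by apply: Int_ge0 => z _; rewrite mulr_ge0.
have eS t : ene t <= 1.
  apply: le_trans g1; apply: Int_le => //; [exact: itg_trunc|exact: (itg_omega oO OL)|].
  by move=> z _; rewrite ler_piMl//; case: (phi z < t)%R.
case: n => [|n]; first by rewrite mul0r oppr0 expR0 mul1r.
set N := n.+1%:R; have N0 : 0 < N by rewrite /N ltr0n.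
(* [N] layers of width [dl] reach the level [sqrt (8 N)], and the constant of [level_step] is
   [dl^2 / 2 = 4 / N]. The energy, at most 1 in all, spends [N / 4] of the gain [N / 2]. *)
pose dl := Num.sqrt (8 / N).
have dl0 : 0 < dl by rewrite sqrtr_gt0 divr_gt0.
have dl2 : dl ^+ 2 = 8 / N by rewrite sqr_sqrtr// divr_ge0// ltW.
have dlN : dl * N = Num.sqrt (8 * N).
  have dN0 : 0 <= dl * N by rewrite mulr_ge0// ltW.
  apply/eqP; rewrite -(@eqrXn2 _ 2 _ _ isT dN0 (sqrtr_ge0 _)).
  rewrite exprMn dl2 sqr_sqrtr; last by rewrite mulr_ge0// ltW.
  by apply/eqP; field; rewrite gt_eqF.
pose A k := lev (dl * k%:R); pose G k := ene (dl * k%:R).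
have Gm k : G k <= G k.+1.
  rewrite /G /ene; apply: Int_le => //; try exact: itg_trunc.
  move=> z _; apply: ler_wpM2r => //; rewrite ler_nat.
  case: (ltP (phi z) (dl * k%:R)) => // h; rewrite (lt_trans h)//.
  by rewrite ltr_pM2l// ltr_nat.
have A0 k : 0 <= A k by apply: Int_ge0.
have st k : 4 / N * A k.+1 <= (A k - A k.+1) * (G k.+1 - G k).
  have d1 : dl * k%:R < dl * k.+1%:R by rewrite ltr_pM2l// ltr_nat.
  have := level_step (mulr_ge0 (ltW dl0) (ler0n _ k)) d1.
  have -> : dl * k.+1%:R - dl * k%:R = dl by rewrite -natr1; ring.
  by rewrite dl2 (_ : 8 / N / 2 = 4 / N)//; field; rewrite gt_eqF.
have c0 : 0 < 4 / N by rewrite divr_gt0.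
have := layer_iter c0 A0 Gm st n.+1; rewrite /A dlN; move=> h; apply: le_trans h _.
apply: ler_pM; [exact: expR_ge0|exact: (A0 0%N)| |exact: lW].
rewrite ler_expR -/N.
have GG : G n.+1 - G 0%N <= 1 by have := e0 (dl * 0%:R); have := eS (dl * N); rewrite /G; lra.
have : (G n.+1 - G 0%N) / (4 / N) <= 1 / (4 / N).
  by rewrite ler_pM2r// invr_gt0.
have -> : 1 / (4 / N) = N / 4 by field; rewrite gt_eqF.
by move: (_ / (4 / N)) => q; lra.
Qed.

End TrudingerMoser.

Section ExpBound.
Context {R : realType}.
Notation plane := (measurableTypeR R * measurableTypeR R)%type.
Notation mu2 := (@lebesgue2 R).
Variables (Omega : set (R * R)) (L : R).
Hypotheses (oO : open Omega) (L0 : 0 < L).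
Hypothesis OL : forall z i, Omega z -> - L < coord i z < L.

Let mO : measurable (Omega : set plane) := omega_measurable oO.

Lemma sum_expR_bound (q : R) N : 0 <= q -> q < 1 -> \sum_(k < N) q ^+ k <= (1 - q)^-1.
Proof.
move=> q0 q1; have h : (1 - q) * \sum_(k < N) q ^+ k = 1 - q ^+ N.
  by rewrite -[1 - q]opprB mulNr -subrX1 opprB.
have q1' : 0 < 1 - q by rewrite subr_gt0.
by rewrite -(ler_pM2l q1') h divff ?gt_eqF// gerBl exprn_ge0.
Qed.

(** The sum of a geometric series of ratio [expR (- 1/8)]: the weights of [level_expR_le] against
    the decay of [level_decay]. The factor 2 accounts for the levels of [phi] and of [- phi]. *)
Definition TM_bound : R :=
  2 * Int mu2 Omega (fun=> 1) * expR 8^-1 * (1 - expR (- 8^-1))^-1.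

(** A discrete layer-cake formula, of which only the term [k = floor (x^2 / 8)] is needed. The
    weights grow like [expR (k / 8)], at half the rate at which the measures of level [sqrt (8 k)]
    decay; this is where 64 comes from. *)
Lemma level_expR_le (x : R) N : x ^+ 2 < 8 * N%:R ->
  expR (x ^+ 2 / 64) <=
  \sum_(k < N) expR (8^-1 * k.+1%:R) * ((Num.sqrt (8 * k%:R) <= x)%R%:R + (Num.sqrt (8 * k%:R) <= - x)%R%:R).
Proof.
move=> xN; have x8 : 0 <= x ^+ 2 / 8 by rewrite divr_ge0// sqr_ge0.
have := truncn_itv x8; set n := Num.truncn _ => /andP[n1 n2].
have nN : (n < N)%N.
  rewrite -(ltr_nat R); apply: le_lt_trans n1 _; rewrite ltr_pdivrMr//.
  by rewrite mulrC.
rewrite (bigD1 (Ordinal nN))//=; apply: ler_wpDr.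
  by apply: sumr_ge0 => k _; rewrite mulr_ge0// ?expR_ge0// addr_ge0.
have sx : Num.sqrt (8 * n%:R) <= `|x|.
  rewrite -sqrtr_sqr ler_wsqrtr//; move: n1; rewrite ler_pdivlMr//; lra.
have ge1 : (1 : R) <= (Num.sqrt (8 * n%:R) <= x)%R%:R + (Num.sqrt (8 * n%:R) <= - x)%R%:R.
  case: (leP 0 x) => x0.
    by rewrite -{1}(ger0_norm x0) sx lerDl.
  by rewrite -(ltr0_norm x0) sx lerDr.
apply: le_trans (_ : expR (8^-1 * n.+1%:R) * 1 <= _).
  rewrite mulr1 ler_expR; move: n2; lra.
by apply: ler_wpM2l; [exact: expR_ge0|].
Qed.

Lemma expR_sqr_le phi : test_function Omega phi ->
  Int mu2 Omega (fun z => partial false phi z ^+ 2 + partial true phi z ^+ 2) <= 1 ->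
  Int mu2 Omega (fun z => expR (phi z ^+ 2 / 64)) <= TM_bound.
Proof.
move=> tphi g1.
pose nphi z := - 1 * phi z + 0 * phi z.
have tn : test_function Omega nphi by exact: test_lin.
have ne z : nphi z = - phi z by rewrite /nphi mulN1r mul0r addr0.
have nef : nphi = (fun z => - phi z) by apply/funext.
have cphi := test_cont tphi.
have pn i z : partial i nphi z = - partial i phi z.
  have h : derivable phi z (basis2 i) by exact: (smooth2_derivable (test_smooth tphi)).
  by rewrite nef /partial; exact: deriveN.
have g1' : Int mu2 Omega (fun z => partial false nphi z ^+ 2 + partial true nphi z ^+ 2) <= 1.
  by apply: le_trans g1; rewrite le_eqVlt; apply/orP; left; apply/eqP; apply: eq_Int => // z _; rewrite !pn !sqrrN.
have [M hM] := rect_bound (- L) L (- L) L cphi.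
(* [phi] is bounded, so finitely many layers suffice; their number does not enter the final
   bound. *)
pose N := (Num.truncn (M ^+ 2 / 8)).+1.
have hN z : Omega z -> phi z ^+ 2 < 8 * N%:R.
  move=> /(omega_sub_rect OL) /hM hz.
  have M8 : 0 <= M ^+ 2 / 8 by rewrite divr_ge0// sqr_ge0.
  have /andP[_ h2] := truncn_itv M8.
  have : phi z ^+ 2 <= M ^+ 2.
    by rewrite -real_normK ?num_real// lerXn2r ?nnegrE// (le_trans _ hz).
  by move=> h3; apply: le_lt_trans h3 _; rewrite mulrC -ltr_pdivrMr.
have mphi : measurable_fun setT (phi : plane -> R) by exact: continuous_measurable2.
have mn : measurable_fun setT ((fun z => - phi z) : plane -> R) by exact: measurable_funN.
have m1 (t : R) : measurable_fun setT ((fun z => (t <= phi z)%R) : plane -> bool).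
  exact: measurable_fun_ler.
have m2 (t : R) : measurable_fun setT ((fun z => (t <= - phi z)%R) : plane -> bool).
  exact: measurable_fun_ler.
pose f k z : R := (Num.sqrt (8 * k%:R) <= phi z)%R%:R + (Num.sqrt (8 * k%:R) <= - phi z)%R%:R.
have fi k : itg mu2 Omega (f k) by apply: itgD => //; exact: (itg_bool oO OL).
set W := Int mu2 Omega (fun=> 1 : R).
have fk k : Int mu2 Omega (f k) <= 2 * (expR (- (k%:R / 4)) * W).
  rewrite /f IntD//; try exact: (itg_bool oO OL).
  have h1 := level_decay oO L0 OL tphi k g1.
  have := level_decay oO L0 OL tn k g1'.
  rewrite nef /= => h2.
  by apply: le_trans (lerD h1 h2) _; rewrite -mulr2n -[leLHS]mulr_natl.
have isum (n : nat) : itg mu2 Omega (fun z => \sum_(k < n) expR (8^-1 * k.+1%:R) * f k z) /\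
   Int mu2 Omega (fun z => \sum_(k < n) expR (8^-1 * k.+1%:R) * f k z) =
   \sum_(k < n) expR (8^-1 * k.+1%:R) * Int mu2 Omega (f k).
  elim: n => [|n [ih1 ih2]].
    split; last by rewrite big_ord0; apply: Int_eq0 => // z _; rewrite big_ord0.
    have : itg mu2 Omega (fun=> 0 : R) by apply: (itg_omega oO OL) => //; exact: cst_continuous.
    by apply: eq_itg => // z _; rewrite big_ord0.
  have e : (fun z => \sum_(k < n.+1) expR (8^-1 * k.+1%:R) * f k z) =
    (fun z => \sum_(k < n) expR (8^-1 * k.+1%:R) * f k z + expR (8^-1 * n.+1%:R) * f n z).
    by apply/funext => z; rewrite big_ord_recr.
  have iz := itgZ mO (expR (8^-1 * n.+1%:R)) (fi n).
  rewrite e; split; first exact: itgD.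
  by rewrite IntD// IntZ// ih2 big_ord_recr.
have [is1 is2] := isum N.
apply: (@le_trans _ _ (\sum_(k < N) expR (8^-1 * k.+1%:R) * Int mu2 Omega (f k))).
  rewrite -is2; apply: Int_le => //.
    apply: (itg_omega oO OL) => // z.
    apply: (@continuous_comp _ _ _ (fun z => phi z ^+ 2 / 64) expR); last exact: continuous_expR.
    by apply: cvgMr_tmp; exact: (continuous_sqr cphi).
  by move=> z Oz; apply: level_expR_le; exact: hN.
have W0 : 0 <= W by apply: Int_ge0.
apply: (@le_trans _ _ (\sum_(k < N) (2 * W * expR 8^-1) * expR (- 8^-1) ^+ k)).
  apply: ler_sum => k _; rewrite -expRM_natr.
  have -> : 2 * W * expR 8^-1 * expR (- 8^-1 * k%:R) = expR (8^-1 * k.+1%:R) * (2 * (expR (- (k%:R / 4)) * W)).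
    have -> : expR (8^-1 * k.+1%:R) * (2 * (expR (- (k%:R / 4)) * W)) =
       2 * W * (expR (8^-1 * k.+1%:R) * expR (- (k%:R / 4))) by ring.
    by rewrite -mulrA -!expRD; congr (_ * expR _); rewrite -natr1; field.
  by apply: ler_wpM2l; [exact: expR_ge0|exact: fk].
rewrite -mulr_sumr /TM_bound -/W; apply: ler_wpM2l.
  by rewrite !mulr_ge0// expR_ge0.
by apply: sum_expR_bound; [exact: expR_ge0|rewrite expR_lt1 oppr_lt0 invr_gt0].
Qed.

End ExpBound.

(** * Compactness for test functions *)

Section Cells.
Context {R : realType}.
Notation plane := (measurableTypeR R * measurableTypeR R)%type.
Notation mu1 := (@lebesgue_measure R).
Notation mu2 := (@lebesgue2 R).

Definition box (a c h : R) : set plane := rect a (a + h) c (c + h).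

Lemma Int_itv_cst (a b k : R) : a <= b -> Int mu1 `[a, b[%classic (fun=> k) = k * (b - a).
Proof.
move=> ab; rewrite /Int /Rintegral integral_cst//= lebesgue_measure_itv/= lte_fin.
move: ab; rewrite le_eqVlt => /predU1P[->|ab]; first by rewrite ltxx subrr mulr0 mule0.
by rewrite ab -EFinD -EFinM.
Qed.

Lemma Int_split (A B : set plane) (g : plane -> R) : measurable A -> measurable B ->
  [disjoint A & B] -> itg mu2 (A `|` B) g ->
  Int mu2 (A `|` B) g = Int mu2 A g + Int mu2 B g.
Proof. by move=> mA mB AB ig; rewrite /Int Rintegral_setU. Qed.

Lemma rect_split1 (g : R * R -> R) a m b c d : continuous g -> a <= m -> m <= b ->
  Int mu2 (rect a b c d) g = Int mu2 (rect a m c d) g + Int mu2 (rect m b c d) g.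
Proof.
move=> cg am mb.
have e : rect a b c d = rect a m c d `|` rect m b c d.
  apply/seteqP; split => -[x y]; rewrite /rect /= !in_itv/=.
    move=> [/andP[ax xb] h]; case: (ltP x m) => xm; [left|right]; split => //.
    by rewrite ax.
  by move=> [[/andP[ax xb] h]|[/andP[ax xb] h]]; split; rewrite // ?ax ?xb ?andbT ?(lt_le_trans xb mb) ?(le_trans am ax).
rewrite e Int_split//; try exact: rect_measurable.
  apply/disj_setPS => -[x y]; rewrite /rect /= !in_itv/=.
  by move=> [[/andP[_ h1] _] [/andP[h2 _] _]]; have := lt_le_trans h1 h2; rewrite ltxx.
by rewrite -e; exact: itg_rect.
Qed.

Lemma rect_split2 (g : R * R -> R) a b c m d : continuous g -> c <= m -> m <= d ->
  Int mu2 (rect a b c d) g = Int mu2 (rect a b c m) g + Int mu2 (rect a b m d) g.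
Proof.
move=> cg am mb.
have e : rect a b c d = rect a b c m `|` rect a b m d.
  apply/seteqP; split => -[y x]; rewrite /rect /= !in_itv/=.
    move=> [h /andP[ax xb]]; case: (ltP x m) => xm; [left|right]; split => //.
    by rewrite ax.
  by move=> [[h /andP[ax xb]]|[h /andP[ax xb]]]; split; rewrite // ?ax ?xb ?andbT ?(lt_le_trans xb mb) ?(le_trans am ax).
rewrite e Int_split//; try exact: rect_measurable.
  apply/disj_setPS => -[x y]; rewrite /rect /= !in_itv/=.
  by move=> [[_ /andP[_ h1]] [_ /andP[h2 _]]]; have := lt_le_trans h1 h2; rewrite ltxx.
by rewrite -e; exact: itg_rect.
Qed.

Lemma box_split (g : R * R -> R) a c h : continuous g -> 0 < h ->
  Int mu2 (box a c h) g = (Int mu2 (box a c (h / 2)) g + Int mu2 (box a (c + h / 2) (h / 2)) g) +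
   (Int mu2 (box (a + h / 2) c (h / 2)) g + Int mu2 (box (a + h / 2) (c + h / 2) (h / 2)) g).
Proof.
move=> cg h0; have h2 : h = h / 2 + h / 2 by field.
have hh : 0 <= h / 2 by rewrite divr_ge0// ltW.
rewrite /box {1 2}h2 !addrA (@rect_split1 g a (a + h / 2))// ?lerDl//.
by rewrite (@rect_split2 g a (a + h / 2) c (c + h / 2))// ?lerDl// (@rect_split2 g (a + h / 2) _ c (c + h / 2))// ?lerDl// !addrA.
Qed.

Section OneCell.
Variables (w : R * R -> R) (dw : bool -> R * R -> R) (a c h : R).
Hypotheses (Cw : C1 w dw) (h0 : 0 < h).
Let I : set (measurableTypeR R) := `[a, a + h[%classic.
Let J : set (measurableTypeR R) := `[c, c + h[%classic.
Let S := box a c h.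
Let cw : continuous w. Proof. by case: Cw. Qed.
Let cdw i : continuous (dw i). Proof. by case: Cw. Qed.
Let ndw i : continuous (fun z => `|dw i z|).
Proof. exact: norm_continuous2. Qed.
Let mI : measurable I. Proof. exact: measurable_itv. Qed.
Let mJ : measurable J. Proof. exact: measurable_itv. Qed.
Let mS : measurable S. Proof. exact: rect_measurable. Qed.
Let IntI k : Int mu1 I (fun=> k) = k * h.
Proof. by rewrite Int_itv_cst ?lerDl ?(ltW h0)// [_ - a]addrC addKr. Qed.
Let IntJ k : Int mu1 J (fun=> k) = k * h.
Proof. by rewrite Int_itv_cst ?lerDl ?(ltW h0)// [_ - c]addrC addKr. Qed.
Let itgI (k : R) : itg mu1 I (fun=> k).
Proof. by apply: itg_itv => x; exact: cvg_cst. Qed.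
Let itgJ (k : R) : itg mu1 J (fun=> k).
Proof. by apply: itg_itv => x; exact: cvg_cst. Qed.

Let A := Int mu2 S w.
Let al y := Int mu1 I (fun x => `|dw false (x, y)|).
Let be x := Int mu1 J (fun y => `|dw true (x, y)|).
Let B := Int mu2 S (fun z => `|dw true z|).

(** One moves horizontally at height [y], then vertically at abscissa [x']. The bound is thus a
    function of [y] plus a function of [x'], and averaging over [(x', y')] leaves the single unknown
    slice integral [al y]. *)
Let oscillation x y x' y' : I x -> J y -> I x' -> J y' ->
  `|w (x, y) - w (x', y')| <= al y + be x'.
Proof.
rewrite /I /J /= !in_itv/= => /andP[x1 x2] /andP[y1 y2] /andP[x1' x2'] /andP[y1' y2'].
have -> : w (x, y) - w (x', y') = (w (x, y) - w (x', y)) + (w (x', y) - w (x', y')) by ring.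
apply: le_trans (ler_normD _ _) _; apply: lerD.
- have [h1 h2] := C1_slice false (0, y) Cw.
  by apply: (diff_le_Int h1 h2); rewrite ?x1 ?x1' ltW.
- have [h1 h2] := C1_slice true (x', 0) Cw.
  by apply: (diff_le_Int h1 h2); rewrite ?y1 ?y1' ltW.
Qed.

Let deviation x y : I x -> J y -> `|h ^+ 2 * w (x, y) - A| <= h ^+ 2 * al y + h * B.
Proof.
move=> Ix Jy.
have [iA eA] := fubini_cont1 a (a + h) c (c + h) cw.
have [iB eB] := fubini_cont1 a (a + h) c (c + h) (@ndw true).
have sl x' : itg mu1 J (fun y' => w (x', y')).
  by apply: itg_itv; exact: (@slice_continuous _ w true (x', 0) cw).
have inner x' : I x' -> `|h * w (x, y) - Int mu1 J (fun y' => w (x', y'))| <= h * (al y + be x').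
  move=> Ix'; rewrite [h * w _]mulrC -IntJ -IntB//.
  apply: le_trans (Int_norm_le mJ _) _; first exact: itgB.
  rewrite [leRHS]mulrC -IntJ; apply: Int_le => //.
  - by apply: itg_norm => //; exact: itgB.
  - by move=> y' Jy'; exact: oscillation.
have -> : h ^+ 2 * w (x, y) = Int mu1 I (fun=> h * w (x, y)) by rewrite IntI; ring.
rewrite /A /S /box eA -IntB//.
apply: le_trans (Int_norm_le mI _) _; first exact: itgB.
have -> : h ^+ 2 * al y + h * B = Int mu1 I (fun x' => h * (al y + be x')).
  rewrite IntZ//; last exact: itgD.
  by rewrite IntD// IntI /B /S /box eB /be; ring.
apply: Int_le => //.
- by apply: itg_norm => //; exact: itgB.
- by apply: itgZ => //; exact: itgD.
Qed.

Let E i := Int mu2 S (fun z => dw i z ^+ 2).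

Let be_sqr : B ^+ 2 <= h ^+ 2 * E true.
Proof.
have cc : continuous (fun _ : R * R => (1 : R) ^+ 2) by exact: cst_continuous.
have i1 : itg mu2 S (fun=> (1 : R) ^+ 2) by exact: itg_rect.
have m1 : measurable_fun S ((fun=> 1) : plane -> R) by exact: measurable_cst.
have m2 : measurable_fun S ((fun z => `|dw true z|) : plane -> R) by exact: continuous_measurable2.
have i2 : itg mu2 S (fun z => `|dw true z| ^+ 2).
  by apply: itg_rect; exact: (continuous_sqr (@ndw true)).
have := Int_CS mS m1 m2 i1 i2.
have -> : Int mu2 S (fun=> (1 : R) ^+ 2) = h ^+ 2.
  by rewrite (fubini_cont1 _ _ _ _ cc).2 -/I -/J IntJ IntI; ring.
have -> : Int mu2 S (fun z => `|dw true z| ^+ 2) = E true.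
  by apply: eq_Int => // z _; rewrite real_normK ?num_real.
have -> // : Int mu2 S (fun z => 1 * `|dw true z|) = B.
by apply: eq_Int => // z _; rewrite mul1r.
Qed.

Let al_sqr y : al y ^+ 2 <= h * Int mu1 I (fun x => dw false (x, y) ^+ 2).
Proof.
have cs : continuous (fun x => dw false (x, y)).
  exact: (@slice_continuous _ (dw false) false (0, y) (@cdw false)).
have cn : continuous (fun x => `|dw false (x, y)|).
  exact: (@slice_continuous _ (fun z => `|dw false z|) false (0, y) (@ndw false)).
have i1 : itg mu1 I (fun=> (1 : R) ^+ 2) by exact: itgI.
have m1 : measurable_fun I ((fun=> 1) : measurableTypeR R -> R) by exact: measurable_cst.
have i2 : itg mu1 I (fun x => `|dw false (x, y)| ^+ 2).
  by apply: itg_itv; exact: (continuous_sqr cn).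
have m2 : measurable_fun I ((fun x => `|dw false (x, y)|) : measurableTypeR R -> R).
  by exact: itg_meas (itg_itv _ _ cn).
have := Int_CS mI m1 m2 i1 i2; rewrite expr1n IntI mul1r.
have -> : Int mu1 I (fun x => 1 * `|dw false (x, y)|) = al y.
  by apply: eq_Int => // x _; rewrite mul1r.
congr (_ <= _ * _); apply: eq_Int => // x _.
by rewrite real_normK ?num_real.
Qed.

Let pointwise x y : I x -> J y -> w (x, y) ^+ 2 <=
  (3 * (A ^+ 2 / h ^+ 4) + 3 * E true) + 3 * (h * Int mu1 I (fun x => dw false (x, y) ^+ 2)).
Proof.
move=> Ix Jy; have := deviation Ix Jy; have := al_sqr y; have := be_sqr.
move: (Int mu1 I _) (E true) (al y) B A (w (x, y)) => a0 E1 al' B' A' w'.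
move=> hB ha hd.
have h4 : 0 < h ^+ 4 by rewrite exprn_gt0.
have n1 : `|h ^+ 2 * w'| <= `|A'| + (h ^+ 2 * al' + h * B').
  by rewrite -[X in `|X|](subrK A') addrC; apply: le_trans (ler_normD _ _) _; rewrite lerD2l.
have n2 : `|h ^+ 2 * w'| ^+ 2 <= (`|A'| + (h ^+ 2 * al' + h * B')) ^+ 2.
  by rewrite lerXn2r// nnegrE ?(le_trans _ n1).
have n3 : (`|A'| + (h ^+ 2 * al' + h * B')) ^+ 2 <= 3 * (A' ^+ 2 + h ^+ 4 * al' ^+ 2 + h ^+ 2 * B' ^+ 2).
  rewrite -[A' ^+ 2]real_normK ?num_real//; move: (`|A'|) => A2.
  rewrite -subr_ge0 (_ : _ - _ = (A2 - h ^+ 2 * al') ^+ 2 + (A2 - h * B') ^+ 2 + (h ^+ 2 * al' - h * B') ^+ 2).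
    by rewrite !addr_ge0// sqr_ge0.
  by ring.
have n4 : h ^+ 4 * w' ^+ 2 <= 3 * (A' ^+ 2 + h ^+ 4 * (h * a0) + h ^+ 2 * (h ^+ 2 * E1)).
  have -> : h ^+ 4 * w' ^+ 2 = `|h ^+ 2 * w'| ^+ 2 by rewrite real_normK ?num_real//; ring.
  apply: le_trans n2 (le_trans n3 _); rewrite ler_pM2l// !lerD// ler_pM2l// exprn_gt0//.
rewrite -(ler_pM2l h4); apply: le_trans n4 _; rewrite le_eqVlt; apply/orP; left; apply/eqP.
by field; rewrite gt_eqF.
Qed.

(** A Poincare inequality that keeps the mean. The means over finitely many cells can be controlled
    by compactness, and the factor [h^2] makes the gradient term small on a fine grid. The 3 comes
    from squaring the sum of three terms in [pointwise]. *)
Lemma cell_poincare : Int mu2 S (fun z => w z ^+ 2) <=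
  3 / h ^+ 2 * A ^+ 2 + 3 * h ^+ 2 * Int mu2 S (fun z => dw false z ^+ 2 + dw true z ^+ 2).
Proof.
have c2 := continuous_sqr cw.
have cd2 i := continuous_sqr (@cdw i).
have [iw ew] := fubini_cont2 a (a + h) c (c + h) c2.
have [id ed] := fubini_cont2 a (a + h) c (c + h) (cd2 false).
rewrite IntD//; try exact: itg_rect.
rewrite -/(E false) -/(E true) /S /box ew.
set k := 3 * (A ^+ 2 / h ^+ 4) + 3 * E true.
have -> : 3 / h ^+ 2 * A ^+ 2 + 3 * h ^+ 2 * (E false + E true) =
  Int mu1 J (fun y => k * h + (3 * h ^+ 2) * Int mu1 I (fun x => dw false (x, y) ^+ 2)).
  rewrite IntD//; last exact: itgZ.
  rewrite IntJ IntZ// -ed -/(E false) /k; field; exact: lt0r_neq0.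
apply: Int_le => //; first by apply: itgD => //; exact: itgZ.
move=> y Jy.
set p := Int mu1 I (fun x => dw false (x, y) ^+ 2).
have -> : k * h + 3 * h ^+ 2 * p = Int mu1 I (fun=> k + 3 * (h * p)) by rewrite IntI; ring.
apply: Int_le => //.
- by apply: itg_itv; exact: (@slice_continuous _ (fun z => w z ^+ 2) false (0, y) c2).
- by move=> x Ix; exact: pointwise.
Qed.

End OneCell.

(** [cell_poincare] after cutting the box into four [n] times. What matters is that [C] and the list
    [s] of cells are chosen before [w]. *)
Lemma grid_poincare n a c h : 0 < h ->
  exists (C : R) (s : seq (R * R * R)), 0 <= C /\ forall w dw, C1 w dw ->
    Int mu2 (box a c h) (fun z => w z ^+ 2) <=
    C * (\sum_(t <- s) Int mu2 (box t.1.1 t.1.2 t.2) w ^+ 2) +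
    3 * (h / 2 ^+ n) ^+ 2 * Int mu2 (box a c h) (fun z => dw false z ^+ 2 + dw true z ^+ 2).
Proof.
elim: n a c h => [|n ih] a c h h0.
  exists (3 / h ^+ 2), [:: (a, c, h)]; split; first by rewrite divr_ge0// exprn_ge0// ltW.
  move=> w dw Cw; rewrite big_seq1 expr0 divr1; exact: cell_poincare.
have h2 : 0 < h / 2 by rewrite divr_gt0.
have [C1 [s1 [C10 H1]]] := ih a c _ h2.
have [C2 [s2 [C20 H2]]] := ih a (c + h / 2) _ h2.
have [C3 [s3 [C30 H3]]] := ih (a + h / 2) c _ h2.
have [C4 [s4 [C40 H4]]] := ih (a + h / 2) (c + h / 2) _ h2.
exists (C1 + C2 + C3 + C4), (s1 ++ s2 ++ s3 ++ s4); split; first by rewrite !addr_ge0.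
move=> w dw Cw; have [cw cdw _] := Cw.
have c2 := continuous_sqr cw.
have cd2 : continuous (fun z => dw false z ^+ 2 + dw true z ^+ 2).
  by move=> z; apply: cvgD; exact: (continuous_sqr (cdw _)).
rewrite (box_split _ _ c2 h0) (box_split _ _ cd2 h0) !big_cat /=.
have := H1 _ _ Cw; have := H2 _ _ Cw; have := H3 _ _ Cw; have := H4 _ _ Cw.
have S0 (s : seq (R * R * R)) : 0 <= \sum_(t <- s) Int mu2 (box t.1.1 t.1.2 t.2) w ^+ 2.
  by apply: sumr_ge0 => t _; exact: sqr_ge0.
have := S0 s1; have := S0 s2; have := S0 s3; have := S0 s4.
have -> : h / 2 / 2 ^+ n = h / 2 ^+ n.+1 by rewrite exprS invfM mulrA.
move: (_ ^+ 2) => k.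
move: (\sum_(t <- s1) _) (\sum_(t <- s2) _) (\sum_(t <- s3) _) (\sum_(t <- s4) _) => x1 x2 x3 x4.
move: (Int mu2 (box a c _) _) (Int mu2 (box a (c + _) _) _) (Int mu2 (box (a + _) c _) _) (Int mu2 (box (a + _) (c + _) _) _) => p1 p2 p3 p4.
move: (Int mu2 (box a c _) _) (Int mu2 (box a (c + _) _) _) (Int mu2 (box (a + _) c _) _) (Int mu2 (box (a + _) (c + _) _) _) => q1 q2 q3 q4.
move=> X4 X3 X2 X1 K4 K3 K2 K1.
(* The constant is the sum of the four constants, so the products with unequal indices are in
   excess; they are nonnegative. *)
have Y12 := mulr_ge0 C10 X2; have Y13 := mulr_ge0 C10 X3; have Y14 := mulr_ge0 C10 X4.
have Y21 := mulr_ge0 C20 X1; have Y23 := mulr_ge0 C20 X3; have Y24 := mulr_ge0 C20 X4.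
have Y31 := mulr_ge0 C30 X1; have Y32 := mulr_ge0 C30 X2; have Y34 := mulr_ge0 C30 X4.
have Y41 := mulr_ge0 C40 X1; have Y42 := mulr_ge0 C40 X2; have Y43 := mulr_ge0 C40 X3.
clear - K1 K2 K3 K4 Y12 Y13 Y14 Y21 Y23 Y24 Y31 Y32 Y34 Y41 Y42 Y43.
lra.
Qed.

End Cells.

(** The image of [U] clusters at a point [p] of the compact interval, and an ultrafilter contains
    the preimage of every ball around such a point, since otherwise it would contain the
    complement. *)
Lemma ultra_cauchy (R : realType) (U : set_system nat) (UU : UltraFilter U) (x : nat -> R) M :
  (forall n, `|x n| <= M) -> forall e : R, 0 < e ->
  exists A, U A /\ forall n m, A n -> A m -> `|x n - x m| < e.
Proof.
move=> xM e e0; have PU : ProperFilter U := ultra_proper.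
have FU : (x @ U) `[- M, M]%classic.
  have : U [set n | `[- M, M]%classic (x n)].
    by apply: filterS filterT => n _ /=; rewrite in_itv/= -ler_norml; exact: xM.
  by [].

have [p [_ cp]] := @segment_compact R (- M) M (x @ U) _ FU.
exists (x @^-1` ball p (e / 2)); split.
  have [//|nU] := in_ultra_setVsetC (x @^-1` ball p (e / 2)) UU.
  have e2 : 0 < e / 2 by rewrite divr_gt0.
  have [y [ny yb]] := cp (~` ball p (e / 2)) (ball p (e / 2)) nU (nbhsx_ballx _ _ e2).
  by [].
move=> n m /= h1 h2; have h := ball_triangle (ball_sym h1) h2.
by rewrite [e]splitr; exact: h.
Qed.

(** * Poincare and Rellich theorems for test functions *)

Section TestCompactness.
Context {R : realType}.
Notation plane := (measurableTypeR R * measurableTypeR R)%type.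
Notation mu2 := (@lebesgue2 R).
Variables (Omega : set (R * R)) (L : R).
Hypotheses (oO : open Omega) (L0 : 0 < L).
Hypothesis OL : forall z i, Omega z -> - L < coord i z < L.

Let mO : measurable (Omega : set plane) := omega_measurable oO.

Lemma Int_box_le (f : R * R -> R) a c h : continuous f -> (forall z, 0 <= f z) ->
  (forall z, ~ Omega z -> f z = 0) -> Int mu2 (box a c h) f <= Int mu2 Omega f.
Proof.
move=> cf f0 fO; rewrite /Int /Rintegral fine_le//.
- by apply: integrable_fin_num => //; [exact: rect_measurable|exact: itg_rect].
- by apply: integrable_fin_num => //; exact: (itg_omega oO OL).
have -> : (\int[mu2]_(z in Omega) (f z)%:E = \int[mu2]_z (f z)%:E)%E.
  rewrite integral_mkcond; apply: eq_integral => z _; rewrite patchE.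
  by case: ifPn => // /negP zO; rewrite fO// => Oz; apply: zO; exact/mem_set.
apply: ge0_subset_integral => //; first exact: rect_measurable.
- by apply/measurable_EFinP; exact: continuous_measurable2.
- by move=> z _; rewrite lee_fin.
Qed.

Definition dirichlet (phi : R * R -> R) : R :=
  Int mu2 Omega (fun z => partial false phi z ^+ 2 + partial true phi z ^+ 2).

Let W : R := Int mu2 Omega (fun=> 1).

(** [omega_GN] for the identity, followed by Cauchy-Schwarz against the constant 1; hence the
    measure [W] of [Omega] as constant. *)
Lemma test_poincare phi : test_function Omega phi ->
  Int mu2 Omega (fun z => phi z ^+ 2) <= W * dirichlet phi.
Proof.
move=> tphi; have cd i := test_cont (test_partial i tphi).
have c1 : continuous (fun _ : R => 1 : R) by exact: cst_continuous.
have hd (x : R) : is_derive x (1 : R) (fun r : R => r) 1 by exact: is_derive_id.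
apply: le_trans (omega_GN L0 OL tphi c1 hd erefl) _.
have i1 : itg mu2 Omega (fun=> (1 : R) ^+ 2).
  by apply: (itg_omega oO OL) => //; exact: cst_continuous.
have m1 : measurable_fun Omega ((fun=> 1) : plane -> R) by exact: measurable_cst.
have csq i := continuous_sqr (cd i).
have bnd i : Int mu2 Omega (fun z => `|1 * partial i phi z|) ^+ 2 <=
    W * Int mu2 Omega (fun z => partial i phi z ^+ 2).
  have m2 : measurable_fun Omega ((fun z => `|partial i phi z|) : plane -> R).
    by apply: continuous_measurable2 => //; exact: (norm_continuous2 (cd i)).
  have i2 : itg mu2 Omega (fun z => `|partial i phi z| ^+ 2).
    by apply: (itg_omega oO OL) => //; exact: (continuous_sqr (norm_continuous2 (cd i))).
  have := Int_CS mO m1 m2 i1 i2.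
  have -> : Int mu2 Omega (fun z => 1 * `|partial i phi z|) = Int mu2 Omega (fun z => `|1 * partial i phi z|).
    by apply: eq_Int => // z _; rewrite !mul1r.
  have -> : Int mu2 Omega (fun=> (1 : R) ^+ 2) = W by apply: eq_Int => // z _; rewrite expr1n.
  have -> // : Int mu2 Omega (fun z => `|partial i phi z| ^+ 2) = Int mu2 Omega (fun z => partial i phi z ^+ 2).
  by apply: eq_Int => // z _; rewrite real_normK ?num_real.
have := bnd false; have := bnd true.
rewrite /dirichlet IntD//; try by apply: (itg_omega oO OL).
have W0 : 0 <= W by apply: Int_ge0.
have D0 i : 0 <= Int mu2 Omega (fun z => partial i phi z ^+ 2).
  by apply: Int_ge0 => z _; exact: sqr_ge0.
have := D0 false; have := D0 true; move: W0 => /[dup].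
move: (Int mu2 Omega (fun z => `|1 * partial false phi z|)) (Int mu2 Omega (fun z => `|1 * partial true phi z|)) => x y.
move: (Int mu2 Omega _) (Int mu2 Omega _) W => p q w w0 _ p0 q0 hx hy.
have h := sqr_ge0 (x - y).
have s0 : 0 <= w * (p + q) by rewrite mulr_ge0// addr_ge0.
have h2 : x ^+ 2 + y ^+ 2 <= w * (p + q) by rewrite mulrDr addrC [leRHS]addrC lerD.
have h3 : 2 * (x * y) <= x ^+ 2 + y ^+ 2.
  by rewrite -subr_ge0 (_ : _ - _ = (x - y) ^+ 2)//; ring.
by clear - s0 h2 h3; move: (w * (p + q)) (x ^+ 2 + y ^+ 2) (x * y) h2 h3 s0 => a b k; lra.
Qed.

Lemma dirichlet_sub phi psi : test_function Omega phi -> test_function Omega psi ->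
  dirichlet (fun z => 1 * phi z + -1 * psi z) <= 2 * dirichlet phi + 2 * dirichlet psi.
Proof.
move=> tp tq.
have cg f : test_function Omega f -> itg mu2 Omega (fun z => partial false f z ^+ 2 + partial true f z ^+ 2).
  move=> tf; apply: (itg_omega oO OL) => z; apply: cvgD; exact: (continuous_sqr (test_cont (test_partial _ tf))).
rewrite -Int_lin2//; try exact: cg.
apply: Int_le => //.
- by apply: cg; exact: test_lin.
- by apply: itgD => //; apply: itgZ => //; exact: cg.
move=> z _.
have pe i : partial i (fun z => 1 * phi z + -1 * psi z) z = partial i phi z - partial i psi z.
  have hp : is_derive z (basis2 i) phi (partial i phi z).
    by split => //; exact: (smooth2_derivable (test_smooth tp)).
  have hq : is_derive z (basis2 i) psi (partial i psi z).
    by split => //; exact: (smooth2_derivable (test_smooth tq)).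
  have e : (fun z => 1 * phi z + -1 * psi z) = phi - psi.
    by apply/funext => y; rewrite mul1r mulN1r.
  by rewrite e; have [_] := is_deriveB hp hq.
rewrite !pe; move: (partial _ _ _) (partial _ _ _) (partial _ _ _) (partial _ _ _) => a b c d.
have := sqr_ge0 (a + b); have := sqr_ge0 (c + d); nra.
Qed.

(** On a fine enough grid the gradient part of [grid_poincare] is below [e / 2] for all pairs [n],
    [m] at once. What remains is a fixed finite number of averages, each a bounded real sequence and
    so Cauchy along [U]. *)
Lemma rellich_test (U : set_system nat) (UU : UltraFilter U) (phi : nat -> R * R -> R) M :
  (forall n, test_function Omega (phi n)) -> (forall n, dirichlet (phi n) <= M) ->
  forall e : R, 0 < e -> exists A, U A /\ forall n m, A n -> A m ->
    Int mu2 Omega (fun z => (phi n z - phi m z) ^+ 2) < e.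
Proof.
move=> tphi dM e e0; have PU : ProperFilter U := ultra_proper.
have D0 f : 0 <= dirichlet f by apply: Int_ge0 => z _; rewrite addr_ge0// sqr_ge0.
have M0 : 0 <= M by apply: le_trans (D0 (phi 0%N)) (dM 0%N).
have L20 : 0 < 2 * L by rewrite mulr_gt0.
(* By [dirichlet_sub], [4 * M] bounds the energy of every difference, so the grid can be fixed
   before the set of indices. *)
have [k hk] : exists k, 3 * (2 * L / 2 ^+ k) ^+ 2 * (4 * M) < e / 2.
  have e2 : 0 < e / 2 by rewrite divr_gt0.
  pose q := (12 * (2 * L) ^+ 2 * M + 1) / (e / 2).
  have q0 : 0 < q by rewrite divr_gt0// ltr_wpDl// !mulr_ge0// ltW.
  have [k hk] : exists k, q < k%:R.
    exists (Num.truncn q).+1; exact: truncnS_gt.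
  exists k; have h2k : k%:R < (2 : R) ^+ k by rewrite -natrX ltr_nat ltn_expl.
  have h1k : (1 : R) <= 2 ^+ k by rewrite exprn_ege1// ler1n.
  have hq : q < (2 ^+ k) ^+ 2.
    apply: (lt_le_trans (lt_trans hk h2k)); rewrite expr2.
    by apply: ler_peMl => //; exact: (le_trans ler01).
  have p2 : 0 < ((2 : R) ^+ k) ^+ 2 by rewrite !exprn_gt0.
  move: hq; rewrite /q ltr_pdivrMr// => hq.
  have -> : 3 * (2 * L / 2 ^+ k) ^+ 2 * (4 * M) = (12 * (2 * L) ^+ 2 * M) / (2 ^+ k) ^+ 2.
    by field; rewrite gt_eqF// exprn_gt0.
  rewrite ltr_pdivrMr// [ltRHS]mulrC; apply: lt_trans hq; rewrite ltrDl//.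
have [C [s [C0 H]]] := grid_poincare k (- L) (- L) L20.
have bQ : box (- L) (- L) (2 * L) = rect (- L) L (- L) L.
  by rewrite /box (_ : - L + 2 * L = L)//; ring.
rewrite bQ in H.
have av t : forall d : R, 0 < d -> exists A, U A /\ forall n m, A n -> A m ->
    Int mu2 (box t.1.1 t.1.2 t.2) (fun z => 1 * phi n z + -1 * phi m z) ^+ 2 < d.
  pose x n := Int mu2 (box t.1.1 t.1.2 t.2) (phi n).
  pose V := Int mu2 (box t.1.1 t.1.2 t.2) (fun=> (1 : R) ^+ 2).
  have mB : measurable (box t.1.1 t.1.2 t.2) by exact: rect_measurable.
  have V0 : 0 <= V by apply: Int_ge0 => z _; exact: sqr_ge0.
  have W0 : 0 <= W by apply: Int_ge0.
  have xb n : `|x n| <= 1 + V * (W * M).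
    have cp := test_cont (tphi n).
    have m1 : measurable_fun (box t.1.1 t.1.2 t.2) ((fun=> 1) : plane -> R) by exact: measurable_cst.
    have m2 : measurable_fun (box t.1.1 t.1.2 t.2) (phi n : plane -> R) by exact: continuous_measurable2.
    have i1 : itg mu2 (box t.1.1 t.1.2 t.2) (fun=> (1 : R) ^+ 2).
      by apply: itg_rect; exact: cst_continuous.
    have i2 : itg mu2 (box t.1.1 t.1.2 t.2) (fun z => phi n z ^+ 2).
      by apply: itg_rect; exact: continuous_sqr.
    have := Int_CS mB m1 m2 i1 i2.
    have -> : Int mu2 (box t.1.1 t.1.2 t.2) (fun z => 1 * phi n z) = x n.
      by apply: eq_Int => z _; rewrite mul1r.
    rewrite -/V => h.
    have h2 : V * Int mu2 (box t.1.1 t.1.2 t.2) (fun z => phi n z ^+ 2) <= V * (W * M).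
      apply: ler_wpM2l => //; apply: le_trans (_ : W * dirichlet (phi n) <= _); last exact: ler_wpM2l.
      apply: le_trans (test_poincare (tphi n)).
      apply: Int_box_le; [exact: continuous_sqr|by move=> z; exact: sqr_ge0|].
      by move=> z nO; rewrite (test_out (tphi n) nO) expr0n.
    have h3 := le_trans h h2; rewrite -[x n ^+ 2]real_normK ?num_real// in h3.
    move: (`|x n|) (V * (W * M)) h3 => y b h3; by apply: (le_trans _ (_ : 1 + y ^+ 2 <= _)); [have := sqr_ge0 (y - 1); rewrite sqrrB1 expr2 => _; rewrite -subr_ge0 (_ : _ - _ = (y - 2^-1) ^+ 2 + 3 / 4); [rewrite addr_ge0 ?sqr_ge0// divr_ge0|field]|rewrite lerD2l].
  move=> d d0; have sd : 0 < Num.sqrt d by rewrite sqrtr_gt0.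
  have [A [UA hA]] := ultra_cauchy UU xb sd.
  exists A; split => // n m An Am.
  rewrite Int_lin2//; try by apply: itg_rect; exact: (test_cont (tphi _)).
  rewrite mul1r mulN1r -/(x n) -/(x m) -[d]sqr_sqrtr ?(ltW d0)//.
  by rewrite -[ltLHS]real_normK ?num_real// ltrXn2r//; exact: hA.
have [A [UA hA]] : exists A, U A /\ forall n m, A n -> A m ->
    C * (\sum_(t <- s) Int mu2 (box t.1.1 t.1.2 t.2) (fun z => 1 * phi n z + -1 * phi m z) ^+ 2) < e / 2.
  suff : forall d : R, 0 < d -> exists A, U A /\ forall n m, A n -> A m ->
    \sum_(t <- s) Int mu2 (box t.1.1 t.1.2 t.2) (fun z => 1 * phi n z + -1 * phi m z) ^+ 2 < d.
    have C1 : 0 < C + 1 by rewrite ltr_wpDl.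
    move=> /(_ (e / 2 / (C + 1))) []; first by rewrite !divr_gt0.
    move=> A [UA hA]; exists A; split => // n m An Am.
    have := hA n m An Am; rewrite ltr_pdivlMr// => h; apply: le_lt_trans h.
    rewrite mulrC; apply: ler_wpM2l; last by rewrite lerDl.
    by apply: sumr_ge0 => t _; exact: sqr_ge0.
  elim: (s) => [|t s' ih] d d0.
    by exists setT; split; [exact: filterT|move=> n m _ _; rewrite big_nil].
  have d2 : 0 < d / 2 by rewrite divr_gt0.
  have [A1 [UA1 h1]] := av t _ d2.
  have [A2 [UA2 h2]] := ih _ d2.
  exists (A1 `&` A2); split; first exact: filterI.
  move=> n m [n1 n2] [m1 m2]; rewrite big_cons [d]splitr.
  by apply: ltrD; [exact: h1|exact: h2].
exists A; split => // n m An Am.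
have td : test_function Omega (fun z => 1 * phi n z + -1 * phi m z) by exact: test_lin.
have := H _ _ (C1_smooth (test_smooth td)).
have out g : test_function Omega g -> forall z, ~ Omega z -> g z ^+ 2 = 0.
  by move=> tg z nO; rewrite (test_out tg nO) expr0n.
rewrite (Int_rect_omega OL (out _ td)) (@Int_rect_omega _ _ _ OL); last first.
  by move=> z nO; rewrite (out _ (test_partial false td)) ?(out _ (test_partial true td)) ?addr0.
rewrite -/(dirichlet _) => h.
have -> : Int mu2 Omega (fun z => (phi n z - phi m z) ^+ 2) = Int mu2 Omega (fun z => (1 * phi n z + -1 * phi m z) ^+ 2).
  by apply: eq_Int => // z _; rewrite mul1r mulN1r.
apply: (le_lt_trans h); rewrite [e]splitr; apply: ltrD; first exact: hA.
apply: le_lt_trans hk; apply: ler_wpM2l; first by rewrite mulr_ge0// sqr_ge0.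
apply: le_trans (dirichlet_sub (tphi n) (tphi m)) _.
have := dM n; have := dM m; move: (dirichlet _) (dirichlet _) => a b; lra.
Qed.

End TestCompactness.

(** * Completeness of L2 *)

Section L2.
Context d (T : measurableType d) (R : realType) (mu : {measure set T -> \bar R}).
Variables (D : set T) (mD : measurable D).
Notation Int := (Int mu D).
Notation itg := (itg mu D).

Lemma Int_fatou (g_ : nat -> T -> R) (g : T -> R) (K : R) :
  (forall n, itg (g_ n)) -> (forall n x, D x -> 0 <= g_ n x) ->
  (\forall n \near \oo, Int (g_ n) <= K) ->
  measurable_fun D g -> {ae mu, forall x, D x -> g_ n x @[n --> \oo] --> g x} ->
  itg g /\ Int g <= K.
Proof.
move=> ig g0 gK mg gg.
pose F n x := (g_ n x)%:E : \bar R.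
have mF n : measurable_fun D (F n) by exact: measurable_int (ig n).
have F0 n x : D x -> (0 <= F n x)%E by move=> Dx; rewrite lee_fin g0.
have fat := fatou mu mD mF F0.
have gae : {ae mu, forall x, D x -> 0 <= g x}.
  apply: filterS gg => x h Dx; have := h Dx; move=> cx.
  have <- := cvg_lim (@Rhausdorff R) cx.
  by apply: limr_ge; [by apply/cvg_ex; exists (g x)|apply: nearW => n; exact: g0].
(* The limit [g] is nonnegative only almost everywhere; [G] is a version nonnegative everywhere. *)
pose G x := Num.max (g x) 0.
have mG : measurable_fun D G by apply: measurable_maxr => //; exact: measurable_cst.
have G0 x : D x -> 0 <= G x by move=> _; rewrite /G le_max lexx orbT.
have mlim : measurable_fun D (fun x => limn_einf (F^~ x)).
  apply: measurableT_comp => //.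
  apply: (@measurable_fun_limn_esup _ _ _ D (fun n x => - F n x)%E) => n.
  by apply: measurableT_comp.
have Elim : (\int[mu]_(x in D) limn_einf (F^~ x) = \int[mu]_(x in D) (G x)%:E)%E.
  apply: ge0_ae_eq_integral => //.
  - exact/measurable_EFinP.
  - move=> x Dx; rewrite limn_einf_lim; apply: lime_ge; first exact: is_cvg_einfs.
    by apply: nearW => n; apply: le_ereal_inf_tmp => _ [k /= _ <-]; exact: F0.
  - apply: (filterS2 _ _ gg gae) => x h1 h2 Dx; rewrite /G max_l ?h2//.
    have c : F n x @[n --> \oo] --> (g x)%:E by apply: cvg_EFin; [exact: nearW|exact: h1].
    by have [-> _] := cvg_limn_einf_sup c.
have EG : (\int[mu]_(x in D) (G x)%:E <= K%:E)%E.
  rewrite -Elim; apply: le_trans fat _.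
  rewrite limn_einf_lim; apply: lime_le; first exact: is_cvg_einfs.
  apply: nearW => n; move: gK => [N _ gK].
  (* The infimum over the tail from [n] is bounded by a term beyond [N], from where the bound [K]
     holds. *)
  apply: (@le_trans _ _ (\int[mu]_(x in D) F (maxn n N) x)%E).
    by apply: ereal_inf_lbound; exists (maxn n N) => //=; rewrite leq_maxl.
  rewrite (Int_fin mD (ig _)).
  by rewrite lee_fin gK//= leq_maxr.

have EG2 : (\int[mu]_(x in D) (G x)%:E < +oo)%E by exact: le_lt_trans EG (ltry _).
have iG : itg G by exact: (itg_ge0 mG G0 EG2).
have Gg : {ae mu, forall x, D x -> G x = g x}.
  by apply: filterS gae => x h Dx; rewrite /G max_l ?h.
have ig' : itg g.
  apply/integrableP; split; first exact/measurable_EFinP.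
  rewrite (_ : \int[mu]_(x in D) `|(EFin \o g) x| = \int[mu]_(x in D) (G x)%:E)%E.
    exact: le_lt_trans EG (ltry _).
  apply: ge0_ae_eq_integral => //.
  - by apply: measurableT_comp => //; exact/measurable_EFinP.
  - exact/measurable_EFinP.
  - apply: filterS2 Gg gae => x h1 h2 Dx /=; rewrite h1// ger0_norm// h2//.
split => //; rewrite -(Int_ae mD iG ig' Gg) -lee_fin -(Int_fin mD iG); exact: EG.
Qed.

(** The series of [4^k * h_k^2] has integral at most 1, since [8^(k+1)] beats [4^k]; so it is finite
    almost everywhere, and each of its terms bounds the square of [2^k * |h_k|]. *)
Lemma fast_ae (h : nat -> T -> R) : (forall k, measurable_fun D (h k)) ->
  (forall k, itg (fun x => h k x ^+ 2)) ->
  (forall k, Int (fun x => h k x ^+ 2) <= (8 ^+ k.+1)^-1) ->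
  {ae mu, forall x, D x -> exists C : R, forall k, `|h k x| <= C / 2 ^+ k}.
Proof.
move=> mh ih hk.
pose f k x := (4 ^+ k * h k x ^+ 2)%:E : \bar R.
have mf k : measurable_fun D (f k).
  apply/measurable_EFinP; apply: measurable_funM; first exact: measurable_cst.
  exact: measurable_funX.
have f0 k x : D x -> (0 <= f k x)%E.
  by move=> Dx; rewrite lee_fin; apply: mulr_ge0; [exact: exprn_ge0|exact: sqr_ge0].
have sumf : (\int[mu]_(x in D) (\sum_(k <oo) f k x) <= 1%:E)%E.
  rewrite integral_nneseries//; apply: le_trans (@epsilon_trick0 R 1 xpredT ler01).
  apply: lee_nneseries => [k _ _|k _].
    by apply: integral_ge0 => x; exact: f0.
  rewrite /f (Int_fin mD (itgZ mD (4 ^+ k) (ih k))) lee_fin IntZ//.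
  apply: (@le_trans _ _ (4 ^+ k * (8 ^+ k.+1)^-1)); first by rewrite ler_pM2l// exprn_gt0.
  have e8 : (8 : R) ^+ k.+1 = 4 ^+ k * (4 * (2 ^+ k.+1)).
    by rewrite (_ : 8 = 4 * 2 :> R); [rewrite exprMn exprSr mulrA|ring].
  have p4 : (4 : R) ^+ k != 0 by rewrite gt_eqF// exprn_gt0.
  have p2 : 0 < (2 : R) ^+ k.+1 by rewrite exprn_gt0.
  rewrite e8 natrX [leLHS](_ : _ = 4^-1 * (2 ^+ k.+1)^-1).
    by rewrite ler_pM2r ?invr_gt0// invf_le1// ler1n.
  rewrite invfM [RHS]mulrC; move: p4 p2; move: (4 ^+ k) (2 ^+ k.+1) => a b a0 b0.
  by field; rewrite a0 gt_eqF.
have ms : measurable_fun D (fun x => \sum_(k <oo) f k x)%E.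
  have := @ge0_emeasurable_sum _ T R D f xpredT (fun k x Dx _ => f0 k x Dx) (fun k _ => mf k).
  by apply: eq_measurable_fun => x _; apply: eq_eseriesl.
have s0 x : D x -> (0 <= \sum_(k <oo) f k x)%E.
  by move=> Dx; apply: nneseries_ge0 => k _ _; exact: f0.
have iS : mu.-integrable D (fun x => \sum_(k <oo) f k x)%E.
  apply/integrableP; split => //.
  rewrite (eq_integral (fun x => \sum_(k <oo) f k x)%E).
    exact: le_lt_trans sumf (ltry _).
  by move=> x /set_mem Dx; rewrite gee0_abs// s0.
apply: filterS (integrable_ae mD iS) => x fx Dx.
have := fx Dx => Fx; set S := (\sum_(k <oo) f k x)%E in Fx.
exists (1 + fine S) => k.
have p2 : 0 < (2 : R) ^+ k by rewrite exprn_gt0.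
rewrite ler_pdivlMr//.
have le1 : 4 ^+ k * h k x ^+ 2 <= fine S.
  rewrite -lee_fin fineK//; apply: le_trans (nneseries_lim_ge k.+1 (fun n _ _ => f0 n x Dx)).
  rewrite big_nat_recr//=; rewrite leeDr// big_nat_cond; apply: sume_ge0 => n _; exact: f0.
have e : 4 ^+ k * h k x ^+ 2 = (`|h k x| * 2 ^+ k) ^+ 2.
  by rewrite exprMn real_normK ?num_real// exprAC mulrC (_ : 4 = 2 ^+ 2 :> R)//; ring.
rewrite e in le1; move: (`|h k x| * _) (fine S) le1 => y s ys.
apply: (@le_trans _ _ (1 + y ^+ 2)); last by rewrite lerD2l.
rewrite -subr_ge0 (_ : _ - _ = (y - 2^-1) ^+ 2 + 3 / 4); last by field.
by rewrite addr_ge0 ?sqr_ge0.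
Qed.

Lemma fast_cvg (f : nat -> T -> R) (g : T -> R) : (forall k, measurable_fun D (f k)) ->
  measurable_fun D g -> (forall k, itg (fun x => (f k x - g x) ^+ 2)) ->
  (forall k, Int (fun x => (f k x - g x) ^+ 2) <= (8 ^+ k.+1)^-1) ->
  {ae mu, forall x, D x -> f k x @[k --> \oo] --> g x}.
Proof.
move=> mf mg ifg hk.
have mh k : measurable_fun D (fun x => f k x - g x) by exact: measurable_funB.
apply: filterS (fast_ae mh ifg hk) => x h Dx; have [C hC] := h Dx.
have C0 : C / 2 ^+ k @[k --> \oo] --> (0 : R).
  have := @cvg_geometric R C 2^-1; rewrite ger0_norm// invf_lt1// => /(_ (ltr1n _ 2)).
  by apply: cvg_trans; apply: near_eq_cvg; apply: nearW => k; rewrite /geometric/= exprVn.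
apply/cvgrPdist_le => e e0.
have hh : \forall k \near \oo, `|C / 2 ^+ k| <= e by move: C0 => /cvgr0Pnorm_le; apply.
apply: filterS hh => k hk'; rewrite distrC (le_trans (hC k))// (le_trans _ hk')//; exact: ler_norm.
Qed.

Lemma cvg_fast_diff (u : nat -> R) (C : R) : (forall k, `|u k.+1 - u k| <= C / 2 ^+ k) ->
  cvgn u.
Proof.
move=> hu.
have gc : cvgn (series (geometric C (2^-1 : R))).
  by apply: is_cvg_geometric_series; rewrite ger0_norm// invf_lt1// ltr1n.
have nc : cvgn [normed series (telescope u)].
  have hg n : `|telescope u n| <= geometric C 2^-1 n by rewrite /geometric/= exprVn; exact: hu.
  apply: (series_le_cvg _ _ hg gc) => n /=; first exact: normr_ge0.
  exact: le_trans (normr_ge0 _) (hg n).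
have /normed_cvg/cvg_ex[l hl] := nc.
apply/cvg_ex; exists (u 0%N + l).
have h : (u 0%N + series (telescope u) n) @[n --> \oo] --> u 0%N + l.
  by apply: cvgD; [exact: cvg_cst|exact: hl].
apply: cvg_trans h; apply: near_eq_cvg; apply: nearW => n.
by rewrite -eq_sum_telescope.
Qed.

(** A rapidly Cauchy subsequence converges almost everywhere by [fast_ae]; Fatou in the second index
    of [f n - f (nk k)] then gives convergence in L2 of the whole sequence. *)
Lemma riesz_fischer (f : nat -> T -> R) : (forall k, measurable_fun D (f k)) ->
  (forall k, itg (fun x => f k x ^+ 2)) ->
  (forall e : R, 0 < e -> exists N, forall n m, (N <= n)%N -> (N <= m)%N ->
     Int (fun x => (f n x - f m x) ^+ 2) < e) ->
  exists g : T -> R, [/\ measurable_fun D g, itg (fun x => g x ^+ 2) &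
    forall e : R, 0 < e -> exists N, forall n, (N <= n)%N ->
      itg (fun x => (f n x - g x) ^+ 2) /\ Int (fun x => (f n x - g x) ^+ 2) < e].
Proof.
move=> mf if2 cau.
have ifB n m : itg (fun x => (f n x - f m x) ^+ 2).
  apply: (itg_dom mD _ (itgD mD (itgZ mD 2 (if2 n)) (itgZ mD 2 (if2 m)))).
    by apply: measurable_funX; exact: measurable_funB.
  move=> x _ /=; rewrite ger0_norm ?sqr_ge0//.
  rewrite -subr_ge0 (_ : _ - _ = (f n x + f m x) ^+ 2); last by ring.
  exact: sqr_ge0.
have e8 k : 0 < (8 ^+ k.+1)^-1 :> R by rewrite invr_gt0 exprn_gt0.
have [N hN] := choice (fun k => cau _ (e8 k)).
(* A partial sum dominates both [N k] and [k] and is monotone, whatever the [N j] are. *)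
pose nk k := (\sum_(j < k.+1) (N j).+1)%N.
have nkN k : (N k <= nk k)%N by rewrite /nk big_ord_recr/= (leq_trans (leqnSn _))// leq_addl.
have nkS k : (nk k <= nk k.+1)%N by rewrite /nk [X in (_ <= X)%N]big_ord_recr leq_addr.
have nkge k : (k <= nk k)%N.
  elim: k => // k ih; apply: (@leq_trans (nk k + (N k.+1).+1)); last by rewrite /nk [X in (_ <= X)%N]big_ord_recr.
  by rewrite addnS ltnS (leq_trans ih)// leq_addr.
pose h k x := f (nk k.+1) x - f (nk k) x.
have mh k : measurable_fun D (h k) by exact: measurable_funB.
have ih k : itg (fun x => h k x ^+ 2) by exact: ifB.
have hk k : Int (fun x => h k x ^+ 2) <= (8 ^+ k.+1)^-1.
  by apply: ltW; apply: hN; rewrite ?nkN// (leq_trans (nkN k)).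
(* An upper limit exists everywhere and is measurable; [fine] gives it an arbitrary real value on
   the null set where it may be infinite. *)
pose g x := fine (limn_esup (fun k => (f (nk k) x)%:E)).
have mg : measurable_fun D g.
  apply: measurableT_comp; first exact: fine_measurable.
  apply: (@measurable_fun_limn_esup _ _ _ D (fun k x => (f (nk k) x)%:E)) => k.
  exact/measurable_EFinP.
have gcv : {ae mu, forall x, D x -> f (nk k) x @[k --> \oo] --> g x}.
  apply: filterS (fast_ae mh ih hk) => x hx Dx; have [C hC] := hx Dx.
  have /cvg_ex[l ul] := cvg_fast_diff hC.
  have c : (f (nk k) x)%:E @[k --> \oo] --> l%:E by apply: cvg_EFin; [exact: nearW|exact: ul].
  by rewrite /g; have [_ ->] := cvg_limn_einf_sup c.
have key e : 0 < e -> exists N, forall n, (N <= n)%N ->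
      itg (fun x => (f n x - g x) ^+ 2) /\ Int (fun x => (f n x - g x) ^+ 2) <= e.
  move=> e0; have [M hM] := cau e e0; exists M => n Mn.
  apply: (@Int_fatou (fun k x => (f n x - f (nk k) x) ^+ 2)).
  - by move=> k; exact: ifB.
  - by move=> k x _; exact: sqr_ge0.
  - exists M => // k /= Mk; apply: ltW; apply: hM => //.
    by rewrite (leq_trans Mk).
  - by apply: measurable_funX; exact: measurable_funB.
  - apply: filterS gcv => x hx Dx; have c := hx Dx.
    have c2 : (f n x - f (nk k) x) @[k --> \oo] --> f n x - g x.
      by apply: cvgB => //; exact: cvg_cst.
    by rewrite expr2; apply: cvg_trans (cvgM c2 c2); apply: near_eq_cvg; apply: nearW => k; rewrite expr2.
exists g; split => //.
  have [M hM] := key 1 ltr01; have [i1 _] := hM M (leqnn _).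
  apply: (itg_dom mD _ (itgD mD (itgZ mD 2 (if2 M)) (itgZ mD 2 i1))).
    exact: measurable_funX.
  move=> x _ /=; rewrite ger0_norm ?sqr_ge0//.
  rewrite -subr_ge0 (_ : _ - _ = (2 * f M x - g x) ^+ 2); last by ring.
  exact: sqr_ge0.
move=> e e0; have [M hM] := key _ (divr_gt0 e0 (ltr0n _ 2)).
exists M => n Mn; have [i1 i2] := hM n Mn; split => //.
by apply: le_lt_trans i2 _; rewrite ltr_pdivrMr// ltr_pMr// ltr1n.
Qed.

End L2.

(** * The Sobolev space *)

Section Norms.
Context {R : realType}.
Notation plane := (measurableTypeR R * measurableTypeR R)%type.
Notation mu2 := (@lebesgue2 R).
Variable (Omega : set (R * R)).
Hypothesis mO : measurable (Omega : set plane).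

Definition L2 (f : R * R -> R) :=
  measurable_fun Omega (f : plane -> R) /\ itg mu2 Omega (fun z => f z ^+ 2).

Lemma L2normE f : L2norm Omega f = sqrte (\int[mu2]_(z in Omega) (f z ^+ 2)%:E)%E.
Proof.
rewrite /L2norm unlock poweR12_sqrt; last by apply: integral_ge0 => x _; exact: poweR_ge0.
congr sqrte; rewrite [RHS]integral_mkcond; apply: eq_integral => z _.
rewrite !patchE; case: ifP => _ /=; last by rewrite normr0 powR0.
by rewrite powR_mulrn// real_normK ?num_real.
Qed.

Lemma L2normI f : itg mu2 Omega (fun z => f z ^+ 2) ->
  L2norm Omega f = (Num.sqrt (Int mu2 Omega (fun z => f z ^+ 2)))%:E.
Proof. by move=> f2; rewrite L2normE (Int_fin mO f2). Qed.

Lemma L2norm_itg f : measurable_fun Omega (f : plane -> R) ->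
  (L2norm Omega f < +oo)%E -> itg mu2 Omega (fun z => f z ^+ 2).
Proof.
move=> mf; rewrite L2normE => h; apply: itg_ge0.
- exact: measurable_funX.
- by move=> z _; exact: sqr_ge0.
- by move: h; case: (\int[_]_(_ in _) _)%E => [r| |] /=; rewrite ?ltry ?ltxx ?ltNyy.
Qed.

Lemma in_L2P f : in_L2 Omega f <-> L2 f.
Proof.
split=> [[mf f2]|[mf f2]]; split => //; first exact: L2norm_itg.
by rewrite L2normI// ltry.
Qed.

Lemma L2norm_lt f (e : R) : measurable_fun Omega (f : plane -> R) -> 0 < e ->
  (L2norm Omega f < e%:E)%E <->
  itg mu2 Omega (fun z => f z ^+ 2) /\ Int mu2 Omega (fun z => f z ^+ 2) < e ^+ 2.
Proof.
move=> mf e0; have I0 : 0 <= Int mu2 Omega (fun z => f z ^+ 2).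
  by apply: Int_ge0 => z _; exact: sqr_ge0.
have key : itg mu2 Omega (fun z => f z ^+ 2) ->
  (L2norm Omega f < e%:E)%E = (Int mu2 Omega (fun z => f z ^+ 2) < e ^+ 2).
  move=> f2; rewrite L2normI// lte_fin -[in RHS](sqr_sqrtr I0).
  by rewrite ltr_pXn2r ?nnegrE ?sqrtr_ge0 ?(ltW e0).
split=> [h|[f2 h]]; last by rewrite key.
have f2 : itg mu2 Omega (fun z => f z ^+ 2) by apply: L2norm_itg => //; exact: lt_trans h (ltry _).
by split => //; rewrite -key.
Qed.

Lemma L2_lin a f b g : L2 f -> L2 g -> L2 (fun z => a * f z + b * g z).
Proof.
move=> [mf f2] [mg g2]; split.
  by apply: measurable_funD; apply: measurable_funM => //; exact: measurable_cst.
have := itgD mO (itgD mO (itgZ mO (a ^+ 2) f2) (itgZ mO (2 * a * b) (itgM mO mf mg f2 g2))) (itgZ mO (b ^+ 2) g2).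
by apply: eq_itg => // z _; ring.
Qed.

Lemma L2_mul f g : L2 f -> L2 g -> itg mu2 Omega (fun z => f z * g z).
Proof. by move=> [mf f2] [mg g2]; exact: itgM. Qed.

Lemma L2_sub f g : L2 f -> L2 g -> L2 (fun z => f z - g z).
Proof.
move=> hf hg; have := L2_lin 1 (-1) hf hg.
by rewrite (_ : (fun z => 1 * f z + -1 * g z) = (fun z => f z - g z))//;
  apply/funext => z; rewrite mul1r mulN1r.
Qed.

(** Young's inequality with a free parameter. A factor [1 + t] close to 1 is what allows
    approximations to stay below any energy strictly larger than that of their limit. *)
Lemma L2_split_le f g t : L2 f -> L2 g -> 0 < t ->
  Int mu2 Omega (fun z => (f z + g z) ^+ 2) <=
  (1 + t) * Int mu2 Omega (fun z => f z ^+ 2) + (1 + t^-1) * Int mu2 Omega (fun z => g z ^+ 2).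
Proof.
move=> hf hg t0; have [mf f2] := hf; have [mg g2] := hg.
rewrite -Int_lin2//; have := (L2_lin 1 1 hf hg).2.
have -> : (fun z => (1 * f z + 1 * g z) ^+ 2) = (fun z => (f z + g z) ^+ 2).
  by apply/funext => z; rewrite !mul1r.
move=> i1; apply: Int_le => //.
  by apply: itgD => //; exact: itgZ.
move=> z _; rewrite -subr_ge0.
have -> : (1 + t) * f z ^+ 2 + (1 + t^-1) * g z ^+ 2 - (f z + g z) ^+ 2 = t^-1 * (t * f z - g z) ^+ 2.
  by field; rewrite gt_eqF.
by rewrite mulr_ge0 ?sqr_ge0// invr_ge0 ltW.
Qed.

End Norms.

Section Sobolev.
Context {R : realType}.
Notation plane := (measurableTypeR R * measurableTypeR R)%type.
Notation mu2 := (@lebesgue2 R).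
Variables (Omega : set (R * R)) (L : R).
Hypotheses (oO : open Omega) (L0 : 0 < L).
Hypothesis OL : forall z i, Omega z -> - L < coord i z < L.

Let mO : measurable (Omega : set plane) := omega_measurable oO.
Notation Int := (Int mu2 Omega).
Notation itg := (itg mu2 Omega).
Notation L2 := (L2 Omega).
Notation test := (test_function Omega).

Definition gr i (u : W12 Omega) z := if i then (grad u z).2 else (grad u z).1.

Lemma Int_lin_sqr_le a f b g : L2 f -> L2 g ->
  Int (fun z => (a * f z + b * g z) ^+ 2) <=
  2 * a ^+ 2 * Int (fun z => f z ^+ 2) + 2 * b ^+ 2 * Int (fun z => g z ^+ 2).
Proof.
move=> hf hg; have [mf f2] := hf; have [mg g2] := hg.
rewrite -(Int_lin2 mO _ _ f2 g2); have [_ i1] := L2_lin mO a b hf hg.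
apply: Int_le => //; first by apply: itgD => //; exact: itgZ.
move=> z _; rewrite -subr_ge0 (_ : _ - _ = (a * f z - b * g z) ^+ 2); last by ring.
exact: sqr_ge0.
Qed.

Lemma Int_sub_sqr_le f g h : L2 f -> L2 g -> L2 h ->
  Int (fun z => (f z - h z) ^+ 2) <=
  2 * Int (fun z => (f z - g z) ^+ 2) + 2 * Int (fun z => (g z - h z) ^+ 2).
Proof.
move=> hf hg hh; have := Int_lin_sqr_le 1 1 (L2_sub mO hf hg) (L2_sub mO hg hh).
rewrite !expr1n !mulr1; congr (_ <= _); apply: eq_Int => // z _; congr (_ ^+ 2); ring.
Qed.

Lemma W12_L2 (u : W12 Omega) : L2 u.
Proof. exact: (in_L2P mO _).1 (W12_fun_L2 u). Qed.

Lemma gr_L2 i (u : W12 Omega) : L2 (gr i u).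
Proof.
by case: i; [exact: (in_L2P mO _).1 (grad2_L2 u)|exact: (in_L2P mO _).1 (grad1_L2 u)].
Qed.

Lemma cont_L2 (f : R * R -> R) : continuous f -> L2 f.
Proof.
move=> cf; split; first exact: continuous_measurable2.
by apply: (itg_omega oO OL); exact: continuous_sqr.
Qed.

Lemma test_L2 phi : test phi -> L2 phi.
Proof. by move=> /test_cont; exact: cont_L2. Qed.

Lemma test_partial_L2 i phi : test phi -> L2 (partial i phi).
Proof. by move=> /(test_partial i)/test_L2. Qed.

Definition is_weak (f : R * R -> R) (g : bool -> R * R -> R) := forall phi i, test phi ->
  Int (fun z => f z * partial i phi z) = - Int (fun z => g i z * phi z).

Lemma gr_weak (u : W12 Omega) : is_weak u (fun i => gr i u).
Proof.
move=> phi i tphi; have [h1 h2] := grad_weak u tphi.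
have ii := L2_mul mO (W12_L2 u) (test_partial_L2 _ tphi).
have ij j := L2_mul mO (gr_L2 j u) (test_L2 tphi).
case: i; [move: h2|move: h1]; rewrite (Int_fin mO (ii _)).
  by rewrite (Int_fin mO (ij true)) -EFinN => -[].
by rewrite (Int_fin mO (ij false)) -EFinN => -[].
Qed.

Lemma weak_gradient_of f g : L2 f -> (forall i, L2 (g i)) -> is_weak f g ->
  weak_gradient Omega f (fun z => (g false z, g true z)).
Proof.
move=> hf hg w phi tphi.
have ii i := L2_mul mO hf (test_partial_L2 i tphi).
have ij j := L2_mul mO (hg j) (test_L2 tphi).
by split; rewrite (Int_fin mO (ii _)) (Int_fin mO (ij _)) (w _ _ tphi) EFinN.
Qed.

Definition mkW f g (hf : L2 f) (hg : forall i, L2 (g i)) (w : is_weak f g) : W12 Omega :=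
  @MkW12 R Omega f (fun z => (g false z, g true z)) ((in_L2P mO f).2 hf)
    ((in_L2P mO _).2 (hg false)) ((in_L2P mO _).2 (hg true)) (weak_gradient_of hf hg w).

Lemma gr_mkW f g (hf : L2 f) (hg : forall i, L2 (g i)) (w : is_weak f g) i :
  gr i (mkW hf hg w) = g i.
Proof. by case: i. Qed.

Lemma lin_weak a (u : W12 Omega) b (v : W12 Omega) : is_weak (fun z => a * u z + b * v z)
  (fun i z => a * gr i u z + b * gr i v z).
Proof.
move=> phi i tphi.
have h1 := L2_mul mO (W12_L2 u) (test_partial_L2 i tphi).
have h2 := L2_mul mO (W12_L2 v) (test_partial_L2 i tphi).
have h3 := L2_mul mO (gr_L2 i u) (test_L2 tphi).
have h4 := L2_mul mO (gr_L2 i v) (test_L2 tphi).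
transitivity (a * Int (fun z => u z * partial i phi z) + b * Int (fun z => v z * partial i phi z)).
  by rewrite -(Int_lin2 mO _ _ h1 h2); apply: eq_Int => // z _; ring.
rewrite (gr_weak u i tphi) (gr_weak v i tphi) !mulrN -opprD -(Int_lin2 mO _ _ h3 h4).
by congr (- _); apply: eq_Int => // z _; ring.
Qed.

Definition linW a (u : W12 Omega) b (v : W12 Omega) : W12 Omega :=
  mkW (L2_lin mO a b (W12_L2 u) (W12_L2 v))
    (fun i => L2_lin mO a b (gr_L2 i u) (gr_L2 i v)) (lin_weak a u b v).

Lemma test_weak phi : test phi -> is_weak phi (fun i => partial i phi).
Proof. by move=> tphi psi i tpsi; exact: (integration_by_parts oO L0 OL). Qed.

Definition testW phi (t : test phi) : W12 Omega :=
  mkW (test_L2 t) (fun i => test_partial_L2 i t) (test_weak t).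

Definition closeW (u : W12 Omega) phi (e : R) := Int (fun z => (u z - phi z) ^+ 2) < e /\
  forall i, Int (fun z => (gr i u z - partial i phi z) ^+ 2) < e.

(** The closure condition in terms of real integrals and of the separate components of the gradient;
    extended norms are left behind here. *)
Lemma W012P (u : W12 Omega) :
  W012 u <-> forall e : R, 0 < e -> exists phi, test phi /\ closeW u phi e.
Proof.
have vec phi z : euclid (grad u z - gradient phi z) ^+ 2 =
    (gr false u z - partial false phi z) ^+ 2 + (gr true u z - partial true phi z) ^+ 2.
  by rewrite sqr_sqrtr// addr_ge0// sqr_ge0.
have id phi i : test phi -> L2 (fun z => gr i u z - partial i phi z).
  by move=> t; apply: L2_sub => //; [exact: gr_L2|exact: test_partial_L2].
have md phi : test phi -> measurable_fun Omega ((fun z => euclid (grad u z - gradient phi z)) : plane -> R).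
  move=> t; have msq : measurable_fun setT (@Num.sqrt R).
    by apply: continuous_measurable_fun; exact: sqrt_continuous.
  have h : measurable_fun Omega ((fun z => (gr false u z - partial false phi z) ^+ 2 +
      (gr true u z - partial true phi z) ^+ 2) : plane -> R).
    by apply: measurable_funD; apply: measurable_funX; [exact: (id _ false t).1|exact: (id _ true t).1].
  exact: measurableT_comp msq h.
have me phi : test phi -> measurable_fun Omega ((fun z => u z - phi z) : plane -> R).
  by move=> t; exact: (L2_sub mO (W12_L2 u) (test_L2 t)).1.
have key phi (e : R) : test phi -> 0 < e ->
   (L2norm_vec Omega (fun z => grad u z - gradient phi z)%R < e%:E)%E <->
   Int (fun z => (gr false u z - partial false phi z) ^+ 2) +
   Int (fun z => (gr true u z - partial true phi z) ^+ 2) < e ^+ 2.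
  move=> t e0; rewrite /L2norm_vec; split.
    move=> /(L2norm_lt mO (md _ t) e0)[_]; congr (_ < _).
    rewrite -IntD//; [|exact: (id _ false t).2|exact: (id _ true t).2].
    by apply: eq_Int => // z _; exact: vec.
  move=> h; apply/(L2norm_lt mO (md _ t) e0); split.
    have := itgD mO (id _ false t).2 (id _ true t).2.
    by apply: eq_itg => // z _; rewrite vec.
  rewrite -IntD// in h; [|exact: (id _ false t).2|exact: (id _ true t).2].
  by move: h; congr (_ < _); apply: eq_Int => // z _; rewrite vec.
have I0 f : 0 <= Int (fun z => f z ^+ 2) by apply: Int_ge0 => // z _; exact: sqr_ge0.
split=> [h e e0|h e e0].
  have s0 : 0 < Num.sqrt e by rewrite sqrtr_gt0.
  have [phi [t h1 h2]] := h _ s0; exists phi; split => //.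
  move: h1 => /(L2norm_lt mO (me _ t) s0)[_]; move: h2 => /(key _ _ t s0).
  rewrite sqr_sqrtr ?(ltW e0)// => h2 h1; split => //.
  case; [apply: le_lt_trans h2; rewrite lerDr|apply: le_lt_trans h2; rewrite lerDl]; exact: I0.
have e2 : 0 < e ^+ 2 / 2 by rewrite divr_gt0// exprn_gt0.
have [phi [t [h1 h2]]] := h _ e2; exists phi; split => //.
  apply/(L2norm_lt mO (me _ t) e0); split.
    exact: (L2_sub mO (W12_L2 u) (test_L2 t)).2.
  by apply: lt_trans h1 _; rewrite ltr_pdivrMr// ltr_pMr ?exprn_gt0// ltr1n.
apply/(key _ _ t e0); rewrite [ltRHS]splitr; exact: ltrD.
Qed.

Lemma testW_W012 phi (t : test phi) : W012 (testW t).
Proof.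
apply/W012P => e e0; exists phi; split => //.
have z0 (f : R * R -> R) : Int (fun z => (f z - f z) ^+ 2) < e.
  by rewrite Int_eq0// => z _; rewrite subrr expr0n.
by split => [|i]; rewrite ?gr_mkW; exact: z0.
Qed.

Lemma linW_W012 a u b v : W012 u -> W012 v -> W012 (linW a u b v).
Proof.
move=> /W012P hu /W012P hv; apply/W012P => e e0.
pose k := 2 * a ^+ 2 + 2 * b ^+ 2 + 1.
have k0 : 0 < k by rewrite ltr_wpDl// addr_ge0// mulr_ge0// sqr_ge0.
have ek : 0 < e / k by rewrite divr_gt0.
have [phi [tp [p1 p2]]] := hu _ ek; have [psi [tq [q1 q2]]] := hv _ ek.
exists (fun z => a * phi z + b * psi z); split; first exact: test_lin.
have bound f f' g g' : L2 f -> L2 f' -> L2 g -> L2 g' ->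
  Int (fun z => (f z - f' z) ^+ 2) < e / k -> Int (fun z => (g z - g' z) ^+ 2) < e / k ->
  Int (fun z => ((a * f z + b * g z) - (a * f' z + b * g' z)) ^+ 2) < e.
  move=> hf hf' hg hg' i1 i2.
  have := Int_lin_sqr_le a b (L2_sub mO hf hf') (L2_sub mO hg hg').
  have -> : Int (fun z => (a * (f z - f' z) + b * (g z - g' z)) ^+ 2) =
    Int (fun z => ((a * f z + b * g z) - (a * f' z + b * g' z)) ^+ 2).
    by apply: eq_Int => // z _; congr (_ ^+ 2); ring.
  move=> h; apply: (le_lt_trans h).
  have a0 : 0 <= 2 * a ^+ 2 by rewrite mulr_ge0// sqr_ge0.
  have b0 : 0 <= 2 * b ^+ 2 by rewrite mulr_ge0// sqr_ge0.
  apply: (@le_lt_trans _ _ (2 * a ^+ 2 * (e / k) + 2 * b ^+ 2 * (e / k))).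
    by apply: lerD; apply: ler_wpM2l => //; exact: ltW.
  rewrite -mulrDl mulrA ltr_pdivrMr// mulrC ltr_pM2l// /k.
  by rewrite ltrDl.
split; first by apply: bound => //; [exact: W12_L2|exact: test_L2|exact: W12_L2|exact: test_L2].
move=> i; rewrite gr_mkW.
have pe z : partial i (fun z => a * phi z + b * psi z) z = a * partial i phi z + b * partial i psi z.
  have hp : derivable phi z (basis2 i) by exact: (smooth2_derivable (test_smooth tp)).
  have hq : derivable psi z (basis2 i) by exact: (smooth2_derivable (test_smooth tq)).
  have e1 : (fun z => a * phi z + b * psi z) = (a \*: phi) + (b \*: psi) by apply/funext.
  rewrite e1 /partial deriveD; [|exact: derivableZ|exact: derivableZ].
  by rewrite !deriveZ.
have := bound _ _ _ _ (gr_L2 i u) (test_partial_L2 i tp) (gr_L2 i v) (test_partial_L2 i tq) (p2 i) (q2 i).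
by congr (_ < _); apply: eq_Int => // z _; rewrite pe.
Qed.

End Sobolev.

Lemma ae_continuous d (T : measurableType d) (R : realType) (mu : {measure set T -> \bar R})
    (D : set T) (f : nat -> T -> R) (g : T -> R) (G : R -> R) : continuous G ->
  {ae mu, forall x, D x -> f k x @[k --> \oo] --> g x} ->
  {ae mu, forall x, D x -> G (f k x) @[k --> \oo] --> G (g x)}.
Proof.
by move=> cG; apply: filterS => x h Dx; apply: (continuous_cvg _ (cG _)); exact: h.
Qed.

(** * The Dirichlet form, and inequalities extended from test functions by Fatou *)

Section Space.
Context {R : realType}.
Notation plane := (measurableTypeR R * measurableTypeR R)%type.
Notation mu2 := (@lebesgue2 R).
Variables (Omega : set (R * R)) (L : R).
Hypotheses (oO : open Omega) (L0 : 0 < L).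
Hypothesis OL : forall z i, Omega z -> - L < coord i z < L.

Let mO : measurable (Omega : set plane) := omega_measurable oO.
Notation Int := (Int mu2 Omega).
Notation itg := (itg mu2 Omega).
Notation L2 := (L2 Omega).
Notation test := (test_function Omega).
Notation W12 := (W12 Omega).
Notation closeW := (@closeW R Omega).
Notation W012P := (W012P oO OL).

Definition ipW (u v : W12) : R :=
  Int (fun z => gr false u z * gr false v z + gr true u z * gr true v z).

Let gg i (u v : W12) : itg (fun z => gr i u z * gr i v z).
Proof. exact: (L2_mul mO (gr_L2 oO i u) (gr_L2 oO i v)). Qed.

Lemma ipWE u v : ipW u v =
  Int (fun z => gr false u z * gr false v z) + Int (fun z => gr true u z * gr true v z).
Proof. by rewrite /ipW (IntD mO (gg _ _ _) (gg _ _ _)). Qed.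

Lemma ipWuE u : ipW u u =
  Int (fun z => gr false u z ^+ 2) + Int (fun z => gr true u z ^+ 2).
Proof. by rewrite ipWE; congr (_ + _); apply: eq_Int => // z _; rewrite expr2. Qed.

Let I0 f : 0 <= Int (fun z => f z ^+ 2).
Proof. by apply: Int_ge0 => z _; exact: sqr_ge0. Qed.

Lemma ipW_ge0 u : 0 <= ipW u u.
Proof. by rewrite ipWuE addr_ge0. Qed.

Lemma dirichletE phi : test phi -> dirichlet Omega phi =
  Int (fun z => partial false phi z ^+ 2) + Int (fun z => partial true phi z ^+ 2).
Proof.
move=> t; rewrite /dirichlet (IntD mO) //; exact: (test_partial_L2 oO OL _ t).2.
Qed.

Lemma dirichlet_close u phi e s : closeW u phi e -> test phi -> 0 < s ->
  dirichlet Omega phi <= (1 + s) * ipW u u + (1 + s^-1) * (2 * e).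
Proof.
move=> [_ h2] t s0.
have b i : Int (fun z => partial i phi z ^+ 2) <=
   (1 + s) * Int (fun z => gr i u z ^+ 2) + (1 + s^-1) * e.
  have hd := L2_sub mO (test_partial_L2 oO OL i t) (gr_L2 oO i u).
  have := L2_split_le mO (gr_L2 oO i u) hd s0.
  have -> : Int (fun z => (gr i u z + (partial i phi z - gr i u z)) ^+ 2) =
    Int (fun z => partial i phi z ^+ 2).
    by apply: eq_Int => // z _; congr (_ ^+ 2); ring.
  move=> h; apply: le_trans h _; rewrite lerD2l; apply: ler_wpM2l.
    by rewrite addr_ge0// invr_ge0 ltW.
  apply/ltW; have := h2 i; congr (_ < _); apply: eq_Int => // z _.
  by rewrite -sqrrN opprB.
rewrite dirichletE// ipWuE; have := lerD (b false) (b true).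
rewrite addrACA -mulrDr -mulrDr; congr (_ <= _ + _ * _); ring.
Qed.

Lemma closeW_dirichlet u E : W012 u -> ipW u u < E -> exists e0 : R, 0 < e0 /\
  forall phi e, test phi -> e <= e0 -> closeW u phi e -> dirichlet Omega phi <= E.
Proof.
move=> _ uE; pose d := E - ipW u u; have d0 : 0 < d by rewrite subr_gt0.
have n0 := ipW_ge0 u; set n := ipW u u in n0 d d0 *.
have n1 : 0 < n + 1 by rewrite ltr_wpDl.
(* The margin [d] is shared: half for the factor [1 + s] on the energy, half for the approximation
   error. *)
pose s := d / (2 * (n + 1)).
have s0 : 0 < s by rewrite divr_gt0// mulr_gt0.
have k0 : 0 < 1 + s^-1 by rewrite addr_gt0// invr_gt0.
exists (d / (4 * (1 + s^-1))); split; first by rewrite divr_gt0// mulr_gt0.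
move=> phi e t ee c; apply: le_trans (dirichlet_close c t s0) _; rewrite -/n.
have h1 : s * n <= d / 2.
  rewrite /s -mulrA -[d / 2]mulr1 -mulrA ler_pM2l// invfM -mulrA ler_pM2l ?invr_gt0//.
  by rewrite mulrC ler_pdivrMr// mul1r lerDl.
have h2 : (1 + s^-1) * (2 * e) <= d / 2.
  apply: (@le_trans _ _ ((1 + s^-1) * (2 * (d / (4 * (1 + s^-1)))))).
    by rewrite ler_pM2l// ler_pM2l.
  by move: (1 + s^-1) k0 => k k0; rewrite le_eqVlt; apply/orP; left; apply/eqP; field; rewrite gt_eqF.
rewrite mulrDl mul1r; have -> : E = n + d / 2 + d / 2 by rewrite /d; field.
by rewrite -addrA -[leRHS]addrA lerD2l lerD.
Qed.

(** The approximations are taken at the rate required by [fast_cvg], so that the sequence itself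
    converges almost everywhere. *)
Lemma W012_approx u E : W012 u -> ipW u u < E -> exists phi : nat -> R * R -> R,
  (forall k, test (phi k)) /\ (forall k, dirichlet Omega (phi k) <= E) /\
  {ae mu2, forall z, Omega z -> phi k z @[k --> \oo] --> u z}.
Proof.
move=> Wu uE; have [e0 [e00 he0]] := closeW_dirichlet Wu uE.
pose ek k : R := Num.min e0 (8 ^+ k.+1)^-1.
have ek0 k : 0 < ek k by rewrite lt_min e00 invr_gt0 exprn_gt0.
have [phi hphi] := choice (fun k => (W012P u).1 Wu _ (ek0 k)).
have tp k : test (phi k) by case: (hphi k).
have uL := W12_L2 oO u.
exists phi; split => //; split.
  by move=> k; have [t c] := hphi k; apply: he0 c => //; rewrite ge_min lexx.
apply: (@fast_cvg _ _ _ mu2 Omega mO phi u) => //.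
- by move=> k; exact: (test_L2 oO OL (tp k)).1.
- exact: uL.1.
- by move=> k; exact: (L2_sub mO (test_L2 oO OL (tp k)) uL).2.
- move=> k; have [_ [c _]] := hphi k.
  apply: (@le_trans _ _ (ek k)); last by rewrite ge_min lexx orbT.
  move: (ltW c); congr (_ <= _); apply: eq_Int => // z _.
  by rewrite -sqrrN opprB.
Qed.

(** An integral bound valid for all test functions of energy at most [E] passes to a limit of
    smaller energy. The strict inequality leaves room for the approximations. *)
Lemma W012_fatou (G : R -> R) u E K : W012 u -> ipW u u < E ->
  continuous G -> (forall x, 0 <= G x) ->
  (forall phi, test phi -> dirichlet Omega phi <= E -> Int (fun z => G (phi z)) <= K) ->
  itg (fun z => G (u z)) /\ Int (fun z => G (u z)) <= K.
Proof.
move=> Wu uE cG G0 GK; have [phi [tp [dp ae]]] := W012_approx Wu uE.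
have uL := W12_L2 oO u.
have ig k : itg (fun z => G (phi k z)).
  apply: (itg_omega oO OL) => z.
  by apply: (@continuous_comp _ _ _ (phi k) G); [exact: (test_cont (tp k))|exact: cG].
have mG : measurable_fun Omega ((fun z => G (u z)) : plane -> R).
  by apply: (measurableT_comp _ uL.1); exact: continuous_measurable_fun.
have aG : {ae mu2, forall z, Omega z -> G (phi k z) @[k --> \oo] --> G (u z)}.
  exact: ae_continuous.
apply: (Int_fatou mO ig _ _ mG aG) => //.
by apply: nearW => k; exact: GK.
Qed.

Let W : R := Int (fun=> 1).
Let W0 : 0 <= W. Proof. by apply: Int_ge0. Qed.

Lemma W012_poincare u : W012 u -> Int (fun z => u z ^+ 2) <= W * ipW u u.
Proof.
move=> Wu; apply/ler_addgt0Pr => e e0.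
pose d := e / (W + 1); have W1 : 0 < W + 1 by rewrite ltr_wpDl.
have d0 : 0 < d by rewrite divr_gt0.
have uE : ipW u u < ipW u u + d by rewrite ltrDl.
have [_ h] := @W012_fatou (fun x => x ^+ 2) u _ (W * (ipW u u + d)) Wu uE
   (@exprn_continuous _ 2) (@sqr_ge0 _) (fun phi t dp => le_trans (test_poincare oO L0 OL t) (ler_wpM2l W0 dp)).
apply: le_trans h _; rewrite mulrDr lerD2l /d mulrA ler_pdivrMr// mulrDr mulr1 mulrC.
by rewrite lerDl ltW.
Qed.

(** The approximations of [u] may be taken with energy at most 4, so that their halves satisfy
    [expR_sqr_le]; hence [256 = 64 * 4]. Adding 1 keeps the constant positive even if [Omega] is
    empty. *)
Lemma W012_trudinger u : W012 u -> ipW u u <= 1 ->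
  itg (fun z => expR (256^-1 * u z ^+ 2)) /\
  Int (fun z => expR (256^-1 * u z ^+ 2)) <= TM_bound Omega + 1.
Proof.
move=> Wu u1.
have u4 : ipW u u < 4 by apply: le_lt_trans u1 _; rewrite ltr1n.
apply: (@W012_fatou (fun x => expR (256^-1 * x ^+ 2)) u 4) => //.
- move=> x; apply: (@continuous_comp _ _ _ (fun x : R => 256^-1 * x ^+ 2) expR); last exact: continuous_expR.
  by apply: cvgMl_tmp; exact: exprn_continuous.
move=> phi t d4.
have tt : test (fun z => 2^-1 * phi z + 0 * phi z) by exact: test_lin.
have ee : (fun z => 2^-1 * phi z + 0 * phi z) = 2^-1 \*: phi.
  by apply/funext => z; rewrite mul0r addr0.
have pe i z : partial i (fun z => 2^-1 * phi z + 0 * phi z) z = 2^-1 * partial i phi z.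
  have hp : derivable phi z (basis2 i) by exact: (smooth2_derivable (test_smooth t)).
  by rewrite ee /partial deriveZ.
have := expR_sqr_le oO L0 OL tt.
have -> : Int (fun z => partial false (fun z => 2^-1 * phi z + 0 * phi z) z ^+ 2 +
     partial true (fun z => 2^-1 * phi z + 0 * phi z) z ^+ 2) = 4^-1 * dirichlet Omega phi.
  rewrite /dirichlet -(IntZ mO); last first.
    by apply: itgD => //; exact: (test_partial_L2 oO OL _ t).2.
  by apply: eq_Int => // z _; rewrite !pe; field.
have l1 : 4^-1 * dirichlet Omega phi <= 1 by rewrite mulrC ler_pdivrMr// mul1r.
move=> /(_ l1) h; apply: (@le_trans _ _ (TM_bound Omega)); last by rewrite lerDl.
apply: le_trans h; rewrite le_eqVlt; apply/orP; left; apply/eqP; apply: eq_Int => // z _.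
by congr expR; field.
Qed.

End Space.

(** * Elementary inequalities *)

Section ExpInequalities.
Context {R : realType}.
Implicit Types a b r s t u v x y : R.

Lemma ge0_of_derive (f df : R -> R) x :
  (forall y, is_derive y 1 f (df y)) -> (forall y, 0 <= y -> 0 <= df y) ->
  f 0 = 0 -> 0 <= x -> 0 <= f x.
Proof.
move=> fdf df0 f0 x0; have [c] : exists2 c, c \in `[0, x]%R &
    f x - f 0 = df c * (x - 0).
  apply: MVT_segment => // y; apply: continuous_subspaceT => z.
  by apply: differentiable_continuous; apply/derivable1_diffP; case: (fdf z).
rewrite in_itv/= f0 !subr0 => /andP[c0 _] ->.
by rewrite mulr_ge0// df0.
Qed.

Lemma expR_ge_taylor2 x : 0 <= x -> 1 + x + x ^+ 2 / 2 <= expR x.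
Proof.
move=> x0; rewrite -subr_ge0.
have [c c2 ->] : exists2 c : R, 2 * c = 1 & 2^-1 = c.
  by exists 2^-1 => //; rewrite divff.
apply: (@ge0_of_derive (fun x => expR x - (1 + x + x ^+ 2 * c))
   (fun x => expR x - (1 + 2 * c * x))) => //.
- move=> y; apply: is_derive_eq; rewrite /GRing.scale/=; ring.
- by move=> y _; rewrite c2 mul1r subr_ge0 expR_ge1Dx.
- by rewrite expR0; ring.
Qed.

Lemma expR_gap x : 0 <= x -> x ^+ 2 / 2 <= x * expR x - (expR x - 1).
Proof.
move=> x0; rewrite -subr_ge0.
have [c c2 ->] : exists2 c : R, 2 * c = 1 & 2^-1 = c.
  by exists 2^-1 => //; rewrite divff.
apply: (@ge0_of_derive (fun x => x * expR x - (expR x - 1) - x ^+ 2 * c)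
   (fun x => x * (expR x - 2 * c))) => //.
- move=> y; apply: is_derive_eq; rewrite /GRing.scale/=; ring.
- by move=> y y0; rewrite c2 mulr_ge0// subr_ge0 (le_trans _ (expR_ge1Dx y))// lerDl.
- by rewrite expR0; ring.
Qed.

Lemma expR_le_taylor2 x : 0 <= x -> expR x <= 1 + x + x ^+ 2 / 2 * expR x.
Proof.
move=> x0; rewrite -subr_ge0.
have [c c2 ->] : exists2 c : R, 2 * c = 1 & 2^-1 = c.
  by exists 2^-1 => //; rewrite divff.
apply: (@ge0_of_derive (fun x => 1 + x + x ^+ 2 * c * expR x - expR x)
   (fun x => 1 + 2 * c * x * expR x + x ^+ 2 * c * expR x - expR x)) => //.
- move=> y; apply: is_derive_eq; rewrite /GRing.scale/=; ring.
- move=> y y0; rewrite c2 mul1r; have := expR_gap y0; have := expR_gt0 y.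
  have : 0 <= c by lra.
  have := sqr_ge0 y; nra.
- by rewrite expR0; ring.
Qed.

Lemma expR_sub1_le x : expR x - 1 <= x * expR x.
Proof.
have := expR_ge1Dx (- x); have := expR_gt0 x; have := expRxMexpNx_1 x; nra.
Qed.

Lemma expR_remainder_le x : expR x - 1 - x <= x ^+ 2 * (expR x + 1).
Proof.
have h1 := expR_sub1_le x; have h2 := expR_ge1Dx x; have h3 := expR_gt0 x.
have [x0|x0] := leP 0 x; nra.
Qed.

Lemma expR_chord t x : 0 <= t <= 1 -> expR (t * x) - 1 <= t * (expR x - 1).
Proof.
move=> /andP[t0 t1].
have h1 : expR (t * x) * (1 + (1 - t) * x) <= expR x.
  have -> : expR x = expR (t * x) * expR ((1 - t) * x).
    by rewrite -expRD; congr expR; ring.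
  by rewrite ler_pM2l ?expR_gt0// expR_ge1Dx.
have h2 : expR (t * x) * (1 - t * x) <= 1.
  rewrite -[leRHS](expRxMexpNx_1 (t * x)).
  by rewrite ler_pM2l ?expR_gt0// expR_ge1Dx.
have h3 := expR_gt0 (t * x); nra.
Qed.

Lemma expR_lipschitz x y : `|expR x - expR y| <= `|x - y| * (expR x + expR y).
Proof.
wlog xy : x y / y <= x => [hw|].
  have [/hw//|/ltW/hw] := leP y x.
  by rewrite distrC [`|y - x|]distrC [_ + expR x]addrC.
have := expR_sub1_le (y - x); have := expR_sub1_le (x - y).
rewrite -[y - x]opprB expRN expRD expRN.
have hy := expR_gt0 y; have hx := expR_gt0 x.
rewrite invfM invrK => h1 h2.
have exy : expR y <= expR x by rewrite ler_expR.
rewrite !ger0_norm ?subr_ge0//.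
have {}h1 : expR x - expR y <= (x - y) * expR x.
  rewrite -(@ler_pM2r _ (expR y)^-1) ?invr_gt0//.
  have -> : (expR x - expR y) / expR y = expR x / expR y - 1.
    by rewrite mulrBl divff// gt_eqF.
  by rewrite -mulrA.
rewrite (le_trans h1)// ler_wpM2l ?subr_ge0// lerDl ltW//.
Qed.

(* The integrand of the functional, normalised so that it tends to [r] as
   [a] tends to 0. *)
Definition mos a r := (expR (a * r) - 1) / a.

Section mos_pos.
Variable a : R.
Hypothesis a0 : 0 < a.

Let sc r : expR (a * r) = 1 + a * mos a r.
Proof. by rewrite /mos [a * (_ / a)]mulrC divfK ?gt_eqF// addrC subrK. Qed.

Lemma mos_lower r : 0 <= r -> r + a / 2 * r ^+ 2 <= mos a r.
Proof.
move=> r0; have := @expR_ge_taylor2 (a * r) (mulr_ge0 (ltW a0) r0).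
rewrite sc => h; rewrite -(ler_pM2l a0); lra.
Qed.

Lemma mos_upper r : 0 <= r -> mos a r <= r + a / 2 * (r ^+ 2 * expR (a * r)).
Proof.
move=> r0; have := @expR_le_taylor2 (a * r) (mulr_ge0 (ltW a0) r0).
rewrite {1}sc => h; rewrite -(ler_pM2l a0); lra.
Qed.

Lemma mos_gap r : 0 <= r -> mos a r + a / 2 * r ^+ 2 <= r * expR (a * r).
Proof.
move=> r0; have := @expR_gap (a * r) (mulr_ge0 (ltW a0) r0).
rewrite {2}sc => h; rewrite -(ler_pM2l a0); lra.
Qed.

Lemma mos_ge0 r : 0 <= r -> 0 <= mos a r.
Proof.
move=> r0; apply: le_trans (mos_lower r0).
by rewrite addr_ge0// mulr_ge0 ?sqr_ge0// divr_ge0// ltW.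
Qed.

Lemma mos_convex u v :
  mos a (v ^+ 2) + 2 * (v * expR (a * v ^+ 2)) * (u - v) <= mos a (u ^+ 2).
Proof.
have h : expR (a * v ^+ 2) * (1 + a * (u ^+ 2 - v ^+ 2)) <= expR (a * u ^+ 2).
  rewrite [leRHS](_ : _ = expR (a * v ^+ 2) * expR (a * (u ^+ 2 - v ^+ 2))).
    by rewrite ler_pM2l ?expR_gt0// expR_ge1Dx.
  by rewrite -expRD; congr expR; ring.
have e1 := sc (u ^+ 2); have e2 := sc (v ^+ 2).
have h0 : 0 <= a * (expR (a * v ^+ 2) * (u - v) ^+ 2).
  by apply: mulr_ge0; [exact: ltW|rewrite mulr_ge0 ?expR_ge0 ?sqr_ge0].
rewrite -(ler_pM2l a0).
move: (expR (a * u ^+ 2)) (expR (a * v ^+ 2)) h h0 e1 e2 => A B h h0 e1 e2.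
have -> : a * (mos a (v ^+ 2) + 2 * (v * B) * (u - v)) =
  a * mos a (v ^+ 2) + a * (2 * (v * B) * (u - v)) by ring.
have -> : a * mos a (u ^+ 2) = A - 1 by rewrite e1; ring.
have -> : a * mos a (v ^+ 2) = B - 1 by rewrite e2; ring.
lra.
Qed.

(** An upper Taylor bound whose quadratic coefficient is exactly 1, that of the limit functional;
    all the rest carries the factor [a]. Of the 3, one unit comes from replacing [B] by 1 and two
    from [d^2 <= 2 (u^2 + v^2) (u - v)^2]. *)
Lemma mos_second_order u v : mos a (u ^+ 2) <= mos a (v ^+ 2) +
    2 * (v * expR (a * v ^+ 2)) * (u - v) + (u - v) ^+ 2 +
  3 * a * ((u ^+ 2 + v ^+ 2) * (expR (a * u ^+ 2) + expR (a * v ^+ 2)) *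
    (u - v) ^+ 2).
Proof.
set A := expR (a * u ^+ 2); set B := expR (a * v ^+ 2).
have A0 : 0 < A := expR_gt0 _; have B0 : 0 < B := expR_gt0 _.
set d := u ^+ 2 - v ^+ 2.
have h : A - B - B * (a * d) <= (a * d) ^+ 2 * (A + B).
  have := expR_remainder_le (a * d).
  rewrite -(ler_pM2l B0) (_ : expR (a * d) = A / B); last first.
    by rewrite /A /B -expRN -expRD; congr expR; rewrite /d; ring.
  have -> : B * (A / B - 1 - a * d) = A - B - B * (a * d) by field; lra.
  by have -> : B * ((a * d) ^+ 2 * (A / B + 1)) = (a * d) ^+ 2 * (A + B) by field; lra.
have B1 : B <= 1 + a * v ^+ 2 * B.
  by have := expR_sub1_le (a * v ^+ 2); rewrite -/B; lra.
have d2 : d ^+ 2 <= 2 * (u ^+ 2 + v ^+ 2) * (u - v) ^+ 2.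
  have -> : d ^+ 2 = (u + v) ^+ 2 * (u - v) ^+ 2 by rewrite /d; ring.
  apply: ler_wpM2r; first exact: sqr_ge0.
  have := sqr_ge0 (u - v); lra.
have eA : A = 1 + a * mos a (u ^+ 2) := sc _.
have eB : B = 1 + a * mos a (v ^+ 2) := sc _.
have h1 : a * d ^+ 2 * (A + B) <=
    2 * a * ((u ^+ 2 + v ^+ 2) * (A + B) * (u - v) ^+ 2).
  have -> : 2 * a * ((u ^+ 2 + v ^+ 2) * (A + B) * (u - v) ^+ 2) =
     a * (2 * (u ^+ 2 + v ^+ 2) * (u - v) ^+ 2) * (A + B) by ring.
  by rewrite ler_wpM2r ?ler_wpM2l// ltW// addr_gt0.
have h2 : B * (u - v) ^+ 2 <= (u - v) ^+ 2 +
    a * ((u ^+ 2 + v ^+ 2) * (A + B) * (u - v) ^+ 2).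
  have -> : (u - v) ^+ 2 + a * ((u ^+ 2 + v ^+ 2) * (A + B) * (u - v) ^+ 2) =
    (1 + a * ((u ^+ 2 + v ^+ 2) * (A + B))) * (u - v) ^+ 2 by ring.
  apply: ler_wpM2r; first exact: sqr_ge0.
  apply: le_trans B1 _; rewrite lerD2l -mulrA ler_wpM2l ?(ltW a0)//.
  by apply: ler_pM; rewrite ?sqr_ge0 ?(ltW B0)// ?lerDr ?lerDl ?sqr_ge0// ltW.
have h3 : mos a (u ^+ 2) - mos a (v ^+ 2) <= B * d + a * d ^+ 2 * (A + B).
  rewrite -(ler_pM2l a0).
  have -> : a * (mos a (u ^+ 2) - mos a (v ^+ 2)) = A - B by rewrite eA eB; ring.
  lra.
move: h3; rewrite {1}(_ : d = 2 * v * (u - v) + (u - v) ^+ 2); last first.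
  by rewrite /d; ring.
lra.
Qed.

Lemma mos_lipschitz u v : `|mos a (u ^+ 2) - mos a (v ^+ 2)| <=
  `|u - v| * ((`|u| + `|v|) * (expR (a * u ^+ 2) + expR (a * v ^+ 2))).
Proof.
have := expR_lipschitz (a * u ^+ 2) (a * v ^+ 2).
rewrite -mulrBr normrM (gtr0_norm a0) !sc.
have -> : 1 + a * mos a (u ^+ 2) - (1 + a * mos a (v ^+ 2)) =
  a * (mos a (u ^+ 2) - mos a (v ^+ 2)) by ring.
rewrite normrM (gtr0_norm a0) -mulrA ler_pM2l// => h; apply: le_trans h _.
rewrite -!sc mulrA; apply: ler_wpM2r; first by rewrite addr_ge0 ?expR_ge0.
have -> : u ^+ 2 - v ^+ 2 = (u - v) * (u + v) by ring.
by rewrite normrM ler_wpM2l// ler_normD.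
Qed.

(** Convexity together with the value 0 at 0. It shows that a maximizing sequence of [J a] cannot
    lose norm. *)
Lemma mos_scale t r : 0 <= t <= 1 -> mos a (t * r) <= t * mos a r.
Proof.
move=> t01; rewrite -(ler_pM2l a0).
have := @expR_chord t (a * r) t01.
rewrite mulrCA (sc r) (sc (t * r)); lra.
Qed.

End mos_pos.
End ExpInequalities.

(** * Stability in an abstract Hilbert space of functions *)

Ltac meas := repeat first [ assumption
  | exact: measurable_cst
  | apply: measurable_funB | apply: measurable_funD
  | apply: measurable_funM
  | apply: measurable_funX
  | (apply: (measurableT_comp (f := expR)); first exact: measurable_expR)
  | apply: (measurableT_comp (@normr_measurable _ setT))
  ].

(** * Semi-inner products and their Cauchy-Schwarz and convergence properties *)

Section SemiInner.
Context {R : realType} {V : Type} (lc : R -> V -> R -> V -> V) (B : V -> V -> R).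
Hypothesis B_sym : forall x y, B x y = B y x.
Hypothesis B_lc : forall a x b y z, B (lc a x b y) z = a * B x z + b * B y z.
Hypothesis B_ge0 : forall x, 0 <= B x x.

(** [V] has only linear combinations, without algebraic laws: elements of the Sobolev space are
    representatives that carry proofs, so identities are stated only for values of forms and
    realisations. *)
Definition sub x y := lc 1 x (-1) y.

Lemma form_lcr a x b y z : B z (lc a x b y) = a * B z x + b * B z y.
Proof. by rewrite B_sym B_lc ![B z _]B_sym. Qed.

Lemma quad_lc a x b y : B (lc a x b y) (lc a x b y) =
  a ^+ 2 * B x x + 2 * a * b * B x y + b ^+ 2 * B y y.
Proof. by rewrite B_lc !form_lcr (B_sym y x); ring. Qed.

Lemma quad_sub x y : B (sub x y) (sub x y) = B x x - 2 * B x y + B y y.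
Proof. by rewrite /sub quad_lc; ring. Qed.

Lemma form_CS x y : B x y ^+ 2 <= B x x * B y y.
Proof. by apply: psd_CS => s t; have := B_ge0 (lc s x t y); rewrite quad_lc. Qed.

Lemma form_CS_sqrt x y : `|B x y| <= Num.sqrt (B x x) * Num.sqrt (B y y).
Proof.
rewrite -sqrtrM// -sqrtr_sqr ler_sqrt ?form_CS// mulr_ge0//.
Qed.

Lemma quad_lc_le a x b y :
  B (lc a x b y) (lc a x b y) <= 2 * a ^+ 2 * B x x + 2 * b ^+ 2 * B y y.
Proof.
have := B_ge0 (lc a x (-b) y); rewrite !quad_lc; lra.
Qed.

Lemma quad_sub_trans x y z : B (sub x z) (sub x z) <=
  2 * B (sub x y) (sub x y) + 2 * B (sub y z) (sub y z).
Proof.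
have := B_ge0 (lc 1 (sub x y) (-1) (sub y z)).
rewrite /sub !quad_lc !B_lc !form_lcr.
have := B_sym y x; have := B_sym z x; have := B_sym z y; lra.
Qed.

Lemma form_cvg (F : set_system nat) {FF : Filter F} (X Y : nat -> V) x y :
  B (sub (X n) x) (sub (X n) x) @[n --> F] --> 0 ->
  B (sub (Y n) y) (sub (Y n) y) @[n --> F] --> 0 ->
  B (X n) (Y n) @[n --> F] --> B x y.
Proof.
move=> Xx Yy.
have sX : Num.sqrt (B (sub (X n) x) (sub (X n) x)) @[n --> F] --> 0.
  by rewrite -[X in _ --> X]sqrtr0; apply: continuous_cvg Xx; exact: sqrt_continuous.
have sY : Num.sqrt (B (sub (Y n) y) (sub (Y n) y)) @[n --> F] --> 0.
  by rewrite -[X in _ --> X]sqrtr0; apply: continuous_cvg Yy; exact: sqrt_continuous.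
apply/subr_cvg0.
pose e n := Num.sqrt (B (sub (X n) x) (sub (X n) x)).
pose g n := Num.sqrt (B (sub (Y n) y) (sub (Y n) y)).
have h0 : e n * g n + (e n * Num.sqrt (B y y) + Num.sqrt (B x x) * g n)
    @[n --> F] --> 0.
  have -> : 0 = 0 * 0 + (0 * Num.sqrt (B y y) + Num.sqrt (B x x) * 0) :> R by ring.
  apply: cvgD; first exact: cvgM.
  by apply: cvgD; [exact: cvgMr_tmp|exact: cvgMl_tmp].
apply/norm_cvg0P; apply: squeeze_cvgr h0; last exact: cvg_cst.
apply: nearW => n; rewrite normr_ge0 /=.
have -> : B (X n) (Y n) - B x y = B (sub (X n) x) (sub (Y n) y) +
   (B (sub (X n) x) y + B x (sub (Y n) y)).
  by rewrite /sub !B_lc !form_lcr; ring.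
apply: le_trans (ler_normD _ _) _; rewrite lerD ?form_CS_sqrt//.
by apply: le_trans (ler_normD _ _) _; rewrite lerD ?form_CS_sqrt.
Qed.

End SemiInner.

(** The scalar part of [unstable_direction]: [k] is the multiplier [kappa], [iv] stands for
    [ip v h], [L] for [l2 h], [Q] for the remainder, and [t] for the norm of [u - v]. Division by
    [t] shows that [iv] is O(t), hence small. Inserting [2 t iv <= - t^2], which expresses the
    constraint on [u], and dividing by [t^2] bounds [k]. *)
Lemma direction_estimate (R : realType) (Ju Jv k iv L Q a r t c e : R) :
  0 < t -> 0 < k -> 0 < c -> 0 < e -> Jv - Ju < r * t ^+ 2 ->
  Ju <= Jv + 2 * (k * (t * iv)) + t ^+ 2 * L + 3 * a * (t ^+ 2 * Q) ->
  2 * (t * iv) <= - t ^+ 2 -> r + L + 3 * a * Q <= c ->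
  t ^+ 2 <= (2 * k * e / c) ^+ 2 -> r <= e ->
  `|iv| <= e /\ k <= e + L + 3 * a * Q.
Proof.
move=> t0 k0 c0 e0 h1 h2 h3 h4 h5 h6.
have t20 : 0 < t ^+ 2 by rewrite exprn_gt0.
have key : - (2 * k * (t * iv)) <= t ^+ 2 * (r + L + 3 * a * Q) by lra.
have iv0 : iv <= 0.
  have : t * iv <= 0 by lra.
  by rewrite pmulr_rle0.
split.
  rewrite ler0_norm//.
  have q2 : - (2 * k * iv) <= t * c.
    rewrite -(ler_pM2l t0).
    have -> : t * (t * c) = t ^+ 2 * c by ring.
    apply: le_trans (ler_wpM2l (ltW t20) h4).
    by apply: le_trans key; lra.
  have q1 : t * c <= 2 * k * e.
    rewrite -ler_pdivlMr// -ler_sqr ?nnegrE ?(ltW t0)//.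
    by rewrite divr_ge0 ?(ltW c0)// !mulr_ge0 ?(ltW k0) ?(ltW e0).
  have k20 : 0 < 2 * k by rewrite mulr_gt0.
  by rewrite -(ler_pM2l k20); lra.
rewrite -(ler_pM2l t20).
apply: (@le_trans _ _ (- (2 * k * (t * iv)))).
  by have := ler_wpM2l (ltW k0) h3; lra.
by apply: le_trans key _; rewrite ler_wpM2l ?(ltW t20)// !lerD2r.
Qed.

Local Opaque Int.

Section Hilbert.
Context {R : realType} d {T : measurableType d}.
Variables (mu : {measure set T -> \bar R}) (D : set T).
Hypothesis mD : measurable D.
Variables (V : Type) (lc : R -> V -> R -> V -> V) (ip : V -> V -> R).
Variable rl : V -> T -> R.
Hypothesis ip_sym : forall x y, ip x y = ip y x.
Hypothesis ip_lc : forall a x b y z, ip (lc a x b y) z = a * ip x z + b * ip y z.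
Hypothesis ip_ge0 : forall x, 0 <= ip x x.
Hypothesis rl_lc : forall a x b y p, rl (lc a x b y) p = a * rl x p + b * rl y p.
Hypothesis rl_meas : forall x, measurable_fun D (rl x).

Notation itg := (itg mu D).
Notation Int := (Int mu D).
Definition n2 x := ip x x.
Definition l2 x := Int (fun p => rl x p ^+ 2).
Notation sub := (sub lc).

Variables (beta K : R).
Hypotheses (beta0 : 0 < beta) (K0 : 0 < K).
Hypothesis TM_itg : forall x, n2 x <= 1 -> itg (fun p => expR (beta * rl x p ^+ 2)).
Hypothesis TM_le : forall x, n2 x <= 1 -> Int (fun p => expR (beta * rl x p ^+ 2)) <= K.

Lemma n2_lc a x b y :
  n2 (lc a x b y) = a ^+ 2 * n2 x + 2 * a * b * ip x y + b ^+ 2 * n2 y.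
Proof. exact: (quad_lc ip_sym ip_lc). Qed.

Lemma n2_ge0 x : 0 <= n2 x. Proof. exact: ip_ge0. Qed.

(** A scaling into the unit ball that makes sense also when [n2 x] is 0. Homogeneous inequalities
    follow from those on the ball by letting [e] tend to 0. *)
Definition shrink x e := lc (Num.sqrt (n2 x + e))^-1 x 0 x.

Lemma shrink_n2 x e : 0 < e -> n2 (shrink x e) <= 1.
Proof.
move=> e0; have h : 0 < n2 x + e by rewrite ltr_wpDl// n2_ge0.
rewrite /shrink n2_lc expr0n /= !mulr0 !mul0r !addr0 exprVn sqr_sqrtr; last exact: ltW.
by rewrite mulrC ler_pdivrMr// mul1r lerDl ltW.
Qed.

Lemma shrink_rl x e p : 0 < e -> rl x p ^+ 2 = (n2 x + e) * rl (shrink x e) p ^+ 2.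
Proof.
move=> e0; have h : 0 < n2 x + e by rewrite ltr_wpDl// n2_ge0.
rewrite /shrink rl_lc mul0r addr0 exprMn exprVn sqr_sqrtr; last exact: ltW.
by rewrite mulrA divff ?mul1r// gt_eqF.
Qed.

Lemma rl2_le x p : rl x p ^+ 2 <= beta^-1 * expR (beta * rl x p ^+ 2).
Proof.
rewrite ler_pdivlMl//; apply: le_trans (expR_ge1Dx _).
by rewrite lerDr.
Qed.

Lemma itg_rl2 x : itg (fun p => rl x p ^+ 2).
Proof.
apply: (eq_itg mD (f := fun p => (n2 x + 1) * rl (shrink x 1) p ^+ 2)).
  by move=> p _; rewrite -shrink_rl.
apply: (itgZ mD); have := TM_itg (shrink_n2 x ltr01).
move=> /(itgZ mD beta^-1) h; apply: (itg_dom mD _ h).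
  by have := rl_meas (shrink x 1) => h1; meas.
by move=> p _; rewrite ger0_norm ?sqr_ge0// rl2_le.
Qed.

Lemma itg_rlM x y : itg (fun p => rl x p * rl y p).
Proof. by apply: itgM => //; exact: itg_rl2. Qed.

Definition li x y := Int (fun p => rl x p * rl y p).

Lemma li_sym x y : li x y = li y x.
Proof. by apply: eq_Int => p _; rewrite mulrC. Qed.

Lemma li_lc a x b y z : li (lc a x b y) z = a * li x z + b * li y z.
Proof.
rewrite /li -(Int_lin2 mD _ _ (itg_rlM _ _) (itg_rlM _ _)).
by apply: eq_Int => p _; rewrite rl_lc; ring.
Qed.

Lemma li_ge0 x : 0 <= li x x.
Proof. by apply: Int_ge0 => p _; rewrite -expr2 sqr_ge0. Qed.

Lemma l2_lc a x b y :
  l2 (lc a x b y) = a ^+ 2 * l2 x + 2 * a * b * li x y + b ^+ 2 * l2 y.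
Proof. exact: (quad_lc li_sym li_lc). Qed.

Lemma l2_ge0 x : 0 <= l2 x.
Proof. by apply: Int_ge0 => p _; exact: sqr_ge0. Qed.

Lemma l2_le_hom c x : 0 <= c -> (forall x, n2 x <= 1 -> l2 x <= c) -> l2 x <= c * n2 x.
Proof.
move=> c0 h; apply/ler_addgt0Pr => e e0.
pose e' := e / (c + 1).
have c1 : 0 < c + 1 by rewrite ltr_wpDl.
have e'0 : 0 < e' by rewrite divr_gt0.
have := h _ (shrink_n2 x e'0).
have -> : l2 x = (n2 x + e') * l2 (shrink x e').
  rewrite /l2 -(IntZ mD)//; last exact: itg_rl2.
  by apply: eq_Int => p _; rewrite -shrink_rl.
move=> h1; apply: (@le_trans _ _ ((n2 x + e') * c)).
  by rewrite ler_wpM2l// addr_ge0 ?n2_ge0// ltW.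
rewrite mulrDl mulrC lerD2l /e' -mulrA ler_piMr ?(ltW e0)//.
by rewrite mulrC ler_pdivrMr// mul1r lerDl.
Qed.

Lemma l2_le x : l2 x <= K / beta * n2 x.
Proof.
apply: l2_le_hom; first by rewrite divr_ge0// ltW.
move=> y y1; rewrite mulrC; apply: (@le_trans _ _ (Int (fun p => beta^-1 * expR (beta * rl y p ^+ 2)))).
  apply: Int_le => //; [exact: itg_rl2|exact: itgZ (TM_itg y1)|].
  by move=> p _; exact: rl2_le.
rewrite IntZ//; last exact: TM_itg.
by rewrite ler_pM2l ?invr_gt0// TM_le.
Qed.

(** For the Dirichlet space of a nonempty [Omega], the inverse of the first Dirichlet eigenvalue. *)
Definition lam := sup [set l2 x | x in [set x | n2 x <= 1]].

Lemma lam_has_ub : has_ubound [set l2 x | x in [set x | n2 x <= 1]].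
Proof.
exists (K / beta) => _ [x x1 <-]; apply: le_trans (l2_le x) _.
by rewrite ler_piMr// divr_ge0// ltW.
Qed.

Lemma l2_le_lam1 x : n2 x <= 1 -> l2 x <= lam.
Proof. by move=> x1; apply: ub_le_sup; [exact: lam_has_ub|exists x]. Qed.

Lemma lam_ge0 (x : V) : 0 <= lam.
Proof.
exact: le_trans (l2_ge0 (shrink x 1)) (l2_le_lam1 (shrink_n2 x ltr01)).
Qed.

Lemma l2_le_lam x : l2 x <= lam * n2 x.
Proof. by apply: l2_le_hom; [exact: lam_ge0 x|exact: l2_le_lam1]. Qed.

(* [dom x] majorises [1], [|w|], [w^2] and [exp (a w^2)] for [w] the
   realisation of [x] and [a <= beta / 32]. *)
Definition C0 := 1 + 32 / beta.
Definition dom x p := C0 * expR (beta / 32 * rl x p ^+ 2).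

Let b320 : 0 < beta / 32. Proof. by rewrite divr_gt0. Qed.

Lemma C0_ge1 : 1 <= C0.
Proof. by rewrite /C0 lerDl divr_ge0// ltW. Qed.

Lemma dom_sqr x p : rl x p ^+ 2 + 1 <= dom x p.
Proof.
rewrite /dom /C0 mulrDl mul1r.
have h0 : 0 <= rl x p ^+ 2 by exact: sqr_ge0.
have h := expR_ge1Dx (beta / 32 * rl x p ^+ 2).
have h1 : 1 <= expR (beta / 32 * rl x p ^+ 2).
  by apply: le_trans h; rewrite lerDl mulr_ge0// ltW.
rewrite addrC lerD//.
have {1}-> : rl x p ^+ 2 = 32 / beta * (beta / 32 * rl x p ^+ 2).
  by field; rewrite gt_eqF.
by rewrite ler_wpM2l ?divr_ge0 ?(ltW beta0)//; lra.
Qed.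

Lemma dom_ge1 x p : 1 <= dom x p.
Proof. by apply: le_trans (dom_sqr x p); rewrite lerDr sqr_ge0. Qed.

Lemma dom_abs x p : `|rl x p| <= dom x p.
Proof.
apply: le_trans (dom_sqr x p); rewrite -(real_normK (num_real (rl x p))).
have := sqr_ge0 (`|rl x p| - 1); have := sqr_ge0 (`|rl x p|); lra.
Qed.

Lemma dom_exp a x p : a <= beta / 32 -> expR (a * rl x p ^+ 2) <= dom x p.
Proof.
move=> h; rewrite /dom; apply: (@le_trans _ _ (expR (beta / 32 * rl x p ^+ 2))).
  by rewrite ler_expR ler_wpM2r// sqr_ge0.
by rewrite ler_peMl ?expR_ge0 ?C0_ge1.
Qed.

Definition dom4 x y z w p := dom x p * dom y p * (dom z p * dom w p).

Lemma dom4_ge1 x y z w p : 1 <= dom4 x y z w p.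
Proof.
by apply: mulr_ege1; apply: mulr_ege1; exact: dom_ge1.
Qed.

Lemma dom4P x y z w p : [/\ dom x p <= dom4 x y z w p, dom y p <= dom4 x y z w p,
  dom z p <= dom4 x y z w p & dom w p <= dom4 x y z w p].
Proof.
have hx := dom_ge1 x p; have hy := dom_ge1 y p.
have hz := dom_ge1 z p; have hw := dom_ge1 w p.
have hxy : 1 <= dom x p * dom y p by apply: mulr_ege1.
have hzw : 1 <= dom z p * dom w p by apply: mulr_ege1.
rewrite /dom4; split.
- by apply: (@le_trans _ _ (dom x p * dom y p)); rewrite ler_peMr// (le_trans ler01).
- apply: (@le_trans _ _ (dom x p * dom y p)).
    by rewrite ler_peMl// (le_trans ler01).
  by rewrite ler_peMr// (le_trans ler01).
- apply: (@le_trans _ _ (dom z p * dom w p)).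
    by rewrite ler_peMr// (le_trans ler01).
  by rewrite ler_peMl// (le_trans ler01).
- apply: (@le_trans _ _ (dom z p * dom w p)).
    by rewrite ler_peMl// (le_trans ler01).
  by rewrite ler_peMl// (le_trans ler01).
Qed.

(** The origin of 32. The eighth power turns the exponent [beta / 32] of [dom] into [beta / 4], and
    the arithmetic-geometric mean of four terms restores [beta], even for four different functions.
    Eighth powers occur because fourth powers of [dom4] get squared in Cauchy-Schwarz. *)
Lemma dom4_pow8 x y z w p : dom4 x y z w p ^+ 8 <= C0 ^+ 32 / 4 *
  (expR (beta * rl x p ^+ 2) + expR (beta * rl y p ^+ 2) +
   (expR (beta * rl z p ^+ 2) + expR (beta * rl w p ^+ 2))).
Proof.
pose e u := expR (beta / 4 * rl u p ^+ 2).
have dE u : dom u p ^+ 8 = C0 ^+ 8 * e u.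
  rewrite /dom exprMn; congr (_ * _); rewrite -expRM_natl /e; congr expR.
  by field.
have eE u : expR (beta * rl u p ^+ 2) = e u ^+ 4.
  by rewrite /e -expRM_natl; congr expR; field.
have e0 u : 0 < e u := expR_gt0 _.
have -> : dom4 x y z w p ^+ 8 =
  dom x p ^+ 8 * dom y p ^+ 8 * (dom z p ^+ 8 * dom w p ^+ 8).
  by rewrite /dom4; ring.
rewrite !dE !eE.
have -> : C0 ^+ 8 * e x * (C0 ^+ 8 * e y) * (C0 ^+ 8 * e z * (C0 ^+ 8 * e w)) =
  C0 ^+ 32 * ((e x * e y) * (e z * e w)) by ring.
rewrite -[leRHS]mulrA ler_wpM2l//.
  by rewrite exprn_ge0// (le_trans ler01 C0_ge1).
have h1 := sqr_ge0 (e x ^+ 2 - e y ^+ 2).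
have h2 := sqr_ge0 (e z ^+ 2 - e w ^+ 2).
have h3 := sqr_ge0 (e x * e y - e z * e w).
lra.
Qed.

Definition Kp := C0 ^+ 32 * K.

Lemma Kp_gt0 : 0 < Kp.
Proof. by rewrite mulr_gt0// exprn_gt0// (lt_le_trans ltr01 C0_ge1). Qed.

Section Moments.
Variables (x y z w : V).
Hypotheses (x1 : n2 x <= 1) (y1 : n2 y <= 1) (z1 : n2 z <= 1) (w1 : n2 w <= 1).

Let itg4 : itg (fun p => C0 ^+ 32 / 4 *
  (expR (beta * rl x p ^+ 2) + expR (beta * rl y p ^+ 2) +
   (expR (beta * rl z p ^+ 2) + expR (beta * rl w p ^+ 2)))).
Proof. by apply/itgZ/itgD => //; apply: itgD => //; exact: TM_itg. Qed.

Lemma moment_itg2 N (m : T -> R) : measurable_fun D m ->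
  (forall p, `|m p| <= N * dom4 x y z w p ^+ 4) -> itg (fun p => m p ^+ 2).
Proof.
move=> mm h; apply: (itg_dom mD _ (itgZ mD (N ^+ 2) itg4)); first by meas.
move=> p _; rewrite normrX; apply: (@le_trans _ _ (N ^+ 2 * dom4 x y z w p ^+ 8)).
  rewrite [leRHS](_ : _ = (N * dom4 x y z w p ^+ 4) ^+ 2); last by ring.
  by rewrite lerXn2r// ?nnegrE// (le_trans _ (h p)).
by rewrite ler_wpM2l ?sqr_ge0// dom4_pow8.
Qed.

Lemma moment_le2 N (m : T -> R) : measurable_fun D m ->
  (forall p, `|m p| <= N * dom4 x y z w p ^+ 4) ->
  Int (fun p => m p ^+ 2) <= N ^+ 2 * Kp.
Proof.
move=> mm h; apply: (@le_trans _ _ (Int (fun p => N ^+ 2 * (C0 ^+ 32 / 4 *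
  (expR (beta * rl x p ^+ 2) + expR (beta * rl y p ^+ 2) +
   (expR (beta * rl z p ^+ 2) + expR (beta * rl w p ^+ 2))))))).
  apply: Int_le => //; [exact: moment_itg2 mm h|exact: itgZ|] => p _.
  apply: (@le_trans _ _ (N ^+ 2 * dom4 x y z w p ^+ 8)).
    rewrite [leRHS](_ : _ = (N * dom4 x y z w p ^+ 4) ^+ 2); last by ring.
    rewrite -(real_normK (num_real (m p))).
    by rewrite lerXn2r// ?nnegrE// (le_trans _ (h p)).
  by rewrite ler_wpM2l ?sqr_ge0// dom4_pow8.
rewrite IntZ// ler_wpM2l ?sqr_ge0// IntZ//; last first.
  by apply: itgD => //; apply: itgD => //; exact: TM_itg.
rewrite !IntD//; try (by apply: itgD => //; exact: TM_itg); try exact: TM_itg.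
rewrite /Kp -mulrA ler_wpM2l ?exprn_ge0 ?(le_trans ler01 C0_ge1)//.
move: (TM_le x1) (TM_le y1) (TM_le z1) (TM_le w1).
move: (Int _) (Int _) (Int _) (Int _) C0 => s t r q c.
lra.
Qed.

Lemma moment_itg N (m : T -> R) : measurable_fun D m ->
  (forall p, `|m p| <= N * dom4 x y z w p ^+ 4) -> itg m.
Proof.
move=> mm h; apply: (itg_dom mD _ (itgZ mD `|N| itg4)) => // p _.
apply: le_trans (h p) _; apply: (@le_trans _ _ (`|N| * dom4 x y z w p ^+ 8)).
  have h1 := dom4_ge1 x y z w p.
  apply: ler_pM.
  - have := le_trans (normr_ge0 _) (h p).
    by rewrite pmulr_lge0// exprn_gt0// (lt_le_trans ltr01).
  - by rewrite exprn_ge0// (le_trans ler01).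
  - exact: ler_norm.
  - by rewrite ler_weXn2l.
by rewrite ler_wpM2l// dom4_pow8.
Qed.

End Moments.

Definition dst x y := Num.sqrt (l2 (sub x y)).

(** The common source of the continuity estimates for nonlinear integrals: Cauchy-Schwarz separates
    the difference of two realisations, measured in L2, from a factor whose moments are bounded
    uniformly on the unit ball. L2 convergence is therefore enough. *)
Lemma Int_diff_le x y z w N (u v : V) (f m : T -> R) :
  n2 x <= 1 -> n2 y <= 1 -> n2 z <= 1 -> n2 w <= 1 ->
  measurable_fun D f -> measurable_fun D m ->
  (forall p, `|m p| <= N * dom4 x y z w p ^+ 4) ->
  (forall p, `|f p| <= `|rl u p - rl v p| * `|m p|) ->
  `|Int f| <= N * Num.sqrt Kp * dst u v /\ itg f.
Proof.
move=> x1 y1 z1 w1 mf mm mN fm.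
have N0 (p : T) : 0 <= N.
  have := le_trans (normr_ge0 _) (mN p).
  by rewrite pmulr_lge0// exprn_gt0// (lt_le_trans ltr01)// dom4_ge1.
have is2 : itg (fun p => rl (sub u v) p ^+ 2) by exact: itg_rl2.
have im2 := moment_itg2 x1 y1 z1 w1 mm mN.
have ms : measurable_fun D (rl (sub u v)) by exact: rl_meas.
have isn2 : itg (fun p => `|rl (sub u v) p| ^+ 2).
  by apply: (eq_itg mD _ is2) => p _; rewrite real_normK ?num_real.
have imn2 : itg (fun p => `|m p| ^+ 2).
  by apply: (eq_itg mD _ im2) => p _; rewrite real_normK ?num_real.
have msn : measurable_fun D (fun p => `|rl (sub u v) p|) by meas.
have mmn : measurable_fun D (fun p => `|m p|) by meas.
have ism : itg (fun p => `|rl (sub u v) p| * `|m p|) by apply: itgM.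
have fm' p : `|f p| <= `|rl (sub u v) p| * `|m p|.
  by have := fm p; rewrite rl_lc mul1r mulN1r.
have itf : itg f by apply: (itg_dom mD _ ism).
split => //.
apply: (@le_trans _ _ (Int (fun p => `|rl (sub u v) p| * `|m p|))).
  apply: (le_trans (Int_norm_le mD itf)).
  by apply: Int_le => //; exact: itg_norm.
have := Int_CS mD msn mmn isn2 imn2.
set I := Int _ => h.
have I0 : 0 <= I by apply: Int_ge0 => p _; rewrite mulr_ge0.
(* The sign of [N] can be read off from the pointwise bound only if there is a point. *)
have [[p0 _]|noT] := pselect (exists p : T, True); last first.
  have D0 : D = set0 by apply/seteqP; split => // p _; case: noT; exists p.
  by rewrite /I /dst /l2 !Int_set0// sqrtr0 mulr0.
have {}N0 : 0 <= N := N0 p0.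
have r0 : 0 <= N * Num.sqrt Kp * dst u v.
  by apply: mulr_ge0; [apply: mulr_ge0 => //|]; exact: sqrtr_ge0.
rewrite -ler_sqr ?nnegrE//.
rewrite !exprMn !sqr_sqrtr; [|exact: l2_ge0|exact: ltW Kp_gt0].
apply: (le_trans h); rewrite mulrC.
have -> : Int (fun p => `|rl (sub u v) p| ^+ 2) = l2 (sub u v).
  by apply: eq_Int => q _; rewrite real_normK ?num_real.
have -> : Int (fun p => `|m p| ^+ 2) = Int (fun p => m p ^+ 2).
  by apply: eq_Int => q _; rewrite real_normK ?num_real.
by rewrite ler_wpM2r ?l2_ge0// (moment_le2 x1 y1 z1 w1).
Qed.

Definition J a u := Int (fun p => mos a (rl u p ^+ 2)).

Definition small a := 0 < a <= beta / 32.

Lemma mos_meas a u : measurable_fun D (fun p => mos a (rl u p ^+ 2)).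
Proof. by rewrite /mos; have := rl_meas u => h; meas. Qed.

Lemma powZ (Z N : R) k : 1 <= Z -> 0 <= N -> (k <= 4)%N -> N * Z ^+ k <= N * Z ^+ 4.
Proof. by move=> Z1 N0 k4; rewrite ler_wpM2l// ler_weXn2l. Qed.

Section FixedParameter.
Variable a : R.
Hypothesis sa : small a.

Let a0 : 0 < a. Proof. by case/andP: sa. Qed.
Let aB : a <= beta / 32. Proof. by case/andP: sa. Qed.

(* Every integrand met below is bounded by a multiple of a power of [Z]. *)
Lemma domZ x y z w p (Z := dom4 x y z w p) u :
  dom u p <= Z -> [/\ 1 <= Z, `|rl u p| <= Z, rl u p ^+ 2 <= Z &
    expR (a * rl u p ^+ 2) <= Z].
Proof.
move=> h; split; [exact: dom4_ge1|exact: le_trans (dom_abs u p) h| |].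
  by apply: le_trans h; apply: le_trans (dom_sqr u p); rewrite lerDl.
by apply: le_trans h; exact: dom_exp.
Qed.

Lemma J_itg u : n2 u <= 1 -> itg (fun p => mos a (rl u p ^+ 2)).
Proof.
move=> u1; apply: (moment_itg u1 u1 u1 u1 (mos_meas a u) (N := 1)) => p.
have [d1 _ _ _] := dom4P u u u u p; have [Z1 _ Z3 Z4] := domZ d1.
set Z := dom4 _ _ _ _ _ in Z1 Z3 Z4 *.
rewrite ger0_norm ?mos_ge0 ?sqr_ge0//.
apply: le_trans (powZ (k := 2) Z1 ler01 isT); rewrite mul1r expr2.
apply: (@le_trans _ _ (rl u p ^+ 2 * expR (a * rl u p ^+ 2))).
  apply: le_trans (mos_gap a0 (sqr_ge0 _)).
  by rewrite lerDl mulr_ge0 ?sqr_ge0// divr_ge0// ltW.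
by rewrite ler_pM ?sqr_ge0 ?expR_ge0.
Qed.

Lemma J_ge0 u : 0 <= J a u.
Proof. by apply: Int_ge0 => p _; rewrite mos_ge0 ?sqr_ge0. Qed.

Lemma J_lip u v : n2 u <= 1 -> n2 v <= 1 ->
  `|J a u - J a v| <= 4 * Num.sqrt Kp * dst u v.
Proof.
move=> u1 v1; rewrite -(IntB mD (J_itg u1) (J_itg v1)).
have mu' := rl_meas u; have mv' := rl_meas v.
have mJu := mos_meas a u; have mJv := mos_meas a v.
apply: (proj1 (@Int_diff_le u v u v 4 u v _ (fun p => (`|rl u p| + `|rl v p|) *
  (expR (a * rl u p ^+ 2) + expR (a * rl v p ^+ 2))) u1 v1 u1 v1 _ _ _ _)).
- by meas.
- by meas.
- move=> p; have [d1 d2 _ _] := dom4P u v u v p.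
  have [Z1 Z2 Z3 Z4] := domZ d1; have [_ Y2 Y3 Y4] := domZ d2.
  set Z := dom4 _ _ _ _ _ in Z1 Z2 Z3 Z4 Y2 Y3 Y4 *.
  apply: le_trans (powZ (k := 2) Z1 _ isT); last by [].
  rewrite ger0_norm; last by rewrite mulr_ge0// addr_ge0// expR_ge0.
  have -> : 4 * Z ^+ 2 = (Z + Z) * (Z + Z) by ring.
  by rewrite ler_pM ?addr_ge0 ?lerD ?expR_ge0.
- move=> p; rewrite [X in _ <= _ * X]ger0_norm; first exact: mos_lipschitz.
  by rewrite mulr_ge0 ?addr_ge0 ?expR_ge0.
Qed.

Definition Jsup := sup [set J a x | x in [set x | n2 x <= 1]].

Lemma J_le_sqr u : n2 u <= 1 -> J a u <= Kp.
Proof.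
move=> u1.
apply: (@le_trans _ _ (Int (fun p => (rl u p * expR (a / 2 * rl u p ^+ 2)) ^+ 2))).
  have mu' := rl_meas u.
  have e p : (rl u p * expR (a / 2 * rl u p ^+ 2)) ^+ 2 =
       rl u p ^+ 2 * expR (a * rl u p ^+ 2).
    by rewrite exprMn -expRM_natl; congr (_ * expR _); field.
  apply: Int_le => //; first exact: J_itg.
    apply: (moment_itg2 u1 u1 u1 u1 (N := 1)); first by meas.
    move=> p; have [d1 _ _ _] := dom4P u u u u p; have [Z1 Z2 Z3 Z4] := domZ d1.
    set Z := dom4 _ _ _ _ _ in Z1 Z2 Z3 Z4 *.
    apply: le_trans (powZ (k := 2) Z1 ler01 isT); rewrite mul1r expr2.
    rewrite normrM (ger0_norm (expR_ge0 _)) ler_pM ?expR_ge0//.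
    apply: le_trans Z4; rewrite ler_expR ler_wpM2r ?sqr_ge0//.
    by have := a0; lra.
  move=> p _; rewrite e; apply: le_trans (mos_gap a0 (sqr_ge0 _)).
  by rewrite lerDl mulr_ge0 ?sqr_ge0// divr_ge0// ltW.
have -> : Kp = 1 ^+ 2 * Kp by rewrite expr1n mul1r.
have mu' := rl_meas u.
apply: (moment_le2 u1 u1 u1 u1); first by meas.
move=> p; have [d1 _ _ _] := dom4P u u u u p; have [Z1 Z2 Z3 Z4] := domZ d1.
set Z := dom4 _ _ _ _ _ in Z1 Z2 Z3 Z4 *.
apply: le_trans (powZ (k := 2) Z1 ler01 isT); rewrite mul1r expr2.
rewrite normrM (ger0_norm (expR_ge0 _)) ler_pM ?expR_ge0//.
apply: le_trans Z4; rewrite ler_expR ler_wpM2r ?sqr_ge0//.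
by have := a0; lra.
Qed.

Lemma J_has_ub : has_ubound [set J a x | x in [set x | n2 x <= 1]].
Proof. by exists Kp => _ [x x1 <-]; exact: J_le_sqr. Qed.

Lemma J_le_sup u : n2 u <= 1 -> J a u <= Jsup.
Proof. by move=> u1; apply: ub_le_sup; [exact: J_has_ub|exists u]. Qed.

(** By [mos_scale], rescaling [u] to the sphere multiplies [J a] by at least the inverse of [n2 u].
    Near the supremum the norm is thus forced to be near 1. *)
Lemma J_scale_le u : n2 u <= 1 -> J a u <= n2 u * Jsup.
Proof.
rewrite le_eqVlt => /predU1P[u1|u1]; first by rewrite u1 mul1r J_le_sup ?u1.
apply/ler_addgt0Pr => e e0.
have S0 : 0 <= Jsup := le_trans (J_ge0 u) (J_le_sup (ltW u1)).
pose e' := Num.min (1 - n2 u) (e / (Jsup + 1)).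
have S1 : 0 < Jsup + 1 by rewrite ltr_wpDl.
have e'0 : 0 < e' by rewrite lt_min subr_gt0 u1 divr_gt0.
have ee : e' * Jsup <= e.
  apply: (@le_trans _ _ (e / (Jsup + 1) * Jsup)).
    by rewrite ler_wpM2r// ge_min lexx orbT.
  by rewrite -mulrA ler_piMr ?(ltW e0)// mulrC ler_pdivrMr// mul1r lerDl.
have s1 := shrink_n2 u e'0.
apply: (@le_trans _ _ ((n2 u + e') * J a (shrink u e'))).
  rewrite /J -(IntZ mD); last exact: J_itg.
  apply: Int_le => //; [exact/J_itg/ltW|exact/itgZ/J_itg|] => p _.
  rewrite (shrink_rl u p e'0) mos_scale// addr_ge0 ?n2_ge0 ?(ltW e'0)//=.
  by rewrite -lerBrDl ge_min lexx.
apply: (@le_trans _ _ ((n2 u + e') * Jsup)).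
  by rewrite ler_wpM2l ?J_le_sup// addr_ge0 ?n2_ge0 ?(ltW e'0).
by rewrite mulrDl lerD2l.
Qed.

End FixedParameter.

Variable U : set_system nat.
Context {UU : UltraFilter U}.
Hypothesis Uoo : \oo `<=` U.

Hypothesis complete : forall X : nat -> V,
  (forall e : R, 0 < e -> exists N, forall n m, (N <= n)%N -> (N <= m)%N ->
    n2 (sub (X n) (X m)) < e) ->
  exists x, forall e : R, 0 < e -> exists N, forall n, (N <= n)%N ->
    n2 (sub (X n) x) < e.

(** Compactness is stated as a Cauchy property along [U], so that no limit function in L2 has to be
    produced. *)
Definition l2cauchy (X : nat -> V) := forall e : R, 0 < e ->
  exists A, U A /\ forall n m, A n -> A m -> l2 (sub (X n) (X m)) < e.

Hypothesis compact : forall X : nat -> V, (forall n, n2 (X n) <= 1) -> l2cauchy X.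

Definition scv (X : nat -> V) x := n2 (sub (X n) x) @[n --> U] --> (0 : R).

Lemma near_lt (f : nat -> R) e : f n @[n --> U] --> (0 : R) -> 0 < e ->
  \forall n \near U, f n < e.
Proof.
move=> /cvgrPdist_lt/[apply]; apply: filterS => n /=.
by rewrite sub0r normrN; apply: le_lt_trans; rewrite ler_norm.
Qed.

Lemma cvg0_of_near (f : nat -> R) : (forall n, 0 <= f n) ->
  (forall e : R, 0 < e -> \forall n \near U, f n < e) -> f n @[n --> U] --> (0 : R).
Proof.
move=> f0 h; apply/cvgrPdist_lt => e /h; apply: filterS => n.
by rewrite sub0r normrN ger0_norm.
Qed.

(** [complete] is about sequences. Indices [s k] are picked in the intersection of the first Cauchy
    sets [A i], all of which belong to [U]; the limit of that sequence attracts the whole family. *)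
Lemma completeU (X : nat -> V) :
  (forall e : R, 0 < e -> exists A, U A /\ forall n m, A n -> A m ->
    n2 (sub (X n) (X m)) < e) ->
  exists x, scv X x.
Proof.
move=> h; have /choice[A HA] (k : nat) : exists A, U A /\ forall n m, A n -> A m ->
    n2 (sub (X n) (X m)) < (k.+1%:R^-1 : R).
  by apply: h; rewrite invr_gt0.
have /choice[s Hs] (k : nat) : exists n, forall i, (i <= k)%N -> A i n.
  have : \forall n \near U, forall i, (i <= k)%N -> A i n.
    elim: k => [|k IH].
      by apply: filterS (HA 0%N).1 => n An i; rewrite leqn0 => /eqP ->.
    apply: filterS2 IH (HA k.+1).1 => n IH An i.
    by rewrite leq_eqVlt => /predU1P[->//|/IH].
  by move=> /filter_ex.
have inv_small (e : R) : 0 < e -> exists k : nat, (k.+1%:R^-1 : R) < e.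
  move=> e0; have [k] := ltr_add_invr e0.
  by rewrite add0r => ?; exists k.
have [x Hx] : exists x, forall e : R, 0 < e -> exists N, forall n, (N <= n)%N ->
    n2 (sub (X (s n)) x) < e.
  apply: (complete (X := X \o s)) => e /inv_small[k ke].
  exists k => n m kn km; apply: lt_trans ke.
  by apply: (HA k).2; apply: Hs.
exists x; apply: cvg0_of_near => [n|e e0]; first exact: n2_ge0.
have e4 : 0 < e / 4 by rewrite divr_gt0.
have [k ke] := inv_small _ e4; have [N HN] := Hx _ e4.
apply: filterS (HA k).1 => n Akn.
apply: (le_lt_trans (quad_sub_trans ip_sym ip_lc ip_ge0 _ (X (s (maxn k N))) _)).
have h1 := HN (maxn k N) (leq_maxr _ _).
have h2 := (HA k).2 n (s (maxn k N)) Akn (Hs _ _ (leq_maxl _ _)).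
move: h1 (lt_trans h2 ke); rewrite /n2; lra.
Qed.

Lemma scv_ip X x Y y : scv X x -> scv Y y -> ip (X n) (Y n) @[n --> U] --> ip x y.
Proof. exact: form_cvg. Qed.

Lemma scv_n2 X x : scv X x -> n2 (X n) @[n --> U] --> n2 x.
Proof. by move=> h; exact: scv_ip. Qed.

Lemma scv_l2sub X x : scv X x -> l2 (sub (X n) x) @[n --> U] --> (0 : R).
Proof.
move=> h; have h0 : K / beta * n2 (sub (X n) x) @[n --> U] --> (0 : R).
  by rewrite -(mulr0 (K / beta)); exact: cvgMl_tmp.
apply: squeeze_cvgr (cvg_cst 0) h0; apply: nearW => n.
by rewrite l2_ge0 l2_le.
Qed.

Lemma scv_l2 X x : scv X x -> l2 (X n) @[n --> U] --> l2 x.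
Proof.
move=> /scv_l2sub h.
exact: (form_cvg li_sym li_lc li_ge0 (F := U) (X := X) (Y := X) h h).
Qed.

Lemma scv_dst X x : scv X x -> dst (X n) x @[n --> U] --> (0 : R).
Proof.
move=> /scv_l2sub h; rewrite -[X in _ --> X]sqrtr0.
by apply: continuous_cvg h; exact: sqrt_continuous.
Qed.

Lemma n2_parallelogram x y :
  n2 (sub x y) = 2 * n2 x + 2 * n2 y - n2 (lc 1 x 1 y).
Proof. by rewrite !n2_lc; ring. Qed.

Lemma l2_parallelogram x y :
  l2 (sub x y) = 2 * l2 x + 2 * l2 y - l2 (lc 1 x 1 y).
Proof. by rewrite !l2_lc; ring. Qed.

Lemma n2_sub_le4 x y : n2 x <= 1 -> n2 y <= 1 -> n2 (sub x y) <= 4.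
Proof.
move=> x1 y1; apply: le_trans (quad_lc_le ip_sym ip_lc ip_ge0 _ _ _ _) _.
rewrite -![ip _ _]/(n2 _); move: x1 y1; move: (n2 x) (n2 y) => s t; lra.
Qed.

(** Uniform convexity: by the parallelogram law, vectors of norm almost 1 whose pairwise sums have
    norm almost 2 are Cauchy. This replaces weak limits and lower semicontinuity. *)
Lemma strong_cvg (X : nat -> V) :
  (forall e : R, 0 < e -> \forall n \near U, n2 (X n) <= 1 + e) ->
  (forall e : R, 0 < e -> exists A, U A /\ forall n m, A n -> A m ->
     4 - e <= n2 (lc 1 (X n) 1 (X m))) ->
  exists x, scv X x /\ n2 x = 1.
Proof.
move=> h1 h4.
have [x Xx] : exists x, scv X x.
  apply: completeU => e e0.
  have e8 : 0 < e / 8 by rewrite divr_gt0.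
  have [A [UA HA]] := h4 _ e8.
  exists (A `&` [set n | n2 (X n) <= 1 + e / 8]); split.
    by apply: filterI => //; exact: h1.
  move=> n m [An n1] [Am m1]; rewrite n2_parallelogram.
  by have := HA n m An Am; move: n1 m1 => /=; lra.
exists x; split => //; apply: (cvg_unique _ (scv_n2 Xx)) => //.
apply/cvgrPdist_lt => e e0; have e2 : 0 < e / 2 by rewrite divr_gt0.
have [A [UA HA]] := h4 _ e2.
apply: filterS2 UA (h1 _ e2) => n An n1.
have hn : n2 (lc 1 (X n) 1 (X n)) = 4 * n2 (X n) by rewrite n2_lc /n2; ring.
have := HA n n An An; rewrite hn => h.
by rewrite ltr_norml; apply/andP; split; lra.
Qed.

(** L2-close vectors have a sum of squared L2 norm near [4 * lam], and [l2_le_lam] converts this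
    into a lower bound on the norm of the sum. *)
Lemma lam_cvg (X : nat -> V) : 0 < lam ->
  (forall e : R, 0 < e -> \forall n \near U, n2 (X n) <= 1 + e) -> l2cauchy X ->
  l2 (X n) @[n --> U] --> lam -> exists x, [/\ scv X x, n2 x = 1 & l2 x = lam].
Proof.
move=> lam0 h1 cX Xlam.
have [x [Xx x1]] : exists x, scv X x /\ n2 x = 1.
  apply: strong_cvg => // e e0.
  have e5 : 0 < lam * e / 5 by rewrite divr_gt0// mulr_gt0.
  have [A [UA HA]] := cX _ e5.
  have /cvgrPdist_lt/(_ _ e5) := Xlam => UB.
  exists (A `&` [set n | `|lam - l2 (X n)| < lam * e / 5]); split.
    exact: filterI.
  move=> n m [An /= n1] [Am /= m1].
  have := l2_le_lam (lc 1 (X n) 1 (X m)); have := HA n m An Am.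
  rewrite l2_parallelogram; move: n1 m1; rewrite !ltr_norml => /andP[_ n1] /andP[_ m1].
  move=> h2 h3; rewrite -(ler_pM2l lam0); apply: le_trans h3; lra.
exists x; split => //; exact: (cvg_unique _ (scv_l2 Xx) Xlam).
Qed.

Lemma l2_scale c x y : (forall p, rl x p = c * rl y p) -> l2 x = c ^+ 2 * l2 y.
Proof.
move=> h; rewrite /l2 -(IntZ mD); last exact: itg_rl2.
by apply: eq_Int => p _; rewrite h exprMn.
Qed.

(** The midpoint [w] of two L2-close members still almost maximizes [J a], by [J_lip]; [J_scale_le]
    then forces [n2 w] to be near 1. *)
Lemma J_cvg a (X : nat -> V) : small a -> 0 < Jsup a ->
  (forall n, n2 (X n) <= 1) -> J a (X n) @[n --> U] --> Jsup a ->
  exists x, [/\ scv X x, n2 x = 1 & J a x = Jsup a].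
Proof.
move=> sa S0 X1 XS; set S := Jsup a in S0 XS *.
pose L := 4 * Num.sqrt Kp.
have L0 : 0 < L by rewrite mulr_gt0// sqrtr_gt0 Kp_gt0.
have [x [Xx x1]] : exists x, scv X x /\ n2 x = 1.
  apply: strong_cvg => e e0.
    by apply: nearW => n; apply: le_trans (X1 n) _; rewrite lerDl ltW.
  have e8 : 0 < S * e / 8 by rewrite divr_gt0// mulr_gt0.
  have eL : 0 < (S * e / 8 / L) ^+ 2 by rewrite exprn_gt0// divr_gt0.
  have [A [UA HA]] := compact X1 eL.
  have /cvgrPdist_lt/(_ _ e8) := XS => UB.
  exists (A `&` [set n | `|S - J a (X n)| < S * e / 8]); split; first exact: filterI.
  move=> n m [An /= n1] [Am /= m1].
  pose w := lc 2^-1 (X n) 2^-1 (X m).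
  have w4 : n2 (lc 1 (X n) 1 (X m)) = 4 * n2 w by rewrite !n2_lc; field.
  have w1 : n2 w <= 1.
    have := n2_ge0 (sub (X n) (X m)); rewrite n2_parallelogram w4.
    by move: (X1 n) (X1 m); lra.
  rewrite w4.
  have dw : dst w (X m) <= S * e / 8 / L.
    rewrite /dst -[leRHS]ger0_norm; last by rewrite ltW// divr_gt0.
    rewrite -sqrtr_sqr ler_wsqrtr//.
    rewrite (@l2_scale (2^-1) _ (sub (X n) (X m))).
      by move: (HA n m An Am) (l2_ge0 (sub (X n) (X m))); lra.
    by move=> p; rewrite !rl_lc; field.
  have jw : S - S * e / 4 <= J a w.
    have := J_lip sa w1 (X1 m); rewrite -/L => hl.
    have hd : L * dst w (X m) <= S * e / 8.
      by rewrite mulrC -ler_pdivlMr.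
    move: hl m1; rewrite ler_norml ltr_norml => /andP[hl _] /andP[_ m1].
    by move: hl m1 hd; lra.
  have := J_scale_le sa w1; rewrite -/S => js.
  by rewrite -(ler_pM2l S0); move: jw js w1; lra.
exists x; split => //.
have Jx : J a (X n) @[n --> U] --> J a x.
  apply/subr_cvg0/norm_cvg0P.
  have h0 : L * dst (X n) x @[n --> U] --> (0 : R).
    by rewrite -(mulr0 L); apply: cvgMl_tmp; exact: scv_dst.
  apply: squeeze_cvgr (cvg_cst 0) h0; apply: nearW => n.
  by rewrite normr_ge0 J_lip// x1.
exact: (cvg_unique _ Jx XS).
Qed.

(** Absolute values are only assumed to be approximable with almost no increase of norm; for
    eigenvectors [eigen_abs] shows that they are attained. *)
Hypothesis absV : forall x (e : R), 0 < e -> exists w, n2 w <= n2 x + e /\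
  Int (fun p => (rl w p - `|rl x p|) ^+ 2) <= e.

(** * The first eigenspace and its quartic maximizers *)

Section PositiveEigenvalue.
Hypothesis lam0 : 0 < lam.

(** Equality in the Rayleigh quotient. Zero is included, so that these vectors are stable under
    linear combinations. *)
Definition eigen x := l2 x = lam * n2 x.

(** The weak eigenvalue equation. The form [lam * ip - li] is nonnegative and vanishes at [x], so by
    Cauchy-Schwarz [x] lies in its kernel. *)
Lemma eigen_form x y : eigen x -> li x y = lam * ip x y.
Proof.
move=> ex; pose B u v := lam * ip u v - li u v.
have Bs u v : B u v = B v u by rewrite /B ip_sym li_sym.
have Bl a u b v z : B (lc a u b v) z = a * B u z + b * B v z.
  by rewrite /B ip_lc li_lc; ring.
have B0 u : 0 <= B u u by rewrite subr_ge0; exact: l2_le_lam.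
have := form_CS Bs Bl B0 x y.
have -> : B x x = 0 by apply/eqP; rewrite subr_eq0; apply/eqP; exact/esym/ex.
rewrite mul0r => h; apply/eqP; rewrite eq_sym -subr_eq0 -sqrf_eq0.
by rewrite eq_le h sqr_ge0.
Qed.

Lemma eigen_lc a x b y : eigen x -> eigen y -> eigen (lc a x b y).
Proof.
move=> ex ey; rewrite /eigen n2_lc l2_lc (eigen_form _ ex) ex ey; ring.
Qed.

Lemma l2_eq0_ae x : l2 x = 0 -> {ae mu, forall p, D p -> rl x p = 0}.
Proof.
move=> x0; have := Int_eq0_ae mD (itg_rl2 x) (fun p _ => sqr_ge0 _) x0.
by apply: filterS => p /[apply] /eqP; rewrite sqrf_eq0 => /eqP.
Qed.

Lemma itg_subf x (g : T -> R) : measurable_fun D g -> itg (fun p => g p ^+ 2) ->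
  itg (fun p => (rl x p - g p) ^+ 2).
Proof.
move=> mg ig; have mx := rl_meas x.
apply: (itg_dom mD _ (itgD mD (itgZ mD 2 (itg_rl2 x)) (itgZ mD 2 ig))).
  by meas.
move=> p _; rewrite ger0_norm ?sqr_ge0//.
have := sqr_ge0 (rl x p + g p); lra.
Qed.

Lemma l2_sub_le_fun x y (g : T -> R) : measurable_fun D g ->
  itg (fun p => g p ^+ 2) ->
  l2 (sub x y) <= 2 * Int (fun p => (rl x p - g p) ^+ 2) +
                  2 * Int (fun p => (rl y p - g p) ^+ 2).
Proof.
move=> mg ig; rewrite -Int_lin2//; [|exact: itg_subf..].
apply: Int_le => //; first exact: itg_rl2.
  by apply: itgD => //; apply: itgZ => //; exact: itg_subf.
move=> p _; rewrite rl_lc.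
have := sqr_ge0 (rl x p - g p + (rl y p - g p)); lra.
Qed.

Lemma l2cauchy_fun (X : nat -> V) (g : T -> R) : measurable_fun D g ->
  itg (fun p => g p ^+ 2) ->
  Int (fun p => (rl (X n) p - g p) ^+ 2) @[n --> U] --> (0 : R) -> l2cauchy X.
Proof.
move=> mg ig h e e0; have e4 : 0 < e / 4 by rewrite divr_gt0.
exists [set n | Int (fun p => (rl (X n) p - g p) ^+ 2) < e / 4]; split.
  exact: near_lt h e4.
move=> n m /= hn hm.
by have := l2_sub_le_fun (X n) (X m) mg ig; lra.
Qed.

Lemma l2_cvg_fun (X : nat -> V) (g : T -> R) : measurable_fun D g ->
  itg (fun p => g p ^+ 2) ->
  Int (fun p => (rl (X n) p - g p) ^+ 2) @[n --> U] --> (0 : R) ->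
  l2 (X n) @[n --> U] --> Int (fun p => g p ^+ 2).
Proof.
move=> mg ig h.
have e n : l2 (X n) - Int (fun p => g p ^+ 2) =
    2 * Int (fun p => (rl (X n) p - g p) * g p) +
    Int (fun p => (rl (X n) p - g p) ^+ 2).
  have mx := rl_meas (X n).
  have i1 : itg (fun p => (rl (X n) p - g p) * g p).
    by apply: itgM => //; [meas|exact: itg_subf].
  have i2 := itg_subf (X n) mg ig.
  rewrite /l2 -(IntB mD (itg_rl2 _) ig) -(IntZ mD _ i1) -(IntD mD (itgZ mD _ i1) i2).
  by apply: eq_Int => p _; ring.
apply/subr_cvg0; rewrite (_ : (fun n => _) = fun n =>
    2 * Int (fun p => (rl (X n) p - g p) * g p) +
    Int (fun p => (rl (X n) p - g p) ^+ 2)); last exact/funext.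
rewrite -[X in _ --> X](addr0 (0:R)); apply: cvgD => //.
rewrite -(mulr0 2); apply: cvgMl_tmp.
apply/norm_cvg0P.
pose G := Int (fun p => g p ^+ 2).
have h0 : Num.sqrt (Int (fun p => (rl (X n) p - g p) ^+ 2)) * Num.sqrt G
    @[n --> U] --> (0 : R).
  rewrite -(mul0r (Num.sqrt G)); apply: cvgMr_tmp.
  by rewrite -[X in _ --> X]sqrtr0; apply: continuous_cvg h; exact: sqrt_continuous.
apply: squeeze_cvgr (cvg_cst 0) h0; apply: nearW => n.
rewrite normr_ge0/= -sqrtrM; last by apply: Int_ge0 => p _; exact: sqr_ge0.
rewrite -sqrtr_sqr ler_wsqrtr//.
have mx := rl_meas (X n).
by apply: Int_CS => //; [meas|exact: itg_subf].
Qed.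

Lemma ae_eq_lim (X : nat -> V) x (g : T -> R) : measurable_fun D g ->
  itg (fun p => g p ^+ 2) ->
  Int (fun p => (rl (X n) p - g p) ^+ 2) @[n --> U] --> (0 : R) -> scv X x ->
  {ae mu, forall p, D p -> rl x p = g p}.
Proof.
move=> mg ig h /scv_l2sub Xx.
have i2 := itg_subf x mg ig.
have h0 : 2 * l2 (sub (X n) x) + 2 * Int (fun p => (rl (X n) p - g p) ^+ 2)
   @[n --> U] --> (0 : R).
  rewrite -[X in _ --> X](addr0 (0 : R)).
  by apply: cvgD; rewrite -[X in _ --> X](mulr0 (2 : R));
    [exact: cvgMl_tmp Xx|exact: cvgMl_tmp h].
have I0 : Int (fun p => (rl x p - g p) ^+ 2) = 0.
  apply/eqP; rewrite eq_le; apply/andP; split; last first.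
    by apply: Int_ge0 => p _; exact: sqr_ge0.
  apply/ler_addgt0Pr => e e0; rewrite add0r.
  have [n hn] := filter_ex (near_lt h0 e0).
  apply: le_trans (ltW hn).
  rewrite -(Int_lin2 mD _ _ (itg_rl2 _) (itg_subf _ mg ig)).
  apply: Int_le => //.
    by apply: itgD => //; apply: itgZ => //; [exact: itg_rl2|exact: itg_subf].
  move=> p _; rewrite rl_lc.
  have := sqr_ge0 (rl (X n) p - rl x p + (rl (X n) p - g p)); lra.
have := Int_eq0_ae mD i2 (fun p _ => sqr_ge0 _) I0.
by apply: filterS => p /[apply] /eqP; rewrite sqrf_eq0 subr_eq0 => /eqP.
Qed.

(** On eigenvectors [l2] is [lam * n2], so a family that is Cauchy in L2 is already Cauchy in
    [V]. *)
Lemma eigen_closed (X : nat -> V) (g : T -> R) : measurable_fun D g ->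
  itg (fun p => g p ^+ 2) -> (forall n, eigen (X n)) ->
  Int (fun p => (rl (X n) p - g p) ^+ 2) @[n --> U] --> (0 : R) ->
  exists x, eigen x /\ {ae mu, forall p, D p -> rl x p = g p}.
Proof.
move=> mg ig eX h.
have [x Xx] : exists x, scv X x.
  apply: completeU => e e0.
  have [A [UA HA]] := l2cauchy_fun mg ig h (mulr_gt0 lam0 e0).
  exists A; split => // n m An Am; rewrite -(ltr_pM2l lam0).
  by rewrite -(eigen_lc 1 (-1) (eX n) (eX m)); exact: HA.
exists x; split; last exact: ae_eq_lim h Xx.
apply: (cvg_unique _ (scv_l2 Xx)) => //.
rewrite (_ : (fun n => l2 (X n)) = (fun n => lam * n2 (X n))); last first.
  by apply/funext => n; exact: eX.
by apply: cvgMl_tmp; exact: scv_n2.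
Qed.

Lemma inv_cvg0 : (n.+1%:R^-1 : R) @[n --> U] --> (0 : R).
Proof. by apply: cvg_trans (@cvg_harmonic R) => A; exact: Uoo. Qed.

(** After normalisation, the approximations given by [absV] have norms at most almost 1 and L2 norms
    tending to the maximal one, so [lam_cvg] makes them converge strongly to a maximizer. *)
Lemma eigen_abs x : eigen x ->
  exists w, eigen w /\ {ae mu, forall p, D p -> rl w p = `|rl x p|}.
Proof.
move=> ex; have [x0|x0] := eqVneq (n2 x) 0.
  exists x; split => //; have := ex; rewrite /eigen x0 mulr0 => /l2_eq0_ae.
  by apply: filterS => p /[apply] ->; rewrite normr0.
have {}x0 : 0 < n2 x by rewrite lt_neqAle eq_sym x0 n2_ge0.
pose s := Num.sqrt (n2 x); have s0 : 0 < s by rewrite sqrtr_gt0.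
pose y := lc s^-1 x 0 x.
have ey : eigen y by exact: eigen_lc.
have y1 : n2 y = 1.
  have ss : s ^+ 2 = n2 x by rewrite sqr_sqrtr ?n2_ge0.
  by rewrite /y n2_lc -ss; field; rewrite gt_eqF.
have /choice[X HX] (n : nat) : exists w, n2 w <= 1 + n.+1%:R^-1 /\
    Int (fun p => (rl w p - `|rl y p|) ^+ 2) <= n.+1%:R^-1.
  have e0 : 0 < (n.+1%:R^-1 : R) by rewrite invr_gt0.
  by have [w] := absV y e0; rewrite y1; exists w.
have my := rl_meas y.
have mg : measurable_fun D (fun p => `|rl y p|) by meas.
have ig : itg (fun p => `|rl y p| ^+ 2).
  by apply: (eq_itg mD _ (itg_rl2 y)) => p _; rewrite real_normK ?num_real.
have h : Int (fun p => (rl (X n) p - `|rl y p|) ^+ 2) @[n --> U] --> (0 : R).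
  apply: squeeze_cvgr (cvg_cst 0) inv_cvg0; apply: nearW => n.
  by rewrite (HX n).2 andbT; apply: Int_ge0 => p _; exact: sqr_ge0.
have Ig : Int (fun p => `|rl y p| ^+ 2) = lam.
  rewrite -[RHS]mulr1 -y1 -ey; apply: eq_Int => p _.
  by rewrite real_normK ?num_real.
have [w [Xw w1 wl]] : exists w, [/\ scv X w, n2 w = 1 & l2 w = lam].
  apply: lam_cvg => //.
  - move=> e e0; have := near_lt inv_cvg0 e0; apply: filterS => n ne.
    by apply: le_trans (HX n).1 _; rewrite lerD2l ltW.
  - exact: l2cauchy_fun h.
  - by rewrite -Ig; exact: l2_cvg_fun h.
exists (lc s w 0 w); split.
  by apply: eigen_lc; rewrite /eigen w1 mulr1.
have := ae_eq_lim mg ig h Xw; apply: filterS => p /[apply] wy.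
rewrite rl_lc wy mul0r addr0 /y rl_lc mul0r addr0 normrM gtr0_norm ?invr_gt0//.
by rewrite mulrA divff ?mul1r// gt_eqF.
Qed.

Lemma eigen_pos x : eigen x ->
  exists w, eigen w /\ {ae mu, forall p, D p -> rl w p = Num.max (rl x p) 0}.
Proof.
move=> ex; have [y [ey hy]] := eigen_abs ex.
exists (lc 2^-1 x 2^-1 y); split; first exact: eigen_lc.
apply: filterS hy => p /[apply] yx; rewrite rl_lc yx /Num.max.
case: ltP => h; first by rewrite ler0_norm ?ltW//; ring.
by rewrite ger0_norm//; field.
Qed.

(* [v 1_{z <= 0}] is the limit of [(v - k z^+)^+] as [k] tends to infinity. *)
Lemma eigen_cut v z : eigen v -> eigen z ->
  {ae mu, forall p, D p -> 0 <= rl v p} ->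
  exists y, eigen y /\ {ae mu, forall p, D p ->
    rl y p = if rl z p <= 0 then rl v p else 0}.
Proof.
move=> ev ez vpos.
have [zp [ezp hzp]] := eigen_pos ez.
pose g p := if rl z p <= 0 then rl v p else 0.
have mv := rl_meas v; have mz := rl_meas z.
have mg : measurable_fun D g.
  apply: measurable_fun_if => //=.
  - by apply: measurable_fun_ler.
  - by apply: measurable_funS mv => //; exact: subIsetl.
have ig : itg (fun p => g p ^+ 2).
  apply: (itg_dom mD _ (itg_rl2 v)); first by meas.
  move=> p _; rewrite ger0_norm ?sqr_ge0// /g; case: ifP => // _.
  by rewrite expr0n sqr_ge0.
have /choice[X HX] (k : nat) := eigen_pos (eigen_lc 1 (- k%:R) ev ezp).
apply: (eigen_closed mg ig) => [n|]; first exact: (HX n).1.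
pose h k p := (Num.max (rl v p - k%:R * Num.max (rl z p) 0) 0 - g p) ^+ 2.
have mh k : measurable_fun D (h k).
  rewrite /h; apply: measurable_funX; apply: measurable_funB => //.
  apply: measurable_maxr => //; apply: measurable_funB => //.
  by apply: measurable_funM => //; apply: measurable_maxr.
have hv k p : h k p <= rl v p ^+ 2.
  rewrite /h /g; case: (leP (rl z p) 0) => z0.
    rewrite mulr0 subr0 /Num.max; case: ltP => v0.
      by rewrite sub0r sqrrN.
    by rewrite subrr expr0n sqr_ge0.
  rewrite subr0 /Num.max; case: ltP => v0.
    by rewrite expr0n sqr_ge0.
  have : 0 <= k%:R * rl z p by rewrite mulr_ge0// ltW.
  by move: v0; set t := k%:R * _ => v0 t0; nra.
have cv : Int (h k) @[k --> \oo] --> 0.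
  pose A := [set p | 0 <= rl v p].
  (* [v] is nonnegative only almost everywhere, whereas [Int_dct] expects convergence at every
     point. *)
  pose h' k p := if 0 <= rl v p then h k p else 0.
  have mh' k : measurable_fun D (h' k).
    apply: measurable_fun_if => //=; first exact: measurable_fun_ler.
    by apply: measurable_funS (mh k) => //; exact: subIsetl.
  have h'v k p : `|h' k p| <= rl v p ^+ 2.
    rewrite /h'; case: ifP => _; last by rewrite normr0 sqr_ge0.
    by rewrite ger0_norm ?sqr_ge0.
  rewrite (_ : (fun k => Int (h k)) = fun k => Int (h' k)); last first.
    apply/funext => k; apply: Int_ae => //.
    - apply: (itg_dom mD _ (itg_rl2 v)) => // p _.
      by rewrite ger0_norm ?sqr_ge0.
    - by apply: (itg_dom mD _ (itg_rl2 v)).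
    - by apply: filterS vpos => p /[apply] v0; rewrite /h' v0.
  apply: (Int_dct mD (g := fun p => rl v p ^+ 2)) => //.
    exact: itg_rl2.
  move=> p _; rewrite /h'; case: (boolP (0 <= rl v p)) => v0; last exact: cvg_cst.
  rewrite /h /g; case: (leP (rl z p) 0) => z0.
    rewrite (_ : (fun k => _) = fun=> 0); first exact: cvg_cst.
    by apply/funext => k; rewrite mulr0 subr0 max_l// subrr expr0n.
  apply: cvg_near_cst.
  exists (Num.bound (rl v p / rl z p)) => // k /= hk.
  rewrite subr0 max_r ?expr0n// subr_le0.
  rewrite -ler_pdivrMr//; apply: le_trans (ltW (archi_boundP _)) _.
    by rewrite divr_ge0// ltW.
  by rewrite ler_nat.
have {}cv : Int (h k) @[k --> U] --> 0 by apply: cvg_trans cv => A; exact: Uoo.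
rewrite (_ : (fun n => Int _) = fun k => Int (h k)) //.
apply/funext => k; apply: Int_ae => //.
- exact: itg_subf.
- apply: (itg_dom mD _ (itg_rl2 v)) => // p _.
  by rewrite ger0_norm ?sqr_ge0.
- apply: filterS2 (HX k).2 hzp => p hX hz Dp.
  by rewrite hX// rl_lc hz// mul1r mulNr.
Qed.

Lemma small_beta : small (beta / 32).
Proof. by rewrite /small b320 lexx. Qed.

Lemma itg_rl4_ball x : n2 x <= 1 -> itg (fun p => rl x p ^+ 4).
Proof.
move=> x1; have mx := rl_meas x.
apply: (moment_itg x1 x1 x1 x1 (N := 1)); first by meas.
move=> p; have [d1 _ _ _] := dom4P x x x x p.
have [Z1 Z2 _ _] := domZ small_beta d1.
by rewrite mul1r normrX lerXn2r// nnegrE (le_trans ler01 Z1).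
Qed.

Lemma itg_rl4 x : itg (fun p => rl x p ^+ 4).
Proof.
have := itgZ mD ((n2 x + 1) ^+ 2) (itg_rl4_ball (shrink_n2 x ltr01)).
apply: (eq_itg mD) => p _.
rewrite -[4%N]/(2 * 2)%N [in RHS]exprM (shrink_rl x p ltr01) exprMn.
by rewrite -exprM.
Qed.

Definition N4 x := Int (fun p => rl x p ^+ 4).

Lemma N4_scale c x y : {ae mu, forall p, D p -> rl x p = c * rl y p} ->
  N4 x = c ^+ 4 * N4 y.
Proof.
move=> h; rewrite /N4 -(IntZ mD _ (itg_rl4 _)); apply: Int_ae => //.
- exact: itg_rl4.
- exact/itgZ/itg_rl4.
- by apply: filterS h => p /[apply] ->; rewrite exprMn.
Qed.

Definition N4max v := [/\ eigen v, n2 v = 1 &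
  forall e, eigen e -> n2 e = 1 -> N4 e <= N4 v].

(** Homogeneity of degree four, with the null eigenvectors treated apart. *)
Lemma N4_le v y : N4max v -> eigen y -> N4 y <= N4 v * n2 y ^+ 2.
Proof.
move=> [ev v1 vm] ey; have [y0|y0] := eqVneq (n2 y) 0.
  have := ey; rewrite /eigen y0 mulr0 => /l2_eq0_ae y0'.
  rewrite (@N4_scale 0 y y); last first.
    by apply: filterS y0' => p /[apply] ->; rewrite mul0r.
  by rewrite !expr0n/= mul0r mulr0.
have {}y0 : 0 < n2 y by rewrite lt_neqAle eq_sym y0 n2_ge0.
pose s := Num.sqrt (n2 y); have s0 : 0 < s by rewrite sqrtr_gt0.
have ss : s ^+ 2 = n2 y by rewrite sqr_sqrtr ?n2_ge0.
have := vm _ (eigen_lc s^-1 0 ey ey).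
have -> : n2 (lc s^-1 y 0 y) = 1 by rewrite n2_lc -ss; field; rewrite gt_eqF.
move=> /(_ erefl); rewrite (@N4_scale s^-1 _ y); last first.
  by apply: aeW => p _; rewrite rl_lc mul0r addr0.
have -> : n2 y ^+ 2 = s ^+ 4 by rewrite -ss -exprM.
by rewrite exprVn ler_pdivrMl ?exprn_gt0// mulrC.
Qed.

Lemma N4_gt0 v : N4max v -> 0 < N4 v.
Proof.
move=> [ev v1 _]; rewrite lt_neqAle eq_sym; apply/andP; split; last first.
  by apply: Int_ge0 => p _; rewrite -[4%N]/(2 * 2)%N exprM sqr_ge0.
apply/eqP => v0.
have h : {ae mu, forall p, D p -> rl v p ^+ 4 = 0}.
  apply: (Int_eq0_ae mD (itg_rl4 v)) => // p _.
  by rewrite -[4%N]/(2 * 2)%N exprM sqr_ge0.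
have : l2 v = 0.
  rewrite -[RHS](mul0r (l2 v)) -(IntZ mD _ (itg_rl2 v)); apply: Int_ae => //.
  - exact: itg_rl2.
  - exact/itgZ/itg_rl2.
  - apply: filterS h => p /[apply] /eqP; rewrite expf_eq0/= => /eqP ->.
    by rewrite mul0r expr0n.
by rewrite ev v1 mulr1 => l0; have := lam0; rewrite l0 ltxx.
Qed.

(* Strict convexity of [s^2 + t^2] on [s + t = 1]. *)
Lemma N4max_split v y z : N4max v -> eigen y -> eigen z ->
  {ae mu, forall p, D p -> rl v p = rl y p + rl z p} ->
  {ae mu, forall p, D p -> rl y p * rl z p = 0} ->
  {ae mu, forall p, D p -> rl y p = 0} \/ {ae mu, forall p, D p -> rl z p = 0}.
Proof.
move=> vmax ey ez vyz yz0; have [ev v1 _] := vmax.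
have l2v : l2 v = l2 y + l2 z.
  rewrite -[RHS]mul1r -[l2 y]mul1r -[l2 z]mul1r mul1r.
  rewrite -(Int_lin2 mD _ _ (itg_rl2 y) (itg_rl2 z)); apply: Int_ae => //.
  - exact: itg_rl2.
  - by apply: itgD => //; apply/itgZ/itg_rl2.
  - apply: filterS2 vyz yz0 => p h1 h2 Dp; rewrite h1// !mul1r sqrrD h2//.
    by rewrite mul0rn addr0.
have N4v : N4 v = N4 y + N4 z.
  rewrite -[N4 y]mul1r -[N4 z]mul1r.
  rewrite -(Int_lin2 mD _ _ (itg_rl4 y) (itg_rl4 z)); apply: Int_ae => //.
  - exact: itg_rl4.
  - by apply: itgD => //; apply/itgZ/itg_rl4.
  - apply: filterS2 vyz yz0 => p h1 h2 Dp; rewrite h1// !mul1r.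
    have := h2 Dp; move: (rl y p) (rl z p) => s t st.
    have -> : (s + t) ^+ 4 = s ^+ 4 + t ^+ 4 +
      (s * t) * (4 * s ^+ 2 + 6 * s * t + 4 * t ^+ 2) by ring.
    by rewrite st mul0r addr0.
have st1 : n2 y + n2 z = 1.
  apply: (@mulfI _ lam); first by rewrite gt_eqF.
  by rewrite mulrDr -ey -ez -l2v ev v1.
have [y0|y0] := eqVneq (n2 y) 0.
  by left; apply: l2_eq0_ae; rewrite ey y0 mulr0.
have [z0|z0] := eqVneq (n2 z) 0.
  by right; apply: l2_eq0_ae; rewrite ez z0 mulr0.
have {}y0 : 0 < n2 y by rewrite lt_neqAle eq_sym y0 n2_ge0.
have {}z0 : 0 < n2 z by rewrite lt_neqAle eq_sym z0 n2_ge0.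
have := N4_le vmax ey; have := N4_le vmax ez; have := N4_gt0 vmax.
rewrite N4v => Nv h1 h2; exfalso.
have : n2 y ^+ 2 + n2 z ^+ 2 < 1 by nra.
nra.
Qed.

Lemma N4max_abs v : N4max v ->
  exists p, N4max p /\ {ae mu, forall q, D q -> rl p q = `|rl v q|}.
Proof.
move=> [ev v1 vm]; have [p [ep hp]] := eigen_abs ev.
exists p; split => //; split => //.
  apply: (@mulfI _ lam); first by rewrite gt_eqF.
  rewrite -ep -v1 -ev; apply: Int_ae => //; [exact: itg_rl2..|].
  by apply: filterS hp => q /[apply] ->; rewrite real_normK ?num_real.
suff -> : N4 p = N4 v by [].
apply: Int_ae => //; [exact: itg_rl4..|].
apply: filterS hp => q /[apply] ->.
by rewrite -[4%N]/(2 * 2)%N !exprM real_normK ?num_real.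
Qed.

(** The absolute value of [v] is again a quartic maximizer. Cutting it by the sign of [z] gives two
    eigenvectors with disjoint supports, one of which must vanish. *)
Lemma N4max_sign v z : N4max v -> eigen z ->
  {ae mu, forall p, D p -> rl v p != 0 -> 0 < rl z p} \/
  {ae mu, forall p, D p -> rl v p != 0 -> rl z p <= 0}.
Proof.
move=> vmax ez; have [p [pmax hp]] := N4max_abs vmax.
have [ep _ _] := pmax.
have [y [ey hy]] : exists y, eigen y /\ {ae mu, forall q, D q ->
    rl y q = if rl z q <= 0 then rl p q else 0}.
  apply: eigen_cut => //.
  by apply: filterS hp => q /[apply] ->.
have ew := eigen_lc 1 (-1) ep ey.
have [||h|h] := N4max_split pmax ey ew.
- by apply: aeW => q _; rewrite rl_lc mul1r mulN1r addrC subrK.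
- apply: filterS hy => q /[apply] e; rewrite rl_lc e.
  by case: ifP => _; ring.
- left; near=> q => Dq vq.
  rewrite ltNge; apply/negP => zq; move: vq.
  have hyq : D q -> rl y q = if rl z q <= 0 then rl p q else 0 by near: q.
  have hpq : D q -> rl p q = `|rl v q| by near: q.
  have hq : D q -> rl y q = 0 by near: q.
  by rewrite -normr_eq0 -hpq//; have := hyq Dq; rewrite zq hq// => <-; rewrite eqxx.
- right; near=> q => Dq vq.
  rewrite leNgt; apply/negP => zq; move: vq.
  have hyq : D q -> rl y q = if rl z q <= 0 then rl p q else 0 by near: q.
  have hpq : D q -> rl p q = `|rl v q| by near: q.
  have hq : D q -> rl (lc 1 p (-1) y) q = 0 by near: q.
  have := hq Dq; rewrite rl_lc hyq// leNgt zq/= mulr0 addr0 mul1r hpq//.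
  by move=> /normr0_eq0 ->; rewrite eqxx.
Unshelve. all: by end_near. Qed.

(** [N4max_sign] applies to [h] and to [v] itself, so the product has one sign almost everywhere;
    its integral is [lam * ip v h = 0]. *)
Lemma N4max_orth v h : N4max v -> eigen h -> ip v h = 0 ->
  {ae mu, forall p, D p -> rl v p * rl h p = 0}.
Proof.
move=> vmax eh vh0; have [ev _ _] := vmax.
have li0 : li v h = 0 by rewrite (eigen_form _ ev) vh0 mulr0.
have mv := rl_meas v; have mh := rl_meas h.
have ivh := itg_rlM v h.
have concl (s : R) : s != 0 ->
    {ae mu, forall p, D p -> `|rl v p * rl h p| = s * (rl v p * rl h p)} ->
    {ae mu, forall p, D p -> rl v p * rl h p = 0}.
  move=> s0 hs.
  have I0 : Int (fun p => `|rl v p * rl h p|) = 0.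
    rewrite -(mulr0 s) -li0 -(IntZ mD _ ivh); apply: Int_ae => //.
    - exact: itg_norm.
    - exact: itgZ.
  have := Int_eq0_ae mD (itg_norm ivh) (fun p _ => normr_ge0 _) I0.
  by apply: filterS => p /[apply] /eqP; rewrite normr_eq0 => /eqP.
have [hv|hv] := N4max_sign vmax ev; have [hh|hh] := N4max_sign vmax eh.
- apply: (concl 1); rewrite ?oner_eq0//.
  apply: filterS2 hv hh => p hv hh Dp; rewrite mul1r.
  have [->|v0] := eqVneq (rl v p) 0; first by rewrite mul0r normr0.
  by rewrite ger0_norm//; apply: mulr_ge0; apply: ltW; [exact: hv|exact: hh].
- apply: (concl (-1)); rewrite ?oppr_eq0 ?oner_eq0//.
  apply: filterS2 hv hh => p hv hh Dp; rewrite mulN1r.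
  have [->|v0] := eqVneq (rl v p) 0; first by rewrite mul0r normr0 oppr0.
  by rewrite ler0_norm//; apply: mulr_ge0_le0; [exact/ltW/hv|exact: hh].
- apply: (concl (-1)); rewrite ?oppr_eq0 ?oner_eq0//.
  apply: filterS2 hv hh => p hv hh Dp; rewrite mulN1r.
  have [->|v0] := eqVneq (rl v p) 0; first by rewrite mul0r normr0 oppr0.
  by rewrite ler0_norm//; apply: mulr_le0_ge0; [exact: hv|exact/ltW/hh].
- apply: (concl 1); rewrite ?oner_eq0//.
  apply: filterS2 hv hh => p hv hh Dp; rewrite mul1r.
  have [->|v0] := eqVneq (rl v p) 0; first by rewrite mul0r normr0.
  by rewrite ger0_norm//; apply: mulr_le0; [exact: hv|exact: hh].
Qed.

(** The Lagrange multiplier of the constraint [n2 v <= 1]. *)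
Definition kappa a v := Int (fun p => rl v p ^+ 2 * expR (a * rl v p ^+ 2)).

(** Half the derivative of [J a] at [v] in the direction [h]. *)
Definition Jd a v h := Int (fun p => rl v p * expR (a * rl v p ^+ 2) * rl h p).

Definition Rem a u v h := Int (fun p => (rl u p ^+ 2 + rl v p ^+ 2) *
  (expR (a * rl u p ^+ 2) + expR (a * rl v p ^+ 2)) * rl h p ^+ 2).

Definition Jmax a v := n2 v <= 1 /\ forall w, n2 w <= 1 -> J a w <= J a v.

Lemma N4_ge0 u : 0 <= N4 u.
Proof. by apply: Int_ge0 => p _; rewrite -[4%N]/(2 * 2)%N exprM sqr_ge0. Qed.

Lemma ip_sub_le u v : n2 v = 1 -> n2 u <= 1 ->
  2 * ip v (sub u v) <= - n2 (sub u v).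
Proof.
have -> : n2 (sub u v) = n2 u - 2 * ip u v + n2 v by apply: quad_sub.
have -> : ip v (sub u v) = 1 * ip u v + -1 * n2 v by rewrite ip_sym ip_lc.
by move: (n2 u) (n2 v) (ip u v) => s t r -> s1; lra.
Qed.

(** * Maximizers of [J a] for a fixed parameter *)

Section EulerLagrange.
Variable a : R.
Hypothesis sa : small a.

Let a0 : 0 < a. Proof. by case/andP: sa. Qed.

Lemma Jd_meas v : measurable_fun D (fun p => rl v p * expR (a * rl v p ^+ 2)).
Proof. by have mv := rl_meas v; meas. Qed.

Lemma Jd_itg v h : n2 v <= 1 ->
  itg (fun p => rl v p * expR (a * rl v p ^+ 2) * rl h p).
Proof.
move=> v1; apply: itgM => //; [exact: Jd_meas| |exact: itg_rl2].
apply: (moment_itg2 v1 v1 v1 v1 (N := 1) (Jd_meas v)) => p.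
have [d1 _ _ _] := dom4P v v v v p; have [Z1 Z2 Z3 Z4] := domZ sa d1.
set Z := dom4 _ _ _ _ _ in Z1 Z2 Z3 Z4 *.
apply: le_trans (powZ (k := 2) Z1 ler01 isT); rewrite mul1r expr2.
by rewrite normrM (ger0_norm (expR_ge0 _)) ler_pM ?expR_ge0.
Qed.

Lemma Jd_lc v b x c y : n2 v <= 1 ->
  Jd a v (lc b x c y) = b * Jd a v x + c * Jd a v y.
Proof.
move=> v1; rewrite /Jd -(Int_lin2 mD _ _ (Jd_itg x v1) (Jd_itg y v1)).
by apply: eq_Int => p _; rewrite rl_lc; ring.
Qed.

Lemma Jd_diag v : Jd a v v = kappa a v.
Proof. by apply: eq_Int => p _; ring. Qed.

Lemma kappa_itg v : n2 v <= 1 ->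
  itg (fun p => rl v p ^+ 2 * expR (a * rl v p ^+ 2)).
Proof.
by move=> v1; apply: (eq_itg mD _ (Jd_itg v v1)) => p _; ring.
Qed.

Lemma J_convex v w : n2 v <= 1 -> n2 w <= 1 ->
  J a v + 2 * Jd a v (sub w v) <= J a w.
Proof.
move=> v1 w1; rewrite /Jd -(IntZ mD _ (Jd_itg _ v1)).
rewrite -(IntD mD (J_itg sa v1) (itgZ mD 2 (Jd_itg _ v1))).
apply: Int_le => //; [|exact: J_itg|].
  by apply: itgD => //; [exact: J_itg|exact/itgZ/Jd_itg].
move=> p _; rewrite rl_lc; have := mos_convex a0 (rl w p) (rl v p); lra.
Qed.

(** The Euler-Lagrange equation, obtained without differentiating. By convexity [Jd a v] is at most
    [kappa a v] on the unit ball, with equality at [v]. Hence the form [kappa^2 * ip] minus the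
    square of [Jd a v] is nonnegative and vanishes at [v], and Cauchy-Schwarz puts [v] in its
    kernel. *)
Lemma Jmax_Jd v h : Jmax a v -> Jd a v h = kappa a v * ip v h.
Proof.
move=> [v1 vmax].
have le w : n2 w <= 1 -> Jd a v w <= kappa a v.
  move=> w1; have := J_convex v1 w1; rewrite Jd_lc// Jd_diag.
  move: (vmax w w1); move: (J a w) (J a v) (Jd a v w) (kappa a v) => s t r q; lra.
have k0 : 0 <= kappa a v.
  by apply: Int_ge0 => p _; rewrite mulr_ge0 ?sqr_ge0 ?expR_ge0.
have le2 w : Jd a v w ^+ 2 <= kappa a v ^+ 2 * n2 w.
  apply/ler_addgt0Pr => e e0.
  pose e' := e / (kappa a v ^+ 2 + 1).
  have k1 : 0 < kappa a v ^+ 2 + 1 by rewrite ltr_wpDl// sqr_ge0.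
  have e'0 : 0 < e' by rewrite divr_gt0.
  have s1 := shrink_n2 w e'0.
  have s2 : Jd a v (shrink w e') ^+ 2 <= kappa a v ^+ 2.
    have h1 := le _ s1.
    have s1' : n2 (lc (-1) (shrink w e') 0 w) <= 1.
      by rewrite n2_lc sqrrN expr1n; move: s1; lra.
    have := le _ s1'; rewrite Jd_lc// => h2.
    rewrite -[leLHS](real_normK (num_real _)) ler_sqr ?nnegrE//.
    by rewrite ler_norml; apply/andP; split; lra.
  have we0 : 0 < n2 w + e' by rewrite ltr_wpDl// n2_ge0.
  have -> : Jd a v w = Num.sqrt (n2 w + e') * Jd a v (shrink w e').
    rewrite /shrink Jd_lc// mul0r addr0 mulrA divff ?mul1r//.
    by rewrite gt_eqF// sqrtr_gt0.
  rewrite exprMn sqr_sqrtr ?(ltW we0)//.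
  apply: (@le_trans _ _ ((n2 w + e') * kappa a v ^+ 2)).
    by rewrite ler_wpM2l// ltW.
  rewrite mulrDl [n2 w * _]mulrC lerD2l /e' -mulrA ler_piMr ?(ltW e0)//.
  by rewrite mulrC ler_pdivrMr// mul1r lerDl.
have [k00|k00] := eqVneq (kappa a v) 0.
  have := le2 h; rewrite k00 expr0n/= !mul0r => h0.
  by apply/eqP; rewrite -sqrf_eq0 eq_le h0 sqr_ge0.
pose B x y := kappa a v ^+ 2 * ip x y - Jd a v x * Jd a v y.
have Bs x y : B x y = B y x by rewrite /B ip_sym mulrC [_ * Jd a v x]mulrC mulrC.
have Bl b x c y z : B (lc b x c y) z = b * B x z + c * B y z.
  by rewrite /B ip_lc Jd_lc//; ring.
have B0 x : 0 <= B x x by rewrite subr_ge0 -expr2; exact: le2.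
have := form_CS Bs Bl B0 v h.
have Bvv : B v v <= 0.
  by rewrite /B Jd_diag subr_le0 expr2 ler_piMr// mulr_ge0.
have {}Bvv : B v v = 0 by apply/le_anti; rewrite Bvv B0.
rewrite Bvv mul0r => h0.
have : B v h = 0 by apply/eqP; rewrite -sqrf_eq0 eq_le h0 sqr_ge0.
rewrite /B Jd_diag expr2 -mulrA => /eqP; rewrite -mulrBr mulf_eq0 (negPf k00)/=.
by rewrite subr_eq0 => /eqP.
Qed.

Lemma Rem_bound u v h p :
  `|(rl u p ^+ 2 + rl v p ^+ 2) *
  (expR (a * rl u p ^+ 2) + expR (a * rl v p ^+ 2)) * rl h p| <= 4 * dom4 u v h h p ^+ 4.
Proof.
set Z := dom4 _ _ _ _ _; have [d1 d2 d3 _] := dom4P u v h h p.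
have [Z1 Z2 Z3 Z4] := domZ sa d1; have [_ Y2 Y3 Y4] := domZ sa d2.
have [_ X2 _ _] := domZ sa d3.
rewrite -/Z in Z1 Z2 Z3 Z4 Y2 Y3 Y4 X2.
apply: le_trans (powZ (k := 3) Z1 _ isT); last by [].
rewrite normrM ger0_norm; last first.
  by rewrite mulr_ge0// addr_ge0// ?sqr_ge0// expR_ge0.
have -> : 4 * Z ^+ 3 = (Z + Z) * (Z + Z) * Z by ring.
have E0 : 0 <= expR (a * rl u p ^+ 2) + expR (a * rl v p ^+ 2).
  by rewrite addr_ge0 ?expR_ge0.
have S0 : 0 <= rl u p ^+ 2 + rl v p ^+ 2 by rewrite addr_ge0 ?sqr_ge0.
apply: ler_pM => //; first exact: mulr_ge0.
by apply: ler_pM => //; rewrite lerD.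
Qed.

Lemma Rem_meas u v h : measurable_fun D (fun p => (rl u p ^+ 2 + rl v p ^+ 2) *
  (expR (a * rl u p ^+ 2) + expR (a * rl v p ^+ 2)) * rl h p).
Proof.
by have h1 := rl_meas u; have h2 := rl_meas v; have h3 := rl_meas h; meas.
Qed.

Lemma Rem_le u v h : n2 u <= 1 -> n2 v <= 1 -> n2 h <= 1 ->
  Rem a u v h <= 4 * Num.sqrt Kp * Num.sqrt lam /\
  itg (fun p => (rl u p ^+ 2 + rl v p ^+ 2) *
  (expR (a * rl u p ^+ 2) + expR (a * rl v p ^+ 2)) * rl h p ^+ 2).
Proof.
move=> u1 v1 h1; have mh := rl_meas h; have mR := Rem_meas u v h.
(* The combination with coefficients 0 realises the zero function, so that one factor [h] can be
   read as a difference. *)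
have [] := @Int_diff_le u v h h 4 h (lc 0 h 0 h)
  (fun p => (rl u p ^+ 2 + rl v p ^+ 2) *
    (expR (a * rl u p ^+ 2) + expR (a * rl v p ^+ 2)) * rl h p ^+ 2)
  _ u1 v1 h1 h1 _ mR (Rem_bound u v h).
- rewrite (_ : (fun p => _) = fun p => (rl u p ^+ 2 + rl v p ^+ 2) *
    (expR (a * rl u p ^+ 2) + expR (a * rl v p ^+ 2)) * rl h p * rl h p).
    by meas.
  by apply/funext => p; ring.
- move=> p; rewrite rl_lc !mul0r addr0 subr0 -normrM.
  by rewrite le_eqVlt; apply/orP; left; apply/eqP; congr `|_|; ring.
move=> hR iR; split => //; apply: le_trans (ler_norm _) _; apply: le_trans hR _.
rewrite ler_wpM2l ?mulr_ge0 ?sqrtr_ge0// /dst ler_wsqrtr//.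
rewrite (@l2_scale 1 _ h); last by move=> p; rewrite !rl_lc; ring.
by rewrite expr1n mul1r; apply: l2_le_lam1.
Qed.

Lemma J_second_order u v (h := sub u v) : n2 u <= 1 -> n2 v <= 1 ->
  J a u <= J a v + 2 * Jd a v h + l2 h + 3 * a * Rem a u v h.
Proof.
move=> u1 v1.
(* The difference [h] may lie outside the unit ball, where [Rem_le] does not apply; integrability is
   taken over from its shrunk version. *)
pose e := (n2 h + 1); have s1 := shrink_n2 h ltr01.
have [_ iR] := Rem_le u1 v1 s1.
have {}iR : itg (fun p => (rl u p ^+ 2 + rl v p ^+ 2) *
  (expR (a * rl u p ^+ 2) + expR (a * rl v p ^+ 2)) * rl h p ^+ 2).
  apply: (eq_itg mD _ (itgZ mD e iR)) => p _.
  by rewrite (shrink_rl h p ltr01) -/e; ring.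
have iJ := J_itg sa v1; have id := itgZ mD 2 (Jd_itg h v1).
have il := itg_rl2 h; have iR3 := itgZ mD (3 * a) iR.
rewrite /Jd /Rem -(IntZ mD _ (Jd_itg h v1)) -(IntZ mD _ iR).
rewrite -(IntD mD iJ id) -(IntD mD (itgD mD iJ id) il).
rewrite -(IntD mD (itgD mD (itgD mD iJ id) il) iR3).
apply: Int_le => //; [exact: J_itg|by do 3?apply: itgD|].
move=> p _; have := mos_second_order a0 (rl u p) (rl v p).
rewrite /h rl_lc mul1r mulN1r; lra.
Qed.

Lemma J_ge_l2 u : n2 u <= 1 -> l2 u + a / 2 * N4 u <= J a u.
Proof.
move=> u1; rewrite -[l2 u]mul1r -(Int_lin2 mD _ _ (itg_rl2 u) (itg_rl4 u)).
apply: Int_le => //; [|exact: J_itg|].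
  by apply: itgD => //; apply: itgZ => //; [exact: itg_rl2|exact: itg_rl4].
move=> p _; rewrite mul1r -[4%N]/(2 * 2)%N exprM.
exact: mos_lower (sqr_ge0 _).
Qed.

Lemma J_le_kappa u : n2 u <= 1 -> J a u <= kappa a u.
Proof.
move=> u1; apply: Int_le => //; [exact: J_itg|exact: kappa_itg|] => p _.
apply: le_trans (mos_gap a0 (sqr_ge0 _)).
by rewrite lerDl mulr_ge0 ?sqr_ge0// divr_ge0// ltW.
Qed.

Lemma Jmax_ge_lam v : Jmax a v -> lam <= J a v.
Proof.
move=> [v1 vmax]; apply: ge_sup => [|_ [x x1 <-]].
  by exists (l2 v); exists v.
apply: le_trans (vmax x x1); apply: le_trans (J_ge_l2 x1).
by rewrite lerDl mulr_ge0 ?N4_ge0// divr_ge0// ltW.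
Qed.

Lemma Jsup_gt0 (x : V) : 0 < Jsup a.
Proof.
apply: lt_le_trans lam0 _; apply: ge_sup => [|_ [y y1 <-]].
  by exists (l2 (shrink x 1)); exists (shrink x 1) => //; exact: shrink_n2.
apply: le_trans (J_le_sup sa y1); apply: le_trans (J_ge_l2 y1).
by rewrite lerDl mulr_ge0 ?N4_ge0// divr_ge0// ltW.
Qed.

Lemma Jmax_exists (x : V) : exists v, J a v = Jsup a /\ n2 v = 1.
Proof.
pose A := [set J a x | x in [set x | n2 x <= 1]].
have hA : has_sup A.
  split; last exact: J_has_ub.
  by exists (J a (shrink x 1)); exists (shrink x 1) => //; exact: shrink_n2.
have /choice[X HX] (n : nat) : exists u, n2 u <= 1 /\ Jsup a - n.+1%:R^-1 < J a u.
  have e0 : 0 < (n.+1%:R^-1 : R) by rewrite invr_gt0.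
  by have [_ [u u1 <-] hu] := sup_adherent e0 hA; exists u.
have [v [_ v1 vS]] : exists v, [/\ scv X v, n2 v = 1 & J a v = Jsup a].
  apply: J_cvg => //; [exact: Jsup_gt0|by move=> n; exact: (HX n).1|].
  apply/cvgrPdist_lt => e e0; have := near_lt inv_cvg0 e0.
  apply: filterS => n ne; have [X1 X2] := HX n.
  have := J_le_sup sa X1 => X3.
  by rewrite ger0_norm ?subr_ge0//; move: X2 ne; set r := _^-1; lra.
by exists v.
Qed.

Lemma Jsup_max v : n2 v = 1 -> J a v = Jsup a -> Jmax a v.
Proof.
by move=> v1 vS; split => [|w w1]; [rewrite v1|rewrite vS; exact: J_le_sup].
Qed.

(** Violation against one fixed maximizer [v0] already makes [X] a maximizing sequence, because
    squared distances in the ball are at most 4. Its strong limit [v] is a maximizer to which the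
    hypothesis applies as well, and [X n] is as close to [v] as desired. The vector [x] only
    witnesses that [V] is inhabited. *)
Lemma unstable_direction (x : V) (e : R) : 0 < e ->
  (forall C : R, 0 < C -> exists u, n2 u <= 1 /\
    forall v, Jmax a v -> J a v - J a u < C * n2 (sub u v)) ->
  exists v u h, [/\ Jmax a v, n2 u <= 1, n2 h = 1, n2 (sub u v) <= e &
    `|ip v h| <= e] /\ kappa a v <= e + l2 h + 3 * a * Rem a u v h.
Proof.
move=> e0 hneg.
have [v0 [v0S v01]] := Jmax_exists x.
have v0max := Jsup_max v01 v0S.
have inv0 (n : nat) : 0 < (n.+1%:R^-1 : R) by rewrite invr_gt0.
have /choice[X HX] (n : nat) := hneg _ (inv0 n).
have X1 n := (HX n).1.
have [v [Xv v1 vS]] : exists v, [/\ scv X v, n2 v = 1 & J a v = Jsup a].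
  apply: J_cvg => //; first exact: Jsup_gt0.
  apply/cvgrPdist_lt => r r0.
  have d4 : 0 < r / 4 by rewrite divr_gt0.
  have := near_lt inv_cvg0 d4.
  apply: filterS => n ne; have X3 := J_le_sup sa (X1 n).
  rewrite ger0_norm ?subr_ge0// -v0S.
  apply: lt_le_trans ((HX n).2 v0 v0max) _.
  have h4 : n2 (sub (X n) v0) <= 4 by rewrite n2_sub_le4 ?v01.
  apply: (@le_trans _ _ (r / 4 * 4)); last by rewrite divfK.
  by rewrite ler_pM ?n2_ge0// ltW.
have vmax := Jsup_max v1 vS.
have klam : lam <= kappa a v := le_trans (Jmax_ge_lam vmax) (J_le_kappa vmax.1).
have k0 : 0 < kappa a v := lt_le_trans lam0 klam.
(* [c] bounds the whole second-order coefficient, and [f] is the squared distance below which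
   [direction_estimate] makes [ip v h] at most [e]. *)
pose c := 1 + lam + 3 * a * (4 * Num.sqrt Kp * Num.sqrt lam).
have c0 : 0 < c.
  by rewrite /c -addrA ltr_pwDl// addr_ge0 ?mulr_ge0 ?sqrtr_ge0 ?(ltW lam0) ?(ltW a0).
pose f := (2 * kappa a v * e / c) ^+ 2.
have f0 : 0 < f by rewrite exprn_gt0// divr_gt0// !mulr_gt0.
have m0 : 0 < Num.min e 1 by rewrite lt_min e0 ltr01.
have [n [[ne nh] nf]] := filter_ex (filterI (filterI
  (near_lt inv_cvg0 m0) (near_lt Xv e0)) (near_lt Xv f0)).
move: ne; rewrite lt_min => /andP[ne n1].
pose g := sub (X n) v; rewrite -/g in nh nf.
have hX := (HX n).2 v vmax; rewrite -/g in hX.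
(* At zero distance the violated inequality would read [J a v < J a (X n)], against maximality. *)
have g0 : 0 < n2 g.
  rewrite lt_neqAle n2_ge0 andbT eq_sym; apply/eqP => g0.
  by move: hX; rewrite g0 mulr0 subr_lt0 ltNge (vmax.2 _ (X1 n)).
pose t := Num.sqrt (n2 g); have t0 : 0 < t by rewrite sqrtr_gt0.
have tt : t ^+ 2 = n2 g by rewrite sqr_sqrtr ?n2_ge0.
pose h := lc t^-1 g 0 g.
have tn0 : t != 0 by rewrite gt_eqF.
have h1 : n2 h = 1 by rewrite n2_lc -tt; field.
have gh p : rl g p = t * rl h p by rewrite (rl_lc (t^-1) g 0 g); field.
have lg : l2 g = t ^+ 2 * l2 h by apply: l2_scale.
have h1' : n2 h <= 1 by rewrite h1.
have [Rb iR] := Rem_le (X1 n) vmax.1 h1'.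
have Rg : Rem a (X n) v g = t ^+ 2 * Rem a (X n) v h.
  rewrite /Rem -(IntZ mD _ iR); apply: eq_Int => p _; rewrite gh; ring.
have ipg : ip v g = t * ip v h.
  by rewrite (ip_sym v h) (ip_lc (t^-1) g 0 g v) (ip_sym g v); field.
have so := J_second_order (X1 n) vmax.1; rewrite -/g in so.
rewrite (Jmax_Jd _ vmax) lg Rg in so.
have nX := ip_sub_le v1 (X1 n); rewrite -/g ipg -tt in nX.
rewrite ipg in so; rewrite -tt in hX nf.
have cb : n.+1%:R^-1 + l2 h + 3 * a * Rem a (X n) v h <= c.
  rewrite /c lerD ?lerD ?(ltW n1) ?l2_le_lam1//.
  by rewrite ler_wpM2l// mulr_ge0// ltW.
have [q1 q2] := direction_estimate t0 k0 c0 e0 hX so nX cb (ltW nf) (ltW ne).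
by exists v, (X n), h; split => //; split => //; exact: ltW.
Qed.

End EulerLagrange.

(* [x h = (x - v) h + v (h - k)] almost everywhere when [v k = 0]. *)
Lemma Rem_half_le a u w x h v k : small a ->
  n2 u <= 1 -> n2 w <= 1 -> n2 h <= 1 -> n2 v <= 1 -> x = u \/ x = w ->
  {ae mu, forall p, D p -> rl v p * rl k p = 0} ->
  let E := fun p => expR (a * rl u p ^+ 2) + expR (a * rl w p ^+ 2) in
  itg (fun p => rl x p ^+ 2 * E p * rl h p ^+ 2) /\
  Int (fun p => rl x p ^+ 2 * E p * rl h p ^+ 2) <=
    2 * Num.sqrt Kp * (dst x v + dst h k).
Proof.
move=> sa u1 w1 h1 v1 xuw vk E.
have mu' := rl_meas u; have mw := rl_meas w; have mx := rl_meas x.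
have mh := rl_meas h; have mv := rl_meas v; have mk := rl_meas k.
have mE : measurable_fun D E by rewrite /E; meas.
have E0 p : 0 <= E p by rewrite addr_ge0 ?expR_ge0.
have bnd p : [/\ 1 <= dom4 u w h v p, `|rl x p| <= dom4 u w h v p,
    `|rl h p| <= dom4 u w h v p, `|rl v p| <= dom4 u w h v p &
    E p <= 2 * dom4 u w h v p].
  have [d1 d2 d3 d4] := dom4P u w h v p.
  have [Z1 Z2 _ Z4] := domZ sa d1; have [_ Y2 _ Y4] := domZ sa d2.
  have [_ X2 _ _] := domZ sa d3; have [_ W2 _ _] := domZ sa d4.
  split=> //; first by case: xuw => ->.
  by rewrite /E mulrDl mul1r lerD.
have prod4 p s t r : `|s| <= dom4 u w h v p -> `|t| <= dom4 u w h v p ->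
    `|r| <= dom4 u w h v p -> `|s * t * r * E p| <= 2 * dom4 u w h v p ^+ 4.
  have [Z1 _ _ _ ZE] := bnd p; set Z := dom4 _ _ _ _ _ in Z1 ZE *.
  move=> hs ht hr; rewrite !normrM (ger0_norm (E0 p)).
  have -> : 2 * Z ^+ 4 = Z * Z * Z * (2 * Z) by ring.
  apply: ler_pM => //.
  by apply: ler_pM => //; apply: ler_pM.
pose m1 p := rl h p * rl x p * rl h p * E p.
pose m2 p := rl v p * rl x p * rl h p * E p.
have mm1 : measurable_fun D m1 by rewrite /m1; meas.
have mm2 : measurable_fun D m2 by rewrite /m2; meas.
have bm1 p : `|m1 p| <= 2 * dom4 u w h v p ^+ 4.
  by have [_ ? ? _ _] := bnd p; exact: prod4.
have bm2 p : `|m2 p| <= 2 * dom4 u w h v p ^+ 4.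
  by have [_ ? ? ? _] := bnd p; exact: prod4.
have mdx : measurable_fun D (fun p => (rl x p - rl v p) * m1 p) by meas.
have mdh : measurable_fun D (fun p => (rl h p - rl k p) * m2 p) by meas.
have [b1 i1] := Int_diff_le (u := x) (v := v) u1 w1 h1 v1 mdx mm1 bm1
  (fun p => eq_ind_r (fun z => z <= _) (lexx _) (normrM _ _)).
have [b2 i2] := Int_diff_le (u := h) (v := k) u1 w1 h1 v1 mdh mm2 bm2
  (fun p => eq_ind_r (fun z => z <= _) (lexx _) (normrM _ _)).
have itgx : itg (fun p => rl x p ^+ 2 * E p * rl h p ^+ 2).
  apply: (moment_itg u1 w1 h1 v1 (N := 2)); first by meas.
  move=> p; have -> : rl x p ^+ 2 * E p * rl h p ^+ 2 =
    rl x p ^+ 2 * rl h p * rl h p * E p by ring.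
  have [_ _ hb _ _] := bnd p; apply: prod4 => //.
  rewrite ger0_norm ?sqr_ge0//; have [d1 d2 _ _] := dom4P u w h v p.
  by case: xuw => ->; [have [_ _ ? _] := domZ sa d1|have [_ _ ? _] := domZ sa d2].
split=> //.
have -> : Int (fun p => rl x p ^+ 2 * E p * rl h p ^+ 2) =
  Int (fun p => (rl x p - rl v p) * m1 p) + Int (fun p => (rl h p - rl k p) * m2 p).
  rewrite -(IntD mD i1 i2); apply: Int_ae => //; first exact: itgD.
  apply: filterS vk => p /[apply] vk0; rewrite /m1 /m2.
  have -> : (rl x p - rl v p) * (rl h p * rl x p * rl h p * E p) +
     (rl h p - rl k p) * (rl v p * rl x p * rl h p * E p) =
     rl x p ^+ 2 * E p * rl h p ^+ 2 - (rl v p * rl k p) * (rl x p * rl h p * E p).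
    by ring.
  by rewrite vk0 mul0r subr0.
by rewrite mulrDr lerD// (le_trans (ler_norm _)).
Qed.

Lemma Rem_le_ae a u w h v k : small a ->
  n2 u <= 1 -> n2 w <= 1 -> n2 h <= 1 -> n2 v <= 1 ->
  {ae mu, forall p, D p -> rl v p * rl k p = 0} ->
  Rem a u w h <= 2 * Num.sqrt Kp * (dst u v + dst h k + (dst w v + dst h k)).
Proof.
move=> sa u1 w1 h1 v1 vk.
have [i1 b1] := Rem_half_le sa u1 w1 h1 v1 (or_introl erefl) vk.
have [i2 b2] := Rem_half_le sa u1 w1 h1 v1 (or_intror erefl) vk.
rewrite mulrDr; apply: le_trans (lerD b1 b2).
by rewrite -(IntD mD i1 i2) le_eqVlt; apply/orP; left; apply/eqP;
  apply: eq_Int => p _; ring.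
Qed.

Definition Q4 a v := Int (fun p => rl v p ^+ 4 * expR (a * rl v p ^+ 2)).

Lemma pow4_bound (Z s t : R) : `|s| <= Z -> `|t| <= Z ->
  `|(s + t) * (s ^+ 2 + t ^+ 2)| <= 4 * Z ^+ 3.
Proof.
move=> sZ tZ; have Z0 : 0 <= Z := le_trans (normr_ge0 _) sZ.
have -> : 4 * Z ^+ 3 = (Z + Z) * (Z ^+ 2 + Z ^+ 2) by ring.
rewrite normrM ler_pM//; first by rewrite (le_trans (ler_normD _ _))// lerD.
rewrite (le_trans (ler_normD _ _))// lerD// normrX ler_sqr ?nnegrE//.
Qed.

(** The exponential weight costs [a * Kp] because [expR x - 1 <= x * expR x], and [v^4 - w^4]
    contains the factor [v - w], so that [Int_diff_le] applies. *)
Lemma Q4_le a v w : small a -> n2 v <= 1 -> n2 w <= 1 ->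
  itg (fun p => rl v p ^+ 4 * expR (a * rl v p ^+ 2)) /\ Q4 a v <= N4 w + 4 * Num.sqrt Kp * dst v w + a * Kp.
Proof.
move=> sa v1 w1; have a0 : 0 < a by case/andP: sa.
have mv := rl_meas v; have mw := rl_meas w.
have bnd p : [/\ 1 <= dom4 v w v w p, `|rl v p| <= dom4 v w v w p,
    `|rl w p| <= dom4 v w v w p, rl v p ^+ 2 <= dom4 v w v w p &
    expR (a * rl v p ^+ 2) <= dom4 v w v w p].
  have [d1 d2 _ _] := dom4P v w v w p.
  by have [Z1 Z2 Z3 Z4] := domZ sa d1; have [_ Y2 _ _] := domZ sa d2.
pose f p := rl v p ^+ 4 * expR (a * rl v p ^+ 2).
pose f1 p := rl v p ^+ 4 - rl w p ^+ 4.
pose m1 p := (rl v p + rl w p) * (rl v p ^+ 2 + rl w p ^+ 2).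
pose g p := rl v p ^+ 3 * expR (a / 2 * rl v p ^+ 2).
have eg p : g p ^+ 2 = rl v p ^+ 6 * expR (a * rl v p ^+ 2).
  by rewrite /g exprMn -expRM_natl -exprM; congr (_ * expR _); field.
have mf : measurable_fun D f by rewrite /f; meas.
have mf1 : measurable_fun D f1 by rewrite /f1; meas.
have mm1 : measurable_fun D m1 by rewrite /m1; meas.
have mg : measurable_fun D g by rewrite /g; meas.
have bm1 p : `|m1 p| <= 4 * dom4 v w v w p ^+ 4.
  have [Z1 Z2 Z3 _ _] := bnd p.
  apply: le_trans (powZ (k := 3) Z1 _ isT); last by [].
  exact: pow4_bound.
have bg p : `|g p| <= 1 * dom4 v w v w p ^+ 4.
  have [Z1 Z2 _ Z4 Z5] := bnd p; set Z := dom4 _ _ _ _ _ in Z1 Z2 Z4 Z5 *.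
  apply: le_trans (powZ (k := 3) Z1 ler01 isT); rewrite mul1r.
  rewrite /g normrM (ger0_norm (expR_ge0 _)).
  have -> : `|rl v p ^+ 3| = `|rl v p| * rl v p ^+ 2.
    by rewrite exprS normrM [X in _ * X]ger0_norm ?sqr_ge0.
  have -> : Z ^+ 3 = Z * Z * Z by ring.
  apply: ler_pM; [by rewrite mulr_ge0 ?sqr_ge0|exact: expR_ge0| |].
    by apply: ler_pM => //; exact: sqr_ge0.
  apply: le_trans Z5; rewrite ler_expR ler_wpM2r ?sqr_ge0//; lra.
have [b1 i1] := Int_diff_le (u := v) (v := w) (f := f1) v1 w1 v1 w1 mf1 mm1 bm1
  (fun p => (fun e => eq_ind_r (fun z => `|z| <= _)
     (eq_ind_r (fun z => z <= _) (lexx _) (normrM (rl v p - rl w p) (m1 p))) e)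
    (ltac:(rewrite /f1 /m1; ring) : f1 p = (rl v p - rl w p) * m1 p)).
have ig := moment_itg2 v1 w1 v1 w1 mg bg.
have bg2 := moment_le2 v1 w1 v1 w1 mg bg.
rewrite expr1n mul1r in bg2.
have fle p : f p <= rl w p ^+ 4 + f1 p + a * g p ^+ 2.
  rewrite eg /f /f1 [_ + (_ - _)]addrC subrK -[rl v p ^+ 6]/(rl v p ^+ (4 + 2)) exprD.
  have h := expR_sub1_le (a * rl v p ^+ 2).
  have h4 : 0 <= rl v p ^+ 4 by rewrite -[4%N]/(2 * 2)%N exprM sqr_ge0.
  have := ler_wpM2l h4 h; set e := expR _; set s := rl v p ^+ 4; lra.
have iw := itg_rl4 w.
have iall : itg (fun p => rl w p ^+ 4 + f1 p + a * g p ^+ 2).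
  by apply: itgD => //; [exact: itgD|exact: itgZ].
have itf : itg f.
  apply: (itg_dom mD mf iall) => p _; rewrite ger0_norm//.
  by rewrite mulr_ge0 ?expR_ge0// -[4%N]/(2 * 2)%N exprM sqr_ge0.
split => //; apply: (@le_trans _ _ (Int (fun p => rl w p ^+ 4 + f1 p + a * g p ^+ 2))).
  exact: (Int_le mD itf iall (fun p _ => fle p)).
rewrite (IntD mD (itgD mD iw i1) (itgZ mD a ig)) (IntD mD iw i1) (IntZ mD a ig).
rewrite lerD//; first by rewrite lerD2l (le_trans (ler_norm _)).
by rewrite ler_wpM2l// ltW.
Qed.

Lemma J_le_Q4 a v : small a -> n2 v <= 1 -> J a v <= l2 v + a / 2 * Q4 a v.
Proof.
move=> sa v1; have a0 : 0 < a by case/andP: sa.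
have [iQ _] := Q4_le sa v1 v1.
rewrite -[l2 v]mul1r -(Int_lin2 mD _ _ (itg_rl2 v) iQ).
apply: Int_le => //; [exact: J_itg| |].
  by apply: itgD => //; apply: itgZ => //; exact: itg_rl2.
move=> p _; rewrite mul1r; apply: le_trans (mos_upper a0 (sqr_ge0 _)) _.
by rewrite -exprM.
Qed.

Lemma N4_le_Kp v : n2 v <= 1 -> N4 v <= Kp.
Proof.
move=> v1; have mv := rl_meas v.
have := moment_le2 v1 v1 v1 v1 (N := 1) (m := fun p => rl v p ^+ 2).
rewrite expr1n mul1r => h.
rewrite [leLHS](_ : _ = Int (fun p => (rl v p ^+ 2) ^+ 2)); last first.
  by apply: eq_Int => p _; rewrite -exprM.
apply: h => [|p]; first by meas.
have [d1 _ _ _] := dom4P v v v v p; have [Z1 _ Z3 _] := domZ small_beta d1.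
rewrite ger0_norm ?sqr_ge0//.
by apply: le_trans (powZ (k := 1) Z1 ler01 isT); rewrite mul1r expr1.
Qed.

Lemma dst_le2 v w : n2 v <= 1 -> n2 w <= 1 -> dst v w <= Num.sqrt (4 * lam).
Proof.
move=> v1 w1; rewrite /dst ler_wsqrtr// mulrC.
apply: le_trans (l2_le_lam _) _; rewrite ler_wpM2l ?(ltW lam0)//.
exact: n2_sub_le4.
Qed.

(* Along [a -> 0] maximizers converge to a maximizer [v] of [N4] on the first
   eigenspace, and unstable directions to an eigenvector [k] orthogonal to
   [v], for which the quartic term [v^2 k^2] vanishes. *)
Lemma stability_pos (x0 : V) : exists a0, 0 < a0 /\ forall a, 0 < a < a0 ->
  exists C, 0 < C /\ forall u, n2 u <= 1 ->
    exists v, Jmax a v /\ C * n2 (sub u v) <= J a v - J a u.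
Proof.
apply: contrapT => hno.
have b0 := b320.
have hneg (b : R) : 0 < b -> exists a, 0 < a < b /\ forall C : R, 0 < C -> exists u, n2 u <= 1 /\ forall v, Jmax a v -> J a v - J a u < C * n2 (sub u v).
  move=> bpos; apply: contrapT => nh; apply: hno; exists b; split => // a ab.
  apply: contrapT => nC; apply: nh; exists a; split => // C C0'.
  apply: contrapT => nu; apply: nC; exists C; split => // u u1.
  apply: contrapT => nv; apply: nu; exists u; split => // v vm.
  rewrite ltNge; apply/negP => le; apply: nv; exists v; split => //.
have inv0 (n : nat) : 0 < (n.+1%:R^-1 : R) by rewrite invr_gt0.
have /choice[a Ha] (n : nat) := hneg (beta / 32 * n.+1%:R^-1) (mulr_gt0 b0 (inv0 n)).
have a0 n : 0 < a n by have /andP[] := (Ha n).1.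
have a_lt n : a n < beta / 32 * n.+1%:R^-1 by have /andP[] := (Ha n).1.
have inv1 (n : nat) : (n.+1%:R^-1 : R) <= 1 by rewrite invf_le1// ler1n.
have sa n : small (a n).
  rewrite /small a0/= (le_trans (ltW (a_lt n)))// ler_piMr// ltW//.
have a_cvg : a n @[n --> U] --> (0 : R).
  have h0 : beta / 32 * n.+1%:R^-1 @[n --> U] --> (0 : R).
    by rewrite -(mulr0 (beta / 32)); apply: cvgMl_tmp; exact: inv_cvg0.
  apply: squeeze_cvgr (cvg_cst 0) h0; apply: nearW => n.
  by rewrite !ltW.
(* The error must be o(a), as the final estimate is divided by [a n]; the minimum with 1 gives the
   bound by 1/(n+1) as well. *)
pose e n := Num.min (a n) 1 * n.+1%:R^-1.
have m0 n : 0 < Num.min (a n) 1 by rewrite lt_min a0 ltr01.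
have e0 n : 0 < e n by rewrite mulr_gt0.
have e_le n : e n <= n.+1%:R^-1.
  by rewrite /e ler_piMl ?(ltW (inv0 n))// ge_min lexx orbT.
have ea_le n : e n <= a n * n.+1%:R^-1.
  by rewrite /e ler_wpM2r ?(ltW (inv0 n))// ge_min lexx.
have e_cvg : e n @[n --> U] --> (0 : R).
  apply: squeeze_cvgr (cvg_cst 0) inv_cvg0; apply: nearW => n.
  by rewrite e_le (ltW (e0 n)).
have /choice[v Hv] (n : nat) := unstable_direction (sa n) x0 (e0 n) (Ha n).2.
have /choice[u {}Hv] := Hv.
have /choice[h {}Hv] := Hv.
have vm n : Jmax (a n) (v n) by case: (Hv n) => -[].
have v1 n : n2 (v n) <= 1 := (vm n).1.
have u1 n : n2 (u n) <= 1 by case: (Hv n) => -[].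
have h1 n : n2 (h n) = 1 by case: (Hv n) => -[].
have h1' n : n2 (h n) <= 1 by rewrite h1.
have uv n : n2 (sub (u n) (v n)) <= e n by case: (Hv n) => -[].
have vh n : `|ip (v n) (h n)| <= e n by case: (Hv n) => -[].
have kap n : kappa (a n) (v n) <= e n + l2 (h n) + 3 * a n * Rem (a n) (u n) (v n) (h n).
  by case: (Hv n).
pose C1 := Kp + 4 * Num.sqrt Kp * Num.sqrt (4 * lam) + beta / 32 * Kp.
have Q4C n : Q4 (a n) (v n) <= C1.
  have [_ q] := Q4_le (sa n) (v1 n) (v1 n); apply: le_trans q _.
  rewrite /C1 !lerD ?N4_le_Kp//.
    by rewrite ler_wpM2l ?mulr_ge0 ?sqrtr_ge0// dst_le2.
  by rewrite ler_wpM2r ?(ltW Kp_gt0)//; case/andP: (sa n).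
have vl n : lam <= l2 (v n) + a n / 2 * Q4 (a n) (v n).
  exact: le_trans (Jmax_ge_lam (sa n) (vm n)) (J_le_Q4 (sa n) (v1 n)).
have a2 n : 0 <= a n / 2 by rewrite divr_ge0// ltW.
have lv_cvg : l2 (v n) @[n --> U] --> lam.
  have hl : lam - a n / 2 * C1 @[n --> U] --> lam.
    rewrite -[X in _ --> X]subr0; apply: cvgB; first exact: cvg_cst.
    have -> : 0 = 0 / 2 * C1 :> R by rewrite !mul0r.
    by apply: cvgMr_tmp; exact: cvgMr_tmp.
  apply: squeeze_cvgr hl (cvg_cst lam); apply: nearW => n.
  rewrite (l2_le_lam1 (v1 n)) andbT lerBlDr; apply: le_trans (vl n) _.
  by rewrite lerD2l ler_wpM2l.
have one_near (X : nat -> V) : (forall n, n2 (X n) <= 1) ->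
    forall r : R, 0 < r -> \forall n \near U, n2 (X n) <= 1 + r.
  by move=> X1 r r0; apply: nearW => n; rewrite (le_trans (X1 n))// lerDl ltW.
have [w [vw w1 lw]] := lam_cvg lam0 (one_near v v1) (compact v1) lv_cvg.
have ew : eigen w by rewrite /eigen lw w1 mulr1.
have w1' : n2 w <= 1 by rewrite w1.
pose C2 := 4 * Num.sqrt Kp * Num.sqrt lam.
have RC n : Rem (a n) (u n) (v n) (h n) <= C2.
  by have [] := Rem_le (sa n) (u1 n) (v1 n) (h1' n).
(* As [lam <= kappa], the estimate [kap] squeezes [l2 (h n)] against its maximal value. *)
have lh_cvg : l2 (h n) @[n --> U] --> lam.
  have hl : lam - (e n + 3 * a n * C2) @[n --> U] --> lam.
    rewrite -[X in _ --> X]subr0; apply: cvgB; first exact: cvg_cst.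
    have -> : 0 = 0 + 3 * 0 * C2 :> R by rewrite mulr0 mul0r addr0.
    by apply: cvgD => //; apply: cvgMr_tmp; exact: cvgMl_tmp.
  apply: squeeze_cvgr hl (cvg_cst lam); apply: nearW => n.
  rewrite (l2_le_lam1 (h1' n)) andbT lerBlDr.
  apply: le_trans (Jmax_ge_lam (sa n) (vm n)) _.
  apply: le_trans (J_le_kappa (sa n) (v1 n)) _.
  apply: le_trans (kap n) _; rewrite -addrA addrCA lerD2l lerD2l.
  by rewrite ler_wpM2l// mulr_ge0// ltW.
have [k [hk k1 lk]] := lam_cvg lam0 (one_near h h1') (compact h1') lh_cvg.
have ek : eigen k by rewrite /eigen lk k1 mulr1.
have wk0 : ip w k = 0.
  apply: (cvg_unique _ (scv_ip vw hk)) => //; apply/norm_cvg0P.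
  apply: squeeze_cvgr (cvg_cst 0) e_cvg; apply: nearW => n.
  by rewrite normr_ge0 vh.
have dvw := scv_dst vw; have dhk := scv_dst hk.
(* [v n] does at least as well as any normalised eigenvector [z]. At order zero [z] is optimal,
   since [l2 (v n) <= lam = l2 z]; so the comparison survives in the quartic terms after cancelling
   [lam] and dividing by [a n / 2]. *)
have wmax : N4max w.
  split => // z ez z1; have z1' : n2 z <= 1 by rewrite z1.
  have le n : N4 z <= N4 w + 4 * Num.sqrt Kp * dst (v n) w + a n * Kp.
    have [_ q] := Q4_le (sa n) (v1 n) w1'; apply: le_trans q.
    have an2 : 0 < a n / 2 by rewrite divr_gt0.
    rewrite -(ler_pM2l an2) -(lerD2l lam).
    apply: (@le_trans _ _ (J (a n) z)).
      apply: le_trans (J_ge_l2 (sa n) z1').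
      by rewrite lerD2r ez z1 mulr1.
    apply: le_trans ((vm n).2 z z1') _.
    apply: le_trans (J_le_Q4 (sa n) (v1 n)) _.
    by rewrite lerD2r l2_le_lam1.
  have lim : N4 w + 4 * Num.sqrt Kp * dst (v n) w + a n * Kp @[n --> U] --> N4 w.
    rewrite -[X in _ --> X]addr0; apply: cvgD.
      rewrite -[X in _ --> X]addr0; apply: cvgD; first exact: cvg_cst.
      by rewrite -(mulr0 (4 * Num.sqrt Kp)); exact: cvgMl_tmp.
    by rewrite -(mul0r Kp); exact: cvgMr_tmp.
  rewrite -(cvg_lim (@Rhausdorff R) lim); apply: limr_ge => //.
    by apply/cvg_ex; exists (N4 w).
  exact: nearW.
have wk := N4max_orth wmax ek wk0.
have Npos := N4_gt0 wmax.
have Rle n := Rem_le_ae (sa n) (u1 n) (v1 n) (h1' n) w1' wk.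
have uw : scv u w.
  have h0 : 2 * e n + 2 * n2 (sub (v n) w) @[n --> U] --> (0 : R).
    have -> : 0 = 2 * 0 + 2 * 0 :> R by rewrite mulr0 addr0.
    by apply: cvgD; [exact: cvgMl_tmp e_cvg|exact: cvgMl_tmp vw].
  apply: squeeze_cvgr (cvg_cst 0) h0; apply: nearW => n.
  rewrite n2_ge0/=; apply: (le_trans (quad_sub_trans ip_sym ip_lc ip_ge0 _ (v n) _)).
  by rewrite lerD2r ler_wpM2l// uv.
have duw := scv_dst uw.
(* The two bounds on [kappa] are combined: [lam] cancels and division by [a n] leaves a positive
   constant below a quantity tending to 0. *)
have fin n : N4 w / 2 <= n.+1%:R^-1 + 3 * (2 * Num.sqrt Kp *
    (dst (u n) w + dst (h n) k + (dst (v n) w + dst (h n) k))).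
  rewrite -(ler_pM2l (a0 n)).
  have j1 : lam + a n / 2 * N4 w <= kappa (a n) (v n).
    apply: le_trans (J_le_kappa (sa n) (v1 n)); apply: le_trans ((vm n).2 w w1').
    by apply: le_trans (J_ge_l2 (sa n) w1'); rewrite lerD2r lw.
  have j2 := kap n; have j3 := l2_le_lam1 (h1' n); have j4 := ea_le n.
  have j5 : 3 * a n * Rem (a n) (u n) (v n) (h n) <= 3 * a n * (2 * Num.sqrt Kp *
    (dst (u n) w + dst (h n) k + (dst (v n) w + dst (h n) k))).
    by rewrite ler_wpM2l// mulr_ge0// ltW.
  have j6 : lam + a n / 2 * N4 w <= a n * n.+1%:R^-1 + lam + 3 * a n *
     (2 * Num.sqrt Kp * (dst (u n) w + dst (h n) k + (dst (v n) w + dst (h n) k))).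
    apply: le_trans j1 _; apply: le_trans j2 _.
    by rewrite !lerD.
  move: j6; set S := dst (u n) w + dst (h n) k + _; set i := n.+1%:R^-1; lra.
have lim : n.+1%:R^-1 + 3 * (2 * Num.sqrt Kp *
    (dst (u n) w + dst (h n) k + (dst (v n) w + dst (h n) k))) @[n --> U] --> (0 : R).
  have -> : 0 = 0 + 3 * (2 * Num.sqrt Kp * (0 + 0 + (0 + 0))) :> R.
    by rewrite !addr0 !mulr0 addr0.
  apply: cvgD; first exact: inv_cvg0.
  by apply: cvgMl_tmp; apply: cvgMl_tmp; apply: cvgD; apply: cvgD.
have N0 : 0 < N4 w / 2 by rewrite divr_gt0.
have [n] := filter_ex (near_lt lim N0).
by rewrite ltNge fin.
Qed.

End PositiveEigenvalue.

(** The case where every realisation vanishes almost everywhere, for instance when [Omega] is empty.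
    Every point of the ball is then a maximizer. *)
Lemma J_degenerate a u : lam = 0 -> n2 u <= 1 -> small a -> J a u = 0.
Proof.
move=> l0 u1 sa; have lu : l2 u = 0.
  by apply/le_anti; rewrite l2_ge0 andbT -l0 l2_le_lam1.
have := Int_eq0_ae mD (itg_rl2 u) (fun p _ => sqr_ge0 _) lu => h.
rewrite -(mul0r (l2 u)) -(IntZ mD 0 (itg_rl2 u)); apply: Int_ae => //.
- exact: J_itg.
- exact/itgZ/itg_rl2.
- by apply: filterS h => p /[apply] ->; rewrite /mos mulr0 expR0 subrr !mul0r.
Qed.

Theorem stability (x0 : V) : exists a0, 0 < a0 /\ forall a, 0 < a < a0 ->
  exists C, 0 < C /\ forall u, n2 u <= 1 ->
    exists v, Jmax a v /\ C * n2 (sub u v) <= J a v - J a u.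
Proof.
have := lam_ge0 x0; rewrite le_eqVlt => /predU1P[l0|l0]; last exact: stability_pos.
exists (beta / 32); split => // a /andP[a0 ab].
have sa : small a by rewrite /small a0 ltW.
exists 1; split => // u u1; exists u; split.
  by split => // w w1; rewrite !J_degenerate.
have -> : n2 (sub u u) = 0 by rewrite /n2 (quad_sub ip_sym ip_lc); ring.
by rewrite subrr mulr0.
Qed.

End Hilbert.

(** * Application to the Dirichlet space *)

Section Instance.
Context {R : realType}.
Notation plane := (measurableTypeR R * measurableTypeR R)%type.
Notation mu2 := (@lebesgue2 R).
Variables (Omega : set (R * R)) (L : R).
Hypotheses (oO : open Omega) (L0 : 0 < L).
Hypothesis OL : forall z i, Omega z -> - L < coord i z < L.

Let mO : measurable (Omega : set plane) := omega_measurable oO.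
Notation Int := (Int mu2 Omega).
Notation itg := (itg mu2 Omega).
Notation L2 := (L2 Omega).
Notation test := (test_function Omega).
Notation closeW := (@closeW R Omega).
Notation W012P := (W012P oO OL).

Definition space := {u : W12 Omega | W012 u}.
Definition lcV (a : R) (x : space) (b : R) (y : space) : space :=
  exist _ (linW oO OL a (sval x) b (sval y)) (linW_W012 oO OL a b (svalP x) (svalP y)).
Definition ipV (x y : space) := ipW (sval x) (sval y).
Definition rlV (x : space) : plane -> R := W12_fun (sval x).

Lemma gr_lcV i a x b y : gr i (sval (lcV a x b y)) =
  (fun z => a * gr i (sval x) z + b * gr i (sval y) z).
Proof. exact: gr_mkW. Qed.

Let gL i (x : space) : L2 (gr i (sval x)) := gr_L2 oO i _.
Let rL (x : space) : L2 (rlV x) := W12_L2 oO _.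

Lemma ipV_sym x y : ipV x y = ipV y x.
Proof. by apply: eq_Int => // z _; ring. Qed.

Lemma ipV_lc a x b y z : ipV (lcV a x b y) z = a * ipV x z + b * ipV y z.
Proof.
have gg i (u v : space) : itg (fun p => gr i (sval u) p * gr i (sval v) p).
  exact: (L2_mul mO (gL i u) (gL i v)).
rewrite /ipV /ipW -(Int_lin2 mO); try by apply: itgD.
by apply: eq_Int => // p _; rewrite !gr_lcV; ring.
Qed.

Lemma ipV_ge0 x : 0 <= ipV x x.
Proof. exact: ipW_ge0. Qed.

Lemma rlV_lc a x b y p : rlV (lcV a x b y) p = a * rlV x p + b * rlV y p.
Proof. by []. Qed.

Lemma rlV_meas x : measurable_fun Omega (rlV x).
Proof. exact: (rL x).1. Qed.

Lemma ipV_sub x y : n2 ipV (sub lcV x y) =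
  Int (fun z => (gr false (sval x) z - gr false (sval y) z) ^+ 2) +
  Int (fun z => (gr true (sval x) z - gr true (sval y) z) ^+ 2).
Proof.
rewrite /n2 /ipV (ipWuE oO); congr (_ + _); apply: eq_Int => // z _;
  by rewrite /sub gr_lcV mul1r mulN1r.
Qed.

Let I0 f : 0 <= Int (fun z => f z ^+ 2).
Proof. by apply: Int_ge0 => z _; exact: sqr_ge0. Qed.

Lemma l2_sub x y : l2 mu2 Omega rlV (sub lcV x y) =
  Int (fun z => (rlV x z - rlV y z) ^+ 2).
Proof. by apply: eq_Int => z _; rewrite rlV_lc mul1r mulN1r. Qed.

Lemma l2_sub_le x y : Int (fun z => (rlV x z - rlV y z) ^+ 2) <=
  Int (fun=> 1) * n2 ipV (sub lcV x y).
Proof. by rewrite -l2_sub; exact: (W012_poincare oO L0 OL (svalP (sub lcV x y))). Qed.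

(** Both sides of the defining identity are L2 pairings with fixed functions, [phi] and its
    derivative, so Cauchy-Schwarz carries the identity to the limit. *)
Lemma weak_limit f g (X : nat -> space) : L2 f -> (forall i, L2 (g i)) ->
  (forall e : R, 0 < e -> exists n, Int (fun z => (rlV (X n) z - f z) ^+ 2) < e /\
     forall i, Int (fun z => (gr i (sval (X n)) z - g i z) ^+ 2) < e) ->
  is_weak Omega f g.
Proof.
move=> hf hg h phi i t.
have tL := test_L2 oO OL t; have dL := test_partial_L2 oO OL i t.
pose S := Int (fun z => phi z ^+ 2) + Int (fun z => partial i phi z ^+ 2).
have S0 : 0 <= S by rewrite addr_ge0.
apply/eqP; rewrite -subr_eq0 opprK; apply/eqP.
set q := _ + _; suff q0 : forall e : R, 0 < e -> q ^+ 2 <= 4 * S * e.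
  apply/eqP; rewrite -sqrf_eq0; apply/eqP; apply/le_anti; rewrite sqr_ge0 andbT.
  apply/ler_addgt0Pr => e e0; rewrite add0r.
  have k0 : 0 < 4 * S + 1 by rewrite ltr_wpDl// mulr_ge0.
  apply: (le_trans (q0 _ (divr_gt0 e0 k0))).
  by rewrite mulrA ler_pdivrMr// mulrC ler_pM2l// lerDl.
move=> e e0; have [n [h1 h2]] := h e e0.
pose q1 := Int (fun z => (f z - rlV (X n) z) * partial i phi z).
pose q2 := Int (fun z => (g i z - gr i (sval (X n)) z) * phi z).
have qE : q = q1 + q2.
  have w := gr_weak oO OL (sval (X n)) i t.
  have i1 := L2_mul mO hf dL; have i2 := L2_mul mO (rL (X n)) dL.
  have i3 := L2_mul mO (hg i) tL; have i4 := L2_mul mO (gL i (X n)) tL.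
  have -> : q1 = Int (fun z => f z * partial i phi z) - Int (fun z => rlV (X n) z * partial i phi z).
    by rewrite -(IntB mO i1 i2); apply: eq_Int => // z _; ring.
  have -> : q2 = Int (fun z => g i z * phi z) - Int (fun z => gr i (sval (X n)) z * phi z).
    by rewrite -(IntB mO i3 i4); apply: eq_Int => // z _; ring.
  by rewrite /q /rlV w; ring.
have b1 : q1 ^+ 2 <= e * S.
  have d1 := L2_sub mO hf (rL (X n)).
  apply: le_trans (Int_CS mO d1.1 dL.1 d1.2 dL.2) _; apply: ler_pM => //.
    apply/ltW; move: h1; congr (_ < _); apply: eq_Int => // z _.
    by rewrite -sqrrN opprB.
  by rewrite /S lerDr.
have b2 : q2 ^+ 2 <= e * S.
  have d1 := L2_sub mO (hg i) (gL i (X n)).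
  apply: le_trans (Int_CS mO d1.1 tL.1 d1.2 tL.2) _; apply: ler_pM => //.
    apply/ltW; move: (h2 i); congr (_ < _); apply: eq_Int => // z _.
    by rewrite -sqrrN opprB.
  by rewrite /S lerDl.
rewrite qE; have h3 : (q1 + q2) ^+ 2 <= 2 * q1 ^+ 2 + 2 * q2 ^+ 2.
  by rewrite -subr_ge0 (_ : _ - _ = (q1 - q2) ^+ 2) ?sqr_ge0//; ring.
apply: le_trans h3 _; have -> : 4 * S * e = 2 * (e * S) + 2 * (e * S) by ring.
by apply: lerD; rewrite ler_pM2l.
Qed.

Lemma space_complete (X : nat -> space) :
  (forall e : R, 0 < e -> exists N, forall n m, (N <= n)%N -> (N <= m)%N ->
    n2 ipV (sub lcV (X n) (X m)) < e) ->
  exists x, forall e : R, 0 < e -> exists N, forall n, (N <= n)%N ->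
    n2 ipV (sub lcV (X n) x) < e.
Proof.
move=> cX.
have grc i : forall e : R, 0 < e -> exists N, forall n m, (N <= n)%N -> (N <= m)%N ->
    Int (fun z => (gr i (sval (X n)) z - gr i (sval (X m)) z) ^+ 2) < e.
  move=> e /cX[N hN]; exists N => n m Nn Nm; have := hN n m Nn Nm; rewrite ipV_sub.
  by apply: le_lt_trans; case: i; rewrite ?lerDl ?lerDr.
have W0 : 0 <= Int (fun=> 1) by apply: Int_ge0.
have rlc : forall e : R, 0 < e -> exists N, forall n m, (N <= n)%N -> (N <= m)%N ->
    Int (fun z => (rlV (X n) z - rlV (X m) z) ^+ 2) < e.
  move=> e e0; have k0 : 0 < Int (fun=> 1) + 1 by rewrite ltr_wpDl.
  have [N hN] := cX _ (divr_gt0 e0 k0); exists N => n m Nn Nm.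
  have := hN n m Nn Nm; rewrite ltr_pdivlMr// => h; apply: le_lt_trans h.
  apply: le_trans (l2_sub_le _ _) _; rewrite mulrC; apply: ler_wpM2l; last by rewrite lerDl.
  exact: ipV_ge0.
have [f [mf f2 cf]] := riesz_fischer mO (fun k => (rL (X k)).1) (fun k => (rL (X k)).2) rlc.
have [g hg] := choice (fun i => riesz_fischer mO (fun k => (gL i (X k)).1) (fun k => (gL i (X k)).2) (grc i)).
have fL : L2 f by split.
have gLL i : L2 (g i) by have [h1 h2 _] := hg i; split.
have lim (e : R) : 0 < e -> exists N, forall n, (N <= n)%N ->
    Int (fun z => (rlV (X n) z - f z) ^+ 2) < e /\
    forall i, Int (fun z => (gr i (sval (X n)) z - g i z) ^+ 2) < e.
  move=> e0; have [N1 h1] := cf e e0.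
  have [_ _ /(_ e e0)[N2 h2]] := hg false; have [_ _ /(_ e e0)[N3 h3]] := hg true.
  exists (N1 + N2 + N3)%N => n Nn; split.
    by apply: (h1 n _).2; apply: leq_trans Nn; rewrite -addnA leq_addr.
  case; [apply: (h3 n _).2|apply: (h2 n _).2]; apply: leq_trans Nn; rewrite ?leq_addl//.
  by rewrite addnAC leq_addl.
have wf : is_weak Omega f g.
  apply: (@weak_limit _ _ X fL gLL) => e e0; have [N hN] := lim e e0.
  by exists N; apply: hN.
pose u := mkW oO OL fL gLL wf.
have Wu : W012 u.
  apply/W012P => e e0; have e4 : 0 < e / 4 by rewrite divr_gt0.
  have [N /(_ N (leqnn _))[h1 h2]] := lim _ e4.
  have [phi [t [p1 p2]]] := (W012P _).1 (svalP (X N)) _ e4.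
  exists phi; split => //; split.
    have := Int_sub_sqr_le oO fL (rL (X N)) (test_L2 oO OL t).
    move=> h; apply: (le_lt_trans h).
    have h1' : Int (fun z => (f z - rlV (X N) z) ^+ 2) < e / 4.
      by move: h1; congr (_ < _); apply: eq_Int => // z _; rewrite -sqrrN opprB.
    have -> : e = 2 * (e / 4) + 2 * (e / 4) by field.
    by apply: ltrD; rewrite ltr_pM2l.
  move=> i; rewrite gr_mkW.
  have := Int_sub_sqr_le oO (gLL i) (gL i (X N)) (test_partial_L2 oO OL i t).
  move=> h; apply: (le_lt_trans h).
  have h1' : Int (fun z => (g i z - gr i (sval (X N)) z) ^+ 2) < e / 4.
    by move: (h2 i); congr (_ < _); apply: eq_Int => // z _; rewrite -sqrrN opprB.
  have -> : e = 2 * (e / 4) + 2 * (e / 4) by field.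
  by apply: ltrD; rewrite ltr_pM2l// p2.
exists (exist _ u Wu) => e e0.
have [N hN] := lim _ (divr_gt0 e0 (ltr0n _ 2)); exists N => n Nn.
have gu i : gr i (sval (exist _ u Wu : space)) = g i by exact: gr_mkW.
have [_ h] := hN n Nn; rewrite ipV_sub !gu [e]splitr.
by apply: ltrD; exact: h.
Qed.

Lemma space_compact (U : set_system nat) (UU : UltraFilter U) (X : nat -> space) :
  \oo `<=` U -> (forall n, n2 ipV (X n) <= 1) -> l2cauchy mu2 Omega lcV rlV U X.
Proof.
move=> Uoo X1.
have PU : ProperFilter U := ultra_proper.
have n0 n : 0 < n.+1%:R^-1 :> R by rewrite invr_gt0.
have [phi hphi] := choice (fun n => (W012P _).1 (svalP (X n)) _ (n0 n)).
have tp n : test (phi n) by case: (hphi n).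
(* [dirichlet_close] with parameter 1, energy at most 1 and error at most 1 gives [2 + 2 * 2]. *)
have dp n : dirichlet Omega (phi n) <= 6.
  have [t c] := hphi n.
  have := dirichlet_close oO OL c t ltr01.
  have n1 : n.+1%:R^-1 <= 1 :> R by rewrite invf_le1 ?ltr0n// ler1n.
  have := X1 n; rewrite /n2 /ipV invr1.
  move: (ipW _ _) (dirichlet _ _) => x y x1 h; apply: le_trans h _.
  by move: (n.+1%:R^-1) n1 => r r1; lra.
(* Two triangle inequalities for squares give the weights 2, 4 and 4, which leave a total of
   [10 * (e / 16)]. *)
move=> e e0; have e8 : 0 < e / 16 by rewrite divr_gt0.
have [A [UA hA]] := rellich_test oO L0 OL UU tp dp e8.
have [N hN] : exists N : nat, forall n, (N <= n)%N -> n.+1%:R^-1 < e / 16.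
  exists (Num.truncn (e / 16)^-1) => n Nn; rewrite -[ltRHS]invrK ltf_pV2 ?posrE ?invr_gt0 ?ltr0n//.
  by apply: (lt_le_trans (truncnS_gt _)); rewrite ler_nat ltnS.
have UN : U [set n | (N <= n)%N] by apply: Uoo; exists N.
exists (A `&` [set n | (N <= n)%N]); split; first exact: filterI.
move=> n m [An /= Nn] [Am /= Nm]; rewrite l2_sub.
have [tn [cn _]] := hphi n; have [tm [cm _]] := hphi m.
have h1 := Int_sub_sqr_le oO (rL (X n)) (test_L2 oO OL tn) (rL (X m)).
have h2 := Int_sub_sqr_le oO (test_L2 oO OL tn) (test_L2 oO OL tm) (rL (X m)).
have c1 : Int (fun z => (rlV (X n) z - phi n z) ^+ 2) < e / 16 by apply: lt_trans cn (hN _ Nn).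
have c2 : Int (fun z => (phi m z - rlV (X m) z) ^+ 2) < e / 16.
  apply: lt_trans (hN _ Nm); move: cm; congr (_ < _); apply: eq_Int => // z _.
  by rewrite -sqrrN opprB.
have c3 := hA n m An Am.
apply: (le_lt_trans h1).
move: e0 h2 c1 c2 c3; move: (Int _) (Int _) (Int _) (Int _) => p q r s; lra.
Qed.

(** The witness is the smoothed absolute value of a test function close to [x]: it has no more
    energy than that function, and its L2 distance to the absolute value of [x] is controlled by the
    smoothing parameter and the approximation error. *)
Lemma space_abs (x : space) (e : R) : 0 < e -> exists w,
  n2 ipV w <= n2 ipV x + e /\ Int (fun p => (rlV w p - `|rlV x p|) ^+ 2) <= e.
Proof.
move=> e0; have xe : ipW (sval x) (sval x) < n2 ipV x + e by rewrite ltrDl.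
have [d [d0 hd]] := closeW_dirichlet oO OL (svalP x) xe.
pose d' := Num.min d (e / 4).
have d'0 : 0 < d' by rewrite lt_min d0 divr_gt0.
have [phi [t c]] := (W012P _).1 (svalP x) _ d'0.
have dE : dirichlet Omega phi <= n2 ipV x + e.
  by apply: (hd phi d') => //; rewrite ge_min lexx.
pose Om := Int (fun=> 1).
have Om0 : 0 <= Om by apply: Int_ge0.
(* Chosen so that [eta^2] times the measure of [Omega] is at most [e / 4]. *)
pose eta := Num.sqrt (e / (4 * (Om + 1))).
have k0 : 0 < 4 * (Om + 1) by rewrite mulr_gt0// ltr_wpDl.
have eta0 : 0 < eta by rewrite sqrtr_gt0 divr_gt0.
have ta := test_smooth_abs eta0 t.
exists (exist _ (testW oO L0 OL ta) (testW_W012 oO L0 OL ta)); split.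
  apply: le_trans dE.
  have -> : n2 ipV (exist _ (testW oO L0 OL ta) (testW_W012 oO L0 OL ta)) = dirichlet Omega (smooth_abs phi eta).
    by rewrite /n2 /ipV (ipWuE oO) !gr_mkW (dirichletE oO OL).
  rewrite /dirichlet; apply: Int_le => //.
  - by apply: itgD => //; exact: (test_partial_L2 oO OL _ ta).2.
  - by apply: itgD => //; exact: (test_partial_L2 oO OL _ t).2.
  move=> z _; have hp i := smooth_abs_partial eta0 i z (test_smooth t).
  have sq i : partial i (smooth_abs phi eta) z ^+ 2 <= partial i phi z ^+ 2.
    rewrite -[leLHS]real_normK ?num_real// -[leRHS]real_normK ?num_real//.
    by rewrite ler_pXn2r ?nnegrE.
  exact: lerD.
rewrite /rlV /=.
have cn := norm_continuous2 (test_cont t).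
have nL := cont_L2 oO OL cn.
have xL : L2 (fun p => `|sval x p|).
  split; first by apply: (measurableT_comp (@normr_measurable _ setT)); exact: (rL x).1.
  by apply: eq_itg (rL x).2 => // z _; rewrite real_normK ?num_real.
have h := Int_sub_sqr_le oO (test_L2 oO OL ta) nL xL.
apply: le_trans h _.
have i1 : Int (fun z => (smooth_abs phi eta z - `|phi z|) ^+ 2) <= e / 4.
  apply: (@le_trans _ _ (Int (fun=> eta ^+ 2 * 1))).
    apply: Int_le => //.
    - exact: (L2_sub mO (test_L2 oO OL ta) nL).2.
    - by apply: (itg_omega oO OL); exact: cst_continuous.
    move=> z _; rewrite mulr1 -[leLHS]real_normK ?num_real//.
    by rewrite ler_pXn2r ?nnegrE ?(ltW eta0)//; exact: smooth_abs_close.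
  rewrite IntZ//; last by apply: (itg_omega oO OL); exact: cst_continuous.
  rewrite -/Om sqr_sqrtr ?divr_ge0 ?(ltW e0) ?(ltW k0)//.
  have O1 : 0 < Om + 1 by rewrite ltr_wpDl.
  have -> : e / (4 * (Om + 1)) * Om = e / 4 * (Om / (Om + 1)) by field; rewrite gt_eqF.
  apply: ler_piMr; first by rewrite divr_ge0// ltW.
  by rewrite ler_pdivrMr// mul1r lerDl.
have i2 : Int (fun z => (`|phi z| - `|sval x z|) ^+ 2) <= e / 4.
  apply: (@le_trans _ _ (Int (fun z => (sval x z - phi z) ^+ 2))).
    apply: Int_le => //.
    - exact: (L2_sub mO nL xL).2.
    - exact: (L2_sub mO (rL x) (test_L2 oO OL t)).2.
    move=> z _; rewrite -[leLHS]real_normK ?num_real// -[leRHS]real_normK ?num_real//.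
    by rewrite ler_pXn2r ?nnegrE// [leRHS]distrC ler_dist_dist.
  by apply: ltW; apply: (lt_le_trans c.1); rewrite ge_min lexx orbT.
apply: (@le_trans _ _ (2 * (e / 4) + 2 * (e / 4))); first by rewrite lerD// ler_pM2l.
by rewrite le_eqVlt; apply/orP; left; apply/eqP; field.
Qed.

End Instance.

Lemma bounded_coord (R : realType) (Omega : set (R * R)) : bounded_set Omega ->
  exists L : R, 0 < L /\ forall z i, Omega z -> - L < coord i z < L.
Proof.
move=> [M [_ hM]]; exists (`|M| + 2); split; first by rewrite ltr_wpDl.
move=> z i Oz; rewrite -ltr_norml.
have h : `|z| <= `|M| + 1.
  by apply: hM => //; rewrite (le_lt_trans (ler_norm M))// ltrDl.
have : `|coord i z| <= `|z| by rewrite /Num.norm/= le_max; case: i; rewrite lexx ?orbT.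
by move=> h2; apply: (le_lt_trans (le_trans h2 h)); rewrite ltrD2l ltr1n.
Qed.

Lemma test0 (R : realType) (Omega : set (R * R)) : test_function Omega (fun=> 0 : R).
Proof.
have e : [set x : R * R | (0 : R) != 0] = set0.
  by apply/seteqP; split => z //=; rewrite eqxx.
split; first exact: smooth2_cst.
  by rewrite e closure0; exact: compact0.
by rewrite e closure0.
Qed.

(** * From extended norms and energies to the abstract setting *)

Section Translate.
Context {R : realType}.
Notation plane := (measurableTypeR R * measurableTypeR R)%type.
Notation mu2 := (@lebesgue2 R).
Variables (Omega : set (R * R)) (L : R).
Hypotheses (oO : open Omega) (L0 : 0 < L).
Hypothesis OL : forall z i, Omega z -> - L < coord i z < L.
Let mO : measurable (Omega : set plane) := omega_measurable oO.
Notation Int := (Int mu2 Omega).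
Notation itg := (itg mu2 Omega).

Lemma L2norm_vecE (F : R * R -> R * R) :
  L2 Omega (fun z => (F z).1) -> L2 Omega (fun z => (F z).2) ->
  L2norm_vec Omega F =
  (Num.sqrt (Int (fun z => (F z).1 ^+ 2) + Int (fun z => (F z).2 ^+ 2)))%:E.
Proof.
move=> h1 h2; have e z : euclid (F z) ^+ 2 = (F z).1 ^+ 2 + (F z).2 ^+ 2.
  by rewrite sqr_sqrtr// addr_ge0// sqr_ge0.
have i : itg (fun z => euclid (F z) ^+ 2).
  by apply: eq_itg (itgD mO h1.2 h2.2) => // z _; rewrite e.
rewrite /L2norm_vec (L2normI mO i) -(IntD mO h1.2 h2.2); congr (Num.sqrt _)%:E.
by apply: eq_Int => // z _; rewrite e.
Qed.

Lemma norm_grad (u : W12 Omega) : L2norm_vec Omega (grad u) = (Num.sqrt (ipW u u))%:E.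
Proof.
rewrite (L2norm_vecE (gr_L2 oO false u) (gr_L2 oO true u)).
by rewrite (ipWuE oO).
Qed.

Lemma unit_ballP (u : W12 Omega) : unit_ball u <-> W012 u /\ ipW u u <= 1.
Proof.
have s : (L2norm_vec Omega (grad u) <= 1)%E = (ipW u u <= 1).
  rewrite norm_grad lee_fin -[in RHS](sqr_sqrtr (ipW_ge0 oO u)).
  by rewrite expr_le1// sqrtr_ge0.
by split => -[h1 h2]; split => //; [rewrite -s|rewrite s].
Qed.

Lemma norm_grad_sub (x y : space Omega) :
  (L2norm_vec Omega (fun z => grad (sval x) z - grad (sval y) z)%R ^+ 2 =
  (n2 (@ipV R Omega) (sub (lcV oO OL) x y))%:E)%E.
Proof.
have h i := L2_sub mO (gr_L2 oO i (sval x)) (gr_L2 oO i (sval y)).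
rewrite (@L2norm_vecE (fun z => grad (sval x) z - grad (sval y) z) (h false) (h true)) -EFin_expe (ipV_sub oO OL) sqr_sqrtr//.
by rewrite addr_ge0//; apply: Int_ge0 => // z _; exact: sqr_ge0.
Qed.

(** Differences of energies are [a] times differences of [J a]: the measure of [Omega] cancels, and
    a stability constant [C] for [J a] becomes [a * C]. *)
Lemma energyE a (x : space Omega) : 0 < a -> a < 256^-1 -> n2 (@ipV R Omega) x <= 1 ->
  energy a (sval x) = (a * J mu2 Omega (@rlV R Omega) a x + Int (fun=> 1))%:E.
Proof.
move=> a0 a1 x1.
have [i0 _] := W012_trudinger oO L0 OL (svalP x) x1.
have i1 : itg (fun z => expR (a * sval x z ^+ 2)).
  apply: (itg_dom mO _ i0).
    have h : measurable_fun Omega ((fun z => a * sval x z ^+ 2) : plane -> R).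
      apply: measurable_funM; first exact: measurable_cst.
      by apply: measurable_funX; exact: (rlV_meas oO x).
    exact: (measurableT_comp (@measurable_expR R) h).
  move=> z _; rewrite ger0_norm ?expR_ge0// ler_expR; apply: ler_wpM2r; last exact: ltW.
  exact: sqr_ge0.
have ic : itg (fun=> 1) by apply: (itg_omega oO OL); exact: cst_continuous.
rewrite /energy (Int_fin mO i1); congr EFin.
have im : itg (fun z => mos a (rlV x z ^+ 2)).
  have := itgZ mO a^-1 (itgB mO i1 ic).
  by apply: eq_itg => // z _; rewrite /mos mulrC.
rewrite /J -(IntZ mO a im) -(IntD mO (itgZ mO a im) ic).
by apply: eq_Int => // z _; rewrite /mos /rlV; field; rewrite gt_eqF.
Qed.

End Translate.

Theorem theorem1 (R : realType) (Omega : set (R * R))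
  (Omega_open : open Omega) (Omega_bounded : bounded_set Omega)
  (Omega_smooth : smooth_boundary Omega) :
  exists alpha0 : R, 0 < alpha0 <= 4 * pi /\
    forall alpha : R, 0 < alpha < alpha0 ->
    exists C : R, 0 < C /\
      forall u : W12 Omega, unit_ball u ->
        (C%:E * ereal_inf
           [set L2norm_vec Omega (fun x => grad u x - grad v x)%R ^+ 2
             | v in optimizers alpha (Omega := Omega)]
         <= TM alpha Omega - energy alpha u)%E.
Proof.
have [L [L0 OL]] := bounded_coord Omega_bounded.
have mO := omega_measurable Omega_open.
have t0 := test0 Omega.
pose x0 : space Omega := exist _ (testW Omega_open L0 OL t0) (testW_W012 Omega_open L0 OL t0).
have [U [UU Uoo]] := ultraFilterLemma (eventually_filter : ProperFilter (\oo : set_system nat)).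
have K0 : 0 < TM_bound Omega + 1.
  rewrite ltr_wpDl// /TM_bound.
  have O0 : 0 <= Int (@lebesgue2 R) Omega (fun=> 1) by apply: Int_ge0.
  have e1 : expR (- 8^-1) <= 1 :> R by rewrite expR_le1 oppr_le0 invr_ge0.
  apply: mulr_ge0; last by rewrite invr_ge0 subr_ge0.
  by apply: mulr_ge0; [exact: mulr_ge0|exact: expR_ge0].
have b0 : 0 < 256^-1 :> R by rewrite invr_gt0.
have [a0 [a00 H]] := stability mO (@ipV_sym R Omega) (ipV_lc Omega_open OL)
  (ipV_ge0 Omega_open) (rlV_lc Omega_open OL) (rlV_meas Omega_open) b0 K0
  (fun x x1 => (W012_trudinger Omega_open L0 OL (svalP x) x1).1)
  (fun x x1 => (W012_trudinger Omega_open L0 OL (svalP x) x1).2)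
  Uoo (@space_complete R Omega L Omega_open L0 OL) (fun X => @space_compact _ _ _ Omega_open L0 OL U UU X Uoo)
  (space_abs Omega_open L0 OL) x0.
(* [a0] comes from the abstract theorem, 1/256 is the range in which [energyE] applies, and [4 * pi]
   is the upper limit for [alpha0] in the statement. *)
exists (Num.min (Num.min a0 256^-1) (4 * pi)); split.
  by rewrite !lt_min a00 b0 mulr_gt0 ?pi_gt0//= ge_min lexx orbT.
move=> a /andP[ap]; rewrite !lt_min => /andP[/andP[aa0 ab] _].
have [C [C0 HC]] := H a (introT andP (conj ap aa0)).
exists (a * C); split; first exact: mulr_gt0.
move=> u /(unit_ballP Omega_open)[Wu u1].
pose x : space Omega := exist _ u Wu.
have [v [[v1 vmax] hv]] := HC x u1.
have en := energyE Omega_open L0 OL ap ab.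
have TMv : TM a Omega = energy a (sval v).
  apply/eqP; rewrite eq_le; apply/andP; split.
    apply: ge_ereal_sup => _ [w /(unit_ballP Omega_open)[Ww w1] <-].
    rewrite (en (exist _ w Ww) w1) (en v v1) lee_fin lerD2r ler_pM2l//.
    exact: vmax.
  apply: ereal_sup_ubound; exists (sval v) => //.
  by apply/(unit_ballP Omega_open); split; [exact: svalP|exact: v1].
rewrite TMv (en v v1) (en x u1) -EFinB.
apply: (@le_trans _ _ ((a * C)%:E * (n2 (@ipV R Omega) (sub (lcV Omega_open OL) x v))%:E)%E).
  apply: lee_wpmul2l; first by rewrite lee_fin mulr_ge0// ltW.
  (* The infimum is bounded by its value at one optimizer, the [v] that stability supplies for this
     [u]. *)
  apply: ereal_inf_lbound; exists (sval v); last exact: (norm_grad_sub Omega_open OL x v).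
  split; last by rewrite TMv.
  by apply/(unit_ballP Omega_open); split; [exact: svalP|exact: v1].
rewrite -EFinM lee_fin -mulrA opprD addrACA subrr addr0 -mulrBr ler_pM2l//.
Qed.
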